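(* Let $T>0$, $H\in(0,1)$, and let $W^{H}$ be a one-dimensional fractional Brownian motion with Hurst index $H$. There is a constant $C>0$, independent of $g$, such that for every deterministic $g\in L^{2}([0,T])$ with ${}_{0}\partial_{t}^{\frac{1-2H}{2}}g\in L^{2}([0,T])$, $$\mathbb{E}\left(\int_{0}^{T} g(r)\,dW^{H}(r)\int_{0}^{T} g(r)\,dW^{H}(r)\right)\leq C\left\|{}_{0}\partial_{t}^{\frac{1-2H}{2}}g\right\|_{L^{2}([0,T])}^{2}$$ and $$\mathbb{E}\left(\int_{0}^{T} g(T-r)\,dW^{H}(r)\int_{0}^{T} g(T-r)\,dW^{H}(r)\right)\leq C\left\|{}_{0}\partial_{t}^{\frac{1-2H}{2}}g\right\|_{L^{2}([0,T])}^{2}.$$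
   Context: Riemann-Liouville operators on $[0,T]$: for $\nu>0$, ${}_{0}\partial_{t}^{-\nu}g(t)=\frac{1}{\Gamma(\nu)}\int_{0}^{t}(t-\xi)^{\nu-1}g(\xi)\,d\xi$ (fractional integral); for $\nu\in(0,1)$, ${}_{0}\partial_{t}^{\nu}g(t)=\frac{1}{\Gamma(1-\nu)}\frac{\partial}{\partial t}\int_{0}^{t}(t-\xi)^{-\nu}g(\xi)\,d\xi$ (fractional derivative); ${}_{0}\partial_{t}^{0}$ is the identity. Thus ${}_{0}\partial_{t}^{\frac{1-2H}{2}}$ is a fractional derivative if $H<1/2$, the identity if $H=1/2$, and a fractional integral if $H>1/2$. The stochastic integral of a deterministic integrand against $W^{H}$ is the usual Wiener integral, with the isometries: for $H=1/2$, $\mathbb{E}\big[\int_0^T g_1\,dW^{H}\int_0^T g_2\,dW^{H}\big]=\int_0^T g_1g_2\,dr$; for $H\in(1/2,1)$ and $g_1,g_2\in L^2([0,T])$, $$\mathbb{E}\Big[\int_0^T g_1\,dW^{H}\int_0^T g_2\,dW^{H}\Big]=H(2H-1)\int_0^T\int_0^T g_1(r_1)g_2(r_2)|r_1-r_2|^{2H-2}\,dr_1dr_2;$$ for $H\in(0,1/2)$ and $g_1,g_2\in H_0^{\frac{1-2H}{2}}([0,T])$ (functions in the fractional Sobolev space $H^{\frac{1-2H}{2}}(\mathbb{R})$ supported in $[0,T]$; functions on $[0,T]$ are extended by zero to $\mathbb{R}$), $$\mathbb{E}\Big[\int_0^T g_1\,dW^{H}\int_0^T g_2\,dW^{H}\Big]=\tfrac12H(1-2H)\int_{\mathbb{R}}\int_{\mathbb{R}}\frac{(g_1(r_1)-g_1(r_2))(g_2(r_1)-g_2(r_2))}{|r_1-r_2|^{2-2H}}\,dr_1dr_2.$$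 *)

(* Defs.v *)
From HB Require Import structures.
From mathcomp Require Import all_boot all_order all_algebra.
From mathcomp Require Import all_classical all_reals all_analysis.

Set Implicit Arguments.
Unset Strict Implicit.
Unset Printing Implicit Defensive.

Import Order.TTheory GRing.Theory Num.Theory.
Import numFieldNormedType.Exports.
Local Open Scope classical_set_scope.
Local Open Scope ring_scope.

(* A function on [0, T] is represented by any g : R -> R; only its values on
   [0, T] matter, and its extension by zero to the line is [g \_ `[0, T]]. *)

Definition L2_on {R : realType} (T : R) (g : R -> R) : Prop :=
  g \_ `[0, T] \in Lfun (@lebesgue_measure R) 2%:E.

Definition L2_norm_on {R : realType} (T : R) (g : R -> R) : \bar R :=
  'N[@lebesgue_measure R]_(2%:E)[EFin \o (g \_ `[0, T])].

Definition Gamma {R : realType} (nu : R) : R :=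
  \int[@lebesgue_measure R]_(x in `]0, +oo[) (x `^ (nu - 1) * expR (- x)).

Definition RL_integral {R : realType} (nu : R) (g : R -> R) (t : R) : R :=
  (Gamma nu)^-1 *
  \int[@lebesgue_measure R]_(xi in `[0, t]) ((t - xi) `^ (nu - 1) * g xi).

(* F has an absolutely continuous representative on [0, T] whose derivative
   is h, i.e. h is the weak derivative of F on ]0, T[.  A classical derivative
   existing only almost everywhere would not be enough: there are non-zero g
   in L^2 for which RL_integral (1 - nu) g is continuous and singular. *)
Definition is_derivative_on {R : realType} (T : R) (F h : R -> R) : Prop :=
  (@lebesgue_measure R).-integrable `[0, T] (EFin \o h) /\
  exists c : R, {ae @lebesgue_measure R, forall t, t \in `[0, T] ->
    F t = c + \int[@lebesgue_measure R]_(xi in `[0, t]) h xi}.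

(* h is the derivative of order nu, 0 < nu < 1; in RL_integral (1 - nu) the
   kernel is (t - xi) ^ (- nu) and the factor is 1 / Gamma (1 - nu). *)
Definition is_RL_derivative {R : realType} (T nu : R) (g h : R -> R) : Prop :=
  is_derivative_on T (RL_integral (1 - nu) g) h.

(* h is (a version of) the Riemann-Liouville operator of signed order s,
   -1 < s < 1, applied to g on [0, T]. *)
Definition is_RL {R : realType} (T s : R) (g h : R -> R) : Prop :=
  if 0 < s then is_RL_derivative T s g h
  else if s == 0 then
    {ae @lebesgue_measure R, forall t, t \in `[0, T] -> h t = g t}
  else
    {ae @lebesgue_measure R, forall t, t \in `[0, T] ->
      h t = RL_integral (- s) g t}.

(* The fractional Sobolev space H^s(R) for 0 < s < 1. *)
Definition frac_sobolev {R : realType} (s : R) (u : R -> R) : Prop :=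
  u \in Lfun (@lebesgue_measure R) 2%:E /\
  (\int[@lebesgue_measure R]_x \int[@lebesgue_measure R]_y
    ((u x - u y) ^+ 2 / `|x - y| `^ (1 + 2 * s))%:E < +oo)%E.

(* Degenerate laws are treated apart because [normal_prob m 0] is not the
   Dirac mass at m. *)
Definition gaussian_rv {R : realType} {d : measure_display}
    {Omega : measurableType d} (P : probability Omega R) (X : Omega -> R) : Prop :=
  measurable_fun [set: Omega] X /\
  exists m : R,
    {ae P, forall w, X w = m} \/
    (exists2 s : R, 0 < s & forall A : set R, measurable A ->
       P (X @^-1` A) = normal_prob m s A).

Record is_fBm {R : realType} {d : measure_display} {Omega : measurableType d}
    (P : probability Omega R) (H : R) (W : R -> {RV P >-> R}) : Prop := IsFBm {
  fBm_gaussian : forall (n : nat) (a t : 'I_n -> R), (forall i, 0 <= t i) ->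
    gaussian_rv P (fun w => \sum_(i < n) a i * W (t i) w) ;
  fBm_centered : forall t : R, 0 <= t -> ('E_P[W t] = 0)%E ;
  fBm_covariance : forall s t : R, 0 <= s -> 0 <= t ->
    covariance P (W s) (W t) =
      (2^-1 * (s `^ (2 * H) + t `^ (2 * H) - `|t - s| `^ (2 * H)))%:E ;
  fBm_continuous : {ae P, forall w,
    {within `[0, +oo[, continuous (fun t : R => W t w)}} }.

Arguments is_fBm {R d Omega} P H W.

Definition integrand {R : realType} (T H : R) (g : R -> R) : Prop :=
  if H < 2^-1 then frac_sobolev ((1 - 2 * H) / 2) (g \_ `[0, T])
  else L2_on T g.

Definition integrand_prod {R : realType} (T H : R) (g1 g2 : R -> R) : \bar R :=
  (if (H < 2^-1)%R then
     (2^-1 * H * (1 - 2 * H))%:E *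
     \int[@lebesgue_measure R]_x \int[@lebesgue_measure R]_y
       (((g1 \_ `[0, T]) x - (g1 \_ `[0, T]) y) *
        ((g2 \_ `[0, T]) x - (g2 \_ `[0, T]) y) / `|x - y| `^ (2 - 2 * H))%:E
   else if (H == 2^-1)%R then
     \int[@lebesgue_measure R]_(x in `[0%R, T]) (g1 x * g2 x)%:E
   else
     (H * (2 * H - 1))%:E *
     \int[@lebesgue_measure R]_(x in `[0%R, T]) \int[@lebesgue_measure R]_(y in `[0%R, T])
       (g1 x * g2 y * `|x - y| `^ (2 * H - 2))%:E)%E.

(* [I g] is the Wiener integral of g against W over [0, T]: the linear
   isometry from the space of integrands into L^2(P) that maps the indicator
   of [0, t] to W t.  As step functions are dense in the space of integrands,
   this determines [I g] almost surely; nothing is assumed about [I g] when g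
   is not an integrand. *)
Record is_wiener_integral {R : realType} {d : measure_display}
    {Omega : measurableType d} (P : probability Omega R) (T H : R)
    (W : R -> {RV P >-> R}) (I : (R -> R) -> Omega -> R) : Prop :=
  IsWienerIntegral {
  wiener_L2 : forall g, integrand T H g -> I g \in Lfun P 2%:E ;
  wiener_indic : forall t : R, t \in `[0, T] ->
    {ae P, forall w, I \1_(`[0, t]) w = W t w} ;
  wiener_linear : forall (a : R) (g1 g2 : R -> R),
    integrand T H g1 -> integrand T H g2 ->
    {ae P, forall w, I (fun r => a * g1 r + g2 r) w = a * I g1 w + I g2 w} ;
  wiener_isometry : forall g1 g2 : R -> R,
    integrand T H g1 -> integrand T H g2 ->
    ('E_P[I g1 \* I g2] = integrand_prod T H g1 g2)%E }.

Arguments is_wiener_integral {R d Omega} P T H W I.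

(* Main.v *)
(* Put J^p f (t) = \int_{y < t} (t - y)^(p - 1) f(y) dy and let G be the extension
   of g by zero.

   For H > 1/2 and nu = H - 1/2, the energy A of G for the kernel
   |x - y|^(2 nu - 1) equals, up to beta factors, both the integral over the line
   of J_+ J_- and that of J_-^2, where J_+ and J_- are the left and right
   fractional integrals of order nu of G.  As J_+ vanishes before 0 and J_- after
   T, the first integral runs over [0, T] only; by AM-GM it is at most
   l ||J_+||^2_{L^2(0, T)} + A / (C l), and a large l lets A absorb the last term.

   For H < 1/2 and s = (1 - 2 H) / 2, the variance is the Gagliardo seminorm S of
   order s of G.  Applying J^s to the hypothesis on the derivative h shows that G
   is a multiple of v = J^s h on [0, T].  If h is a step function, then v is a
   combination \sum_i e_i w(x - t_i) of translates of w(x) = x_+^s with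
   \sum_i e_i = 0.  A quadratic form in such a combination only depends on its
   values on the differences w(x - t_i) - w(x - t_j), and by scaling both
   S(w(x - a) - w(x - b)) and the squared L^2 norm of 1_{]a, b]} are proportional
   to |a - b|; hence S(v) = C ||h||^2 exactly.  Averages over grids, Lebesgue
   differentiation, truncation and Fatou's lemma extend S(v) <= C ||h||^2 to all h
   in L^2.  Cutting v off at T adds at most C \int v^2 (T - x)^(-2 s) dx, which a
   Hardy inequality, proved by Schur's test with the weight (T - y)^(1/2), bounds
   by ||h||^2. *)

(* The obstacle in both regimes is the half-line beyond T: the right-hand side only sees [0, T],
   while the potentials of functions supported in [0, T] do not vanish after T. Pairing J_+ with J_-
   hides this tail for H > 1/2; for H < 1/2 it has to be cut off.

   No Fourier transform is used; homogeneity takes its place. A single translate of x_+^s has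
   infinite seminorm of order s and only differences have finite energy, so step functions are
   written with Heaviside functions of zero total weight.

   For H < 1/2 the hypothesis determines the fractional integral of g only up to a constant k. Such
   a constant would add a multiple of x^(s - 1) to G, which is not square integrable near 0 as s <
   1/2; the proof finds k = 0 by letting t tend to 0 in the hypothesis.

   Real-valued integrals are 0 where they diverge. Identities between iterated integrals are
   therefore derived from absolute convergence, at every point or almost everywhere.

   The second inequality follows from the first, because all three covariances are invariant under r
   -> T - r. *)
Require Import Defs.
From HB Require Import structures.
From mathcomp Require Import all_boot all_order all_algebra.
From mathcomp Require Import all_classical all_reals all_analysis.
From mathcomp Require Import measurable_realfun ring lra.
Import Order.TTheory GRing.Theory Num.Theory.
Import numFieldNormedType.Exports.
Local Open Scope classical_set_scope.
Local Open Scope ring_scope.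
Set Implicit Arguments.
Unset Strict Implicit.
Unset Printing Implicit Defensive.

(** * Affine changes of variables and power kernels *)

Section affine.
Context {R : realType}.
Local Notation mu := (@lebesgue_measure R).

Lemma measurable_affine (a b : R) : measurable_fun [set: R] (fun x => a * x + b).
Proof. by apply: measurable_realfun.measurable_funD => //; apply: measurable_funM. Qed.

(** Lebesgue measure is determined by its values on the intervals ]p, q]. For a < 0 the preimage of
    such an interval is closed on the left instead of the right, which does not change its
    length. *)
Lemma lebesgue_measure_affine (a b : R) (A : set R) : a != 0 -> measurable A ->
  mu A = (`|a|%:E * mu ((fun x : R => (a * x + b)%R) @^-1` A))%E.
Proof.
move=> a0 mA.
pose phi : measurableTypeR R -> measurableTypeR R := fun x => a * x + b.
have mphi : measurable_fun [set: R] phi by exact: measurable_affine.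
pose k := NngNum (normr_ge0 a).
pose pm : {measure set (measurableTypeR R) -> \bar R} :=
  mscale k (pushforward mu phi).
suff : mu A = pm mphi A by [].
apply: lebesgue_measure_unique => //= _ [[p q]] _ <-.
rewrite /pm /mscale/= /pushforward.
have [apos|aneg] := ltP 0 a.
  have -> : phi @^-1` `]p, q]%classic = `](p - b) / a, (q - b) / a]%classic.
    by apply/seteqP; split => x /=; rewrite !in_itv/= /phi ltr_pdivrMr// ler_pdivlMr//
      ltrBlDr lerBrDr mulrC.
  rewrite !lebesgue_measure_itv/= !lte_fin.
  rewrite ltr_pdivrMr// divfK// ltrD2r; case: ifP => _; last by rewrite mule0.
  by rewrite -!EFinD -EFinM gtr0_norm//; congr EFin; field.
have {a0}aneg : a < 0 by rewrite lt_neqAle a0.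
have -> : phi @^-1` `]p, q]%classic = `[(q - b) / a, (p - b) / a[%classic.
  by apply/seteqP; split => x /=; rewrite !in_itv/= /phi ltr_ndivlMr// ler_ndivrMr//
    andbC ltrBlDr lerBrDr mulrC.
rewrite !lebesgue_measure_itv/= !lte_fin ltr_ndivlMr// divfK ?lt_eqF//.
rewrite ltrD2r; case: ifP => _; last by rewrite mule0.
by rewrite -!EFinD -EFinM ltr0_norm//; congr EFin; field; rewrite lt_eqF.
Qed.

Lemma ge0_integral_affine (a b : R) (f : R -> \bar R) : a != 0 ->
  measurable_fun [set: R] f -> (forall x, 0 <= f x)%E ->
  (\int[mu]_x f (a * x + b)%R = (`|a|^-1)%:E * \int[mu]_x f x)%E.
Proof.
move=> a0 mf f0.
pose phi : measurableTypeR R -> measurableTypeR R := fun x => a * x + b.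
have mphi : measurable_fun [set: R] phi by exact: measurable_affine.
pose k := NngNum (normr_ge0 a).
pose pm : {measure set (measurableTypeR R) -> \bar R} :=
  mscale k (pushforward mu phi).
have -> : (\int[mu]_x f x = \int[pm mphi]_x f x)%E.
  apply: eq_measure_integral => A mA _.
  exact: (lebesgue_measure_affine b a0).
rewrite ge0_integral_mscale// (@ge0_integral_pushforward _ _ _ _ _ phi)//= preimage_setT.
by rewrite muleA -EFinM mulVf ?mul1e// normr_eq0.
Qed.

Lemma ge0_integral_shift (b : R) (f : R -> \bar R) :
  measurable_fun [set: R] f -> (forall x, 0 <= f x)%E ->
  (\int[mu]_x f (x + b)%R = \int[mu]_x f x)%E.
Proof.
move=> mf f0; have := @ge0_integral_affine 1 b f (oner_neq0 _) mf f0.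
by rewrite normr1 invr1 mul1e => <-; apply: eq_integral => x _; rewrite mul1r.
Qed.

Lemma ge0_integral_reflect (b : R) (f : R -> \bar R) :
  measurable_fun [set: R] f -> (forall x, 0 <= f x)%E ->
  (\int[mu]_x f (b - x)%R = \int[mu]_x f x)%E.
Proof.
move=> mf f0; have N1 : (-1 : R) != 0 by rewrite oppr_eq0 oner_eq0.
have := ge0_integral_affine b N1 mf f0.
by rewrite normrN1 invr1 mul1e => <-; apply: eq_integral => x _; rewrite mulN1r addrC.
Qed.

(** Positive and negative parts are reflected separately, so that no integrability is required; this
    serves the signed energy for H > 1/2. *)
Lemma integral_reflect (b : R) (f : R -> \bar R) : measurable_fun [set: R] f ->
  (\int[mu]_x f (b - x)%R = \int[mu]_x f x)%E.
Proof.
move=> mf; rewrite integralE [RHS]integralE.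
rewrite -(@ge0_integral_reflect b f^\+%E); [|exact: measurable_funepos|by []].
rewrite -(@ge0_integral_reflect b f^\-%E); [|exact: measurable_funeneg|by []].
by congr (_ - _)%E; apply: eq_integral => x _; rewrite ?funeposE ?funenegE.
Qed.

End affine.

(** * Truncated powers and their integrability at 0 and at infinity *)

Section truncated_power.
Context {R : realType}.
Local Notation mu := (@lebesgue_measure R).

(* Truncated powers let all kernels live on the whole line; note that
   [tpow 0 0 = 0] whereas [0 `^ 0 = 1]. *)
Definition tpow (a x : R) : R := if 0 < x then x `^ a else 0.

Lemma tpow_ge0 a x : 0 <= tpow a x.
Proof. by rewrite /tpow; case: ifP => // _; exact: powR_ge0. Qed.

Lemma tpowE a x : 0 < x -> tpow a x = x `^ a.
Proof. by rewrite /tpow => ->. Qed.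

Lemma tpow_le0 a x : x <= 0 -> tpow a x = 0.
Proof. by rewrite /tpow leNgt => /negbTE ->. Qed.

Lemma tpow_gt0 a x : 0 < x -> 0 < tpow a x.
Proof. by move=> x0; rewrite tpowE// powR_gt0. Qed.

Lemma tpowZ a c x : 0 < c -> tpow a (c * x) = c `^ a * tpow a x.
Proof.
move=> c0; rewrite /tpow pmulr_rgt0//; case: ifP => [x0|_]; last by rewrite mulr0.
by rewrite powRM// ltW.
Qed.

Lemma tpowD a b x : tpow (a + b) x = tpow a x * tpow b x.
Proof.
rewrite /tpow; case: ifP => [x0|_]; last by rewrite mulr0.
by rewrite powRD//; apply/implyP => _; rewrite gt_eqF.
Qed.

Lemma measurable_tpow a : measurable_fun [set: R] (tpow a).
Proof.
apply: measurable_fun_if => //; first exact: measurable_fun_ltr.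
by apply: measurable_funTS; exact: measurable_powR.
Qed.

Lemma integral_powR_itv (a p q : R) : a != -1 -> 0 < p -> p < q ->
  (\int[mu]_(x in `[p, q]) (x `^ a)%:E =
   ((q `^ (a + 1) - p `^ (a + 1)) / (a + 1))%:E)%E.
Proof.
move=> a1 p0 pq.
have a10 : a + 1 != 0 by rewrite -[1]opprK subr_eq0.
pose F (x : R) := (a + 1)^-1 * x `^ (a + 1).
have dF (x : R) : 0 < x -> is_derive x 1 F (x `^ a).
  move=> x0; have -> : x `^ a = (a + 1)^-1 *: ((a + 1) * x `^ (a + 1 - 1)).
    by rewrite addrK -mulr_algl scaler1 mulKf.
  by apply: is_deriveZ; exact: is_derive1_powR.
have cpow (b x : R) : 0 < x -> {for x, continuous (fun y : R => y `^ b)}.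
  move=> x0; apply/differentiable_continuous/derivable1_diffP.
  by apply: derivable_powR; rewrite in_itv/= x0.
have cF (x : R) : 0 < x -> {for x, continuous F}.
  move=> x0; apply/differentiable_continuous/derivable1_diffP.
  by have [] := dF _ x0.
rewrite (@continuous_FTC2 _ _ F)//.
- by rewrite -EFinB; congr EFin; rewrite /F; field.
- apply: continuous_in_subspaceT => x; rewrite inE/= in_itv/= => /andP[px _].
  by apply: cpow; apply: lt_le_trans px.
- split.
  + by move=> x; rewrite in_itv/= => /andP[px _]; have [] := dF _ (lt_trans p0 px).
  + exact/cvg_at_right_filter/cF.
  + by apply/cvg_at_left_filter/cF; exact: lt_trans pq.
- move=> x; rewrite in_itv/= => /andP[px _].
  by rewrite derive1E; have /(@derive_val _ _ _ _ _ _ _ ) -> := dF _ (lt_trans p0 px).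
Qed.

(** Monotone convergence along an exhaustion: uniform bounds on compact intervals of ]0, +oo[ give
    the finiteness of the two improper integrals below. *)
Lemma ge0_integral_bigcup_le (F : (set R)^nat) (D : set R) (f : R -> \bar R) (M : \bar R) :
  nondecreasing_seq F -> (forall i, measurable (F i)) -> measurable D ->
  D `<=` \bigcup_i F i -> measurable_fun [set: R] f -> (forall x, 0 <= f x)%E ->
  (forall i, \int[mu]_(x in F i) f x <= M)%E -> (\int[mu]_(x in D) f x <= M)%E.
Proof.
move=> ndF mF mD DF mf f0 fM.
apply: (@le_trans _ _ (\int[mu]_(x in \bigcup_i F i) f x)%E).
  apply: ge0_subset_integral => //; first exact: bigcupT_measurable.
  exact: measurable_funTS.
have cvgF : (\int[mu]_(x in F i) f x @[i --> \oo] --> \int[mu]_(x in \bigcup_i F i) f x)%E.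
  by apply: ge0_nondecreasing_set_cvg_integral => // i; exact: measurable_funTS.
rewrite -(cvg_lim _ cvgF)//; apply: lime_le; last exact: nearW.
by apply/cvg_ex; eexists; exact: cvgF.
Qed.

Lemma integral_tpow01_lty a : -1 < a -> (\int[mu]_(x in `]0%R, 1%R]) (tpow a x)%:E < +oo)%E.
Proof.
move=> a1.
have a10 : 0 < a + 1 by rewrite -ltrBlDr sub0r.
apply: (@le_lt_trans _ _ ((a + 1)^-1)%:E); last by rewrite ltry.
(* The index [n.+2] keeps every interval non-degenerate, as [integral_powR_itv] asks for [p < q]. *)
apply: (@ge0_integral_bigcup_le (fun n => `[n.+2%:R^-1, 1]%classic)) => //.
- apply/nondecreasing_seqP => n; apply/subsetPset => x /=; rewrite !in_itv/= => /andP[nx ->].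
  by rewrite (le_trans _ nx)// lef_pV2 ?posrE ?ltr0n// ler_nat.
- move=> x /=; rewrite in_itv/= => /andP[x0 x1].
  exists (Num.truncn x^-1) => //=; rewrite in_itv/= x1 andbT.
  rewrite invf_ple ?posrE ?ltr0n//; apply: ltW.
  apply: (lt_trans (Num.Theory.truncnS_gt _)); by rewrite ltr_nat.
- by apply/measurable_EFinP; exact: measurable_tpow.
- by move=> x; rewrite lee_fin tpow_ge0.
- move=> n; rewrite (_ : (\int[_]_(_ in _) _)%E =
    (\int[mu]_(x in `[n.+2%:R^-1%R, 1%R]) (x `^ a)%:E)%E); last first.
    apply: eq_integral => x; rewrite inE/= in_itv/= => /andP[nx _]; congr EFin.
    by apply: tpowE; rewrite (lt_le_trans _ nx)// invr_gt0 ltr0n.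
  rewrite integral_powR_itv//; last 2 first.
  + by rewrite gt_eqF.
  + by rewrite invf_lt1 ?ltr0n// ltr1n.
  by rewrite lee_fin powR1 -[leRHS]mul1r ler_pM2r ?invr_gt0// lerBlDr lerDl powR_ge0.
Qed.

Lemma integral_tpow1y_lty a : a < -1 -> (\int[mu]_(x in `[1%R, +oo[) (tpow a x)%:E < +oo)%E.
Proof.
move=> a1.
have a10 : a + 1 < 0 by rewrite -ltrBrDr sub0r.
apply: (@le_lt_trans _ _ (- (a + 1)^-1)%:E); last by rewrite ltry.
apply: (@ge0_integral_bigcup_le (fun n => `[1, n.+2%:R]%classic)) => //.
- apply/nondecreasing_seqP => n; apply/subsetPset => x /=; rewrite !in_itv/= => /andP[-> nx].
  by rewrite (le_trans nx)// ler_nat.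
- move=> x /=; rewrite in_itv/= andbT => x1.
  exists (Num.truncn x) => //=; rewrite in_itv/= x1/=.
  apply: ltW; apply: (lt_trans (Num.Theory.truncnS_gt _)); by rewrite ltr_nat.
- by apply/measurable_EFinP; exact: measurable_tpow.
- by move=> x; rewrite lee_fin tpow_ge0.
- move=> n; rewrite (_ : (\int[_]_(_ in _) _)%E =
    (\int[mu]_(x in `[1%R, n.+2%:R]) (x `^ a)%:E)%E); last first.
    apply: eq_integral => x; rewrite inE/= in_itv/= => /andP[nx _]; congr EFin.
    by apply: tpowE; rewrite (lt_le_trans _ nx).
  rewrite integral_powR_itv//; last 2 first.
  + by rewrite lt_eqF.
  + by rewrite ltr1n.
  rewrite lee_fin powR1 -[leRHS]mulN1r ler_nM2r ?invr_lt0//.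
  by rewrite lerBrDr addNr powR_ge0.
Qed.

End truncated_power.

Ltac measurable_step := match goal with
  | |- measurable_fun _ (fun x => EFin _) => apply/measurable_EFinP
  | |- measurable_fun _ (EFin \o _) => apply/measurable_EFinP
  | |- measurable_fun _ (fun x => fst x) => exact: measurable_fst
  | |- measurable_fun _ (fun x => snd x) => exact: measurable_snd
  | |- measurable_fun _ (fun x => x) => exact: measurable_id
  | |- measurable_fun _ (fun x => ?c) => exact: measurable_cst
  | |- measurable_fun _ (fun x => tpow _ _) => apply: (measurableT_comp (@measurable_tpow _ _))
  | |- measurable_fun _ (fun x => _ `^ _) => apply: (measurableT_comp (@measurable_powR _ _))
  | |- measurable_fun _ (fun x => `|_|) => apply: (measurableT_comp (@normr_measurable _ _))
  | |- measurable_fun _ (fun x => _ - _) => apply: measurable_funB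
  | |- measurable_fun _ (fun x => _ + _) => apply: measurable_funD
  | |- measurable_fun _ (fun x => - _) => apply: measurable_funN
  | |- measurable_fun _ (fun x => _ * _) => apply: measurable_funM
  | |- measurable_fun _ (fun x => _ ^+ _) => apply: measurable_funX
  | H : measurable_fun _ ?f |- measurable_fun _ ?f => exact: H
  | H : measurable_fun _ ?f |- measurable_fun _ (fun x => ?f _) =>
     apply: (measurableT_comp H)
  | _ => first
 [ exact: measurable_tpow | exact: measurable_powR | exact: normr_measurable
 | exact: measurable_cst | exact: measurable_id | exact: measurable_fst | exact: measurable_snd
 | assumption
 | apply: measurable_funB | apply: measurable_funD | apply: measurable_funN
 | apply: measurable_funM | apply: measurable_funX
 | apply: emeasurable_funD | apply: emeasurable_funM ] end.
Ltac solve_measurable := cbv beta; repeat measurable_step.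

(** * Beta integrals and convolutions of truncated powers *)

Section kernel_integrals.
Context {R : realType}.
Local Notation mu := (@lebesgue_measure R).
Local Notation tpow := (@tpow R).
Implicit Types a b c x y z : R.

Lemma mul_powR_tpow a x : 0 < x -> x * x `^ a = tpow (a + 1) x.
Proof.
move=> x0; rewrite tpowE// -[X in X * _]powRr1 ?ltW// -powRD; first by rewrite addrC.
by apply/implyP => _; rewrite gt_eqF.
Qed.

(** Powers are monotone, in a direction given by the sign of [a]; the sum of the two end values
    covers both cases. *)
Lemma powR_between a p q x : 0 < p -> p <= x -> x <= q -> x `^ a <= p `^ a + q `^ a.
Proof.
move=> p0 px xq; have x0 := lt_le_trans p0 px; have q0 := lt_le_trans x0 xq.
have [a0|/ltW a0] := leP 0 a.
  apply: ler_wpDl; first exact: powR_ge0.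
  by rewrite ge0_ler_powR// nnegrE ltW.
apply: ler_wpDr; first exact: powR_ge0.
rewrite -[a]opprK powRN [leRHS]powRN lef_pV2 ?posrE ?powR_gt0//.
by rewrite ge0_ler_powR ?oppr_ge0// nnegrE ltW.
Qed.

(* [Beta a b = B(a + 1, b + 1)] and [Beta' a b = B(a + 1, - a - b - 1)] for
   Euler's beta function B; each is +oo when its integral diverges. *)
Definition Beta a b : \bar R := (\int[mu]_z (tpow a z * tpow b (1 - z))%:E)%E.
Definition Beta' a b : \bar R := (\int[mu]_z (tpow a z * tpow b (1 + z))%:E)%E.

Lemma integral_restrict_lty (A : set R) (f : R -> R) : measurable A ->
  (\int[mu]_(x in A) (f x)%:E < +oo)%E -> (\int[mu]_x ((f \_ A) x)%:E < +oo)%E.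
Proof.
move=> mA; rewrite integral_mkcond.
by under eq_integral do rewrite restrict_EFin.
Qed.

(** Most integrands below have two critical places, such as a singularity and a tail, or two
    singularities; [g1] and [g2] take care of one each. *)
Lemma ge0_integral_dom2 (f g1 g2 : R -> R) (c1 c2 : R) :
  measurable_fun [set: R] f -> measurable_fun [set: R] g1 -> measurable_fun [set: R] g2 ->
  0 <= c1 -> 0 <= c2 -> (forall x, 0 <= f x) -> (forall x, 0 <= g1 x) -> (forall x, 0 <= g2 x) ->
  (forall x, f x <= c1 * g1 x + c2 * g2 x) ->
  (\int[mu]_x (g1 x)%:E < +oo)%E -> (\int[mu]_x (g2 x)%:E < +oo)%E ->
  (\int[mu]_x (f x)%:E < +oo)%E.
Proof.
move=> mf mg1 mg2 c10 c20 f0 g10 g20 fg i1 i2.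
apply: (@le_lt_trans _ _ (c1%:E * \int[mu]_x (g1 x)%:E + c2%:E * \int[mu]_x (g2 x)%:E)%E).
  rewrite -ge0_integralZl//; [|solve_measurable|by move=> x _; rewrite lee_fin].
  rewrite -ge0_integralZl//; [|solve_measurable|by move=> x _; rewrite lee_fin].
  rewrite -ge0_integralD//; last 4 first.
  - by move=> x _; rewrite lee_fin mulr_ge0.
  - by solve_measurable.
  - by move=> x _; rewrite lee_fin mulr_ge0.
  - by solve_measurable.
  apply: ge0_le_integral => //.
  - by move=> x _; rewrite lee_fin.
  - by solve_measurable.
  - by solve_measurable.
  - by move=> x _; rewrite -!EFinM -EFinD lee_fin.
by rewrite lte_add_pinfty// lte_mul_pinfty.
Qed.

Lemma restrict_tpow_ge0 a (A : set R) x : 0 <= (tpow a \_ A) x.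
Proof. by rewrite patchE; case: ifP => // _; exact: tpow_ge0. Qed.

Lemma measurable_restrict_tpow a (i : interval R) :
  measurable_fun [set: R] (tpow a \_ [set` i]).
Proof. by apply/(measurable_restrictT (tpow a)) => //; apply: measurable_funTS; exact: measurable_tpow. Qed.

(** On each side of 1/2 only one factor is singular and the other lies between its values at 1/2 and
    at 1. *)
Lemma Beta_lty a b : -1 < a -> -1 < b -> (Beta a b < +oo)%E.
Proof.
move=> a1 b1.
have Ia := integral_restrict_lty (measurable_itv _) (integral_tpow01_lty a1).
have Ib := integral_restrict_lty (measurable_itv _) (integral_tpow01_lty b1).
have ma := @measurable_restrict_tpow a `]0, 1].
have mb := @measurable_restrict_tpow b `]0, 1].
apply: (@ge0_integral_dom2 _ (tpow a \_ `]0, 1]) (fun x => (tpow b \_ `]0, 1]) (1 - x))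
   (2^-1 `^ b + 1 `^ b) (2^-1 `^ a + 1 `^ a)).
- by solve_measurable.
- exact: ma.
- by solve_measurable.
- by rewrite addr_ge0// powR_ge0.
- by rewrite addr_ge0// powR_ge0.
- by move=> x; rewrite mulr_ge0// tpow_ge0.
- by move=> x; exact: restrict_tpow_ge0.
- by move=> x; exact: restrict_tpow_ge0.
- move=> x.
  have [x0|x0] := leP x 0.
    rewrite tpow_le0// mul0r addr_ge0// mulr_ge0// ?addr_ge0 ?powR_ge0//;
    exact: restrict_tpow_ge0.
  have [x1|x1] := leP 1 x.
    rewrite [X in _ * X]tpow_le0 ?subr_le0// mulr0 addr_ge0// mulr_ge0// ?addr_ge0 ?powR_ge0//;
    exact: restrict_tpow_ge0.
  have hx : 0 < 1 - x by rewrite subr_gt0.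
  rewrite !patchE !mem_set/= ?in_itv/= ?x0 ?hx ?(ltW x1)//; last by rewrite lerBlDr lerDl ltW.
  rewrite !tpowE//.
  have [xh|xh] := leP x 2^-1.
    apply: ler_wpDr; first by rewrite mulr_ge0// ?addr_ge0 ?powR_ge0.
    rewrite mulrC ler_wpM2r ?powR_ge0//; apply: powR_between; lra.
  apply: ler_wpDl; first by rewrite mulr_ge0// ?addr_ge0 ?powR_ge0.
  rewrite ler_wpM2r ?powR_ge0//; apply: powR_between; lra.
- exact: Ia.
- rewrite (@ge0_integral_reflect _ 1 (EFin \o (tpow b \_ `]0, 1])))//; first by solve_measurable.
  by move=> x; rewrite lee_fin restrict_tpow_ge0.
Qed.

(** Up to 1 the second factor is bounded. Beyond 1 one has [x <= 1 + x <= 2 x], so that the product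
    is comparable to [x ^ (a + b)], integrable at infinity. *)
Lemma Beta'_lty a b : -1 < a -> a + b < -1 -> (Beta' a b < +oo)%E.
Proof.
move=> a1 ab1.
have Ia := integral_restrict_lty (measurable_itv _) (integral_tpow01_lty a1).
have Ib := integral_restrict_lty (measurable_itv _) (integral_tpow1y_lty ab1).
have ma := @measurable_restrict_tpow a `]0, 1].
have mb := @measurable_restrict_tpow (a + b) `[1, +oo[.
apply: (@ge0_integral_dom2 _ (tpow a \_ `]0, 1]) (tpow (a + b) \_ `[1, +oo[)
   (1 `^ b + 2 `^ b) (1 `^ b + 2 `^ b)).
- by solve_measurable.
- exact: ma.
- exact: mb.
- by rewrite addr_ge0// powR_ge0.
- by rewrite addr_ge0// powR_ge0.
- by move=> x; rewrite mulr_ge0// tpow_ge0.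
- by move=> x; exact: restrict_tpow_ge0.
- by move=> x; exact: restrict_tpow_ge0.
- move=> x.
  have [x0|x0] := leP x 0.
    rewrite tpow_le0// mul0r addr_ge0// mulr_ge0// ?addr_ge0 ?powR_ge0//;
    exact: restrict_tpow_ge0.
  have x10 : 0 < 1 + x by lra.
  have [x1|x1] := leP x 1.
    apply: ler_wpDr; first by rewrite mulr_ge0// ?addr_ge0 ?powR_ge0// restrict_tpow_ge0.
    rewrite patchE mem_set/= ?in_itv/= ?x0// mulrC ler_wpM2r ?tpow_ge0//.
    rewrite tpowE//; apply: powR_between; lra.
  apply: ler_wpDl; first by rewrite mulr_ge0// ?addr_ge0 ?powR_ge0// restrict_tpow_ge0.
  rewrite patchE mem_set/= ?in_itv/= ?(ltW x1)//.
  rewrite tpowD mulrCA ler_wpM2l ?tpow_ge0//.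
  rewrite [in leRHS]tpowE// mulrDl -!powRM// ?(ltW x0)// mul1r tpowE//.
  apply: powR_between; lra.
- exact: Ia.
- exact: Ib.
Qed.

(** A zero integral would force the integrand, positive on ]0, 1[, to vanish almost everywhere
    there. *)
Lemma Beta_gt0 a b : (0 < Beta a b)%E.
Proof.
have f0 z : 0 <= tpow a z * tpow b (1 - z) by rewrite mulr_ge0// tpow_ge0.
rewrite lt0e; apply/andP; split; last first.
  by apply: integral_ge0 => x _; rewrite lee_fin.
apply/eqP => B0.
have : (\int[mu]_z `|(tpow a z * tpow b (1 - z))%:E| = 0)%E.
  rewrite -[RHS]B0; apply: eq_integral => x _; rewrite gee0_abs//.
  by rewrite lee_fin.
move/ae_eq_integral_abs => -[]//; first by solve_measurable.
move=> N [mN N0 sN].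
have : (mu `]0%R, 1%R[ <= mu N)%E.
  apply: le_measure; rewrite ?inE//.
  move=> x /=; rewrite in_itv/= => /andP[x0 x1]; apply: sN => /= h.
  have {h} := h I; apply/eqP.
  by rewrite eqe gt_eqF// mulr_gt0// tpow_gt0// subr_gt0.
by rewrite N0 lebesgue_measure_itv/= lte01 leNgt oppr0 adde0 lte01.
Qed.

Lemma ge0_integral_scale (f : R -> \bar R) x (d : R) : 0 < d ->
  measurable_fun [set: R] f -> (forall x, 0 <= f x)%E ->
  (\int[mu]_t f t = d%:E * \int[mu]_z f (d * z + x)%R)%E.
Proof.
move=> d0 mf f0; rewrite (ge0_integral_affine x _ mf f0) ?gt_eqF//.
by rewrite muleA -EFinM gtr0_norm// mulfV ?gt_eqF// mul1e.
Qed.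

(** Substitution [t = x + (y - x) z]: the factors contribute [(y - x) ^ (a + b)] and the Jacobian
    one more power. For [y <= x] the two truncations have disjoint supports and both sides are 0. *)
Lemma integral_tpow_between a b x y :
  (\int[mu]_t (tpow a (t - x) * tpow b (y - t))%:E = Beta a b * (tpow (a + b + 1) (y - x))%:E)%E.
Proof.
have [yx|xy] := leP y x.
  rewrite [in RHS]tpow_le0 ?subr_le0// mule0.
  rewrite (_ : (fun t => _) = cst 0%E) ?integral0//; apply/funext => t/=.
  have [tx|tx] := leP t x; first by rewrite tpow_le0 ?subr_le0// mul0r.
  by rewrite [X in _ * X]tpow_le0 ?mulr0// subr_le0 (le_trans yx)// ltW.
have d0 : 0 < y - x by rewrite subr_gt0.
rewrite (@ge0_integral_scale _ x _ d0); last 2 first.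
- by solve_measurable.
- by move=> t; rewrite lee_fin mulr_ge0// tpow_ge0.
rewrite [X in (_ * X)%E](_ : _ = \int[mu]_z (((y - x) `^ (a + b))%:E * (tpow a z * tpow b (1 - z))%:E)%E)%E; last first.
  apply: eq_integral => z _; rewrite -EFinM; congr EFin.
  rewrite addrK (_ : y - ((y - x) * z + x) = (y - x) * (1 - z)); last by ring.
  by rewrite !tpowZ// powRD ?(gt_eqF d0) ?implybT//; ring.
rewrite ge0_integralZl//; last 3 first.
- by solve_measurable.
- by move=> z _; rewrite lee_fin mulr_ge0// tpow_ge0.
- by rewrite lee_fin powR_ge0.
rewrite -/(Beta a b) muleA -EFinM muleC; congr (_ * _%:E)%E.
exact: mul_powR_tpow.
Qed.

(** Here [t] runs over the points below both [x] and [y]; the substitution is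
    [t = x - (y - x) z]. *)
Lemma integral_tpow_above a b x y : x < y ->
  (\int[mu]_t (tpow a (x - t) * tpow b (y - t))%:E = Beta' a b * (tpow (a + b + 1) (y - x))%:E)%E.
Proof.
move=> xy; have d0 : 0 < y - x by rewrite subr_gt0.
rewrite -(@ge0_integral_reflect _ x); last 2 first.
- by solve_measurable.
- by move=> t; rewrite lee_fin mulr_ge0// tpow_ge0.
rewrite (@ge0_integral_scale _ 0 _ d0); last 2 first.
- by solve_measurable.
- by move=> t; rewrite lee_fin mulr_ge0// tpow_ge0.
rewrite [X in (_ * X)%E](_ : _ = \int[mu]_z (((y - x) `^ (a + b))%:E * (tpow a z * tpow b (1 + z))%:E)%E)%E; last first.
  apply: eq_integral => z _; rewrite -EFinM; congr EFin.
  rewrite addr0 (_ : y - (x - (y - x) * z) = (y - x) * (1 + z)); last by ring.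
  rewrite (_ : x - (x - (y - x) * z) = (y - x) * z); last by ring.
  by rewrite !tpowZ// powRD ?(gt_eqF d0) ?implybT//; ring.
rewrite ge0_integralZl//; last 3 first.
- by solve_measurable.
- by move=> z _; rewrite lee_fin mulr_ge0// tpow_ge0.
- by rewrite lee_fin powR_ge0.
rewrite -/(Beta' a b) muleA -EFinM muleC; congr (_ * _%:E)%E.
exact: mul_powR_tpow.
Qed.

End kernel_integrals.

(** * Fubini for possibly divergent signed integrals *)

Section signed_integrals.
Context d {T : measurableType d} {R : realType} (m : {measure set T -> \bar R}).

Lemma integrable_fin_numP (f : T -> R) : measurable_fun [set: T] f ->
  m.-integrable [set: T] (EFin \o f) <-> (\int[m]_x (f x)%:E)%E \is a fin_num.
Proof.
move=> mf; rewrite -integral_fin_num_abs//; split=> [/integrableP[]//|fi].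
by apply/integrableP; split => //; exact/measurable_EFinP.
Qed.

(** The extended integral is then infinite, also when both parts diverge, and [fine] sends infinite
    values to 0. *)
Lemma Rintegral_nonintegrable (f : T -> R) : measurable_fun [set: T] f ->
  ~ m.-integrable [set: T] (EFin \o f) -> \int[m]_x f x = 0.
Proof.
move=> mf; rewrite integrable_fin_numP// /Rintegral.
by case: (integral _ _ _) => //= r; rewrite fin_numE.
Qed.

(** Without integrability both sides are 0 by convention, except for [c = 0], where the claim is
    immediate. *)
Lemma RintegralZ (c : R) (f : T -> R) : measurable_fun [set: T] f ->
  \int[m]_x (c * f x) = c * \int[m]_x f x.
Proof.
move=> mf.
have [intf|nintf] := pselect (m.-integrable [set: T] (EFin \o f)).
  exact: RintegralZl.
have [->|c0] := eqVneq c 0.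
  by rewrite mul0r /Rintegral; under eq_integral do rewrite mul0r; rewrite integral0.
rewrite !Rintegral_nonintegrable ?mulr0//; first exact: measurable_funM.
move=> icf; apply: nintf.
have := integrableZl measurableT c^-1 icf.
apply: eq_integrable => // x _ /=.
by rewrite -EFinM mulKf.
Qed.

End signed_integrals.

Section fubini_signed.
Context d1 d2 {T1 : measurableType d1} {T2 : measurableType d2} {R : realType}.
Variables (m1 : {sigma_finite_measure set T1 -> \bar R})
          (m2 : {sigma_finite_measure set T2 -> \bar R}).

Lemma measurable_Rintegral (f : T1 * T2 -> R) : measurable_fun [set: T1 * T2] f ->
  measurable_fun [set: T1] (fun x => \int[m2]_y f (x, y)).
Proof.
move=> mf; rewrite /Rintegral.
apply: (measurableT_comp (@fine_measurable _ setT measurableT)).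
rewrite (_ : (fun x => _) = (fun x => \int[m2]_y (EFin \o f)^\+ (x, y) -
  \int[m2]_y (EFin \o f)^\- (x, y))%E); last first.
  apply/funext => x; rewrite integralE.
  by congr (_ - _)%E; apply: eq_integral => y _; rewrite ?funeposE ?funenegE.
have mef : measurable_fun [set: T1 * T2] (EFin \o f) by exact/measurable_EFinP.
apply: emeasurable_funB.
- apply: (measurable_fun_fubini_tonelli_F (EFin \o f)^\+)%E; first exact: measurable_funepos.
  by [].
- apply: (measurable_fun_fubini_tonelli_F (EFin \o f)^\-)%E; first exact: measurable_funeneg.
  by [].
Qed.

Lemma integral_Rintegral (f : T1 * T2 -> R) :
  (m1 \x m2)%E.-integrable [set: T1 * T2] (EFin \o f) ->
  (\int[m1]_x (\int[m2]_y f (x, y))%:E = \int[m1]_x \int[m2]_y (f (x, y))%:E)%E.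
Proof.
move=> intf.
have mf : measurable_fun [set: T1 * T2] f.
  by apply/measurable_EFinP; exact: measurable_int intf.
apply: ae_eq_integral => //.
- by apply/measurable_EFinP; exact: measurable_Rintegral.
- exact: (measurable_fubini_F intf).
have := ae_integrable1 intf; apply: filterS => x /= intfx _.
by rewrite /Rintegral fineK//; exact: integrable_fin_num.
Qed.

(* The inner integral may be junk where it does not converge; the set of such
   points is negligible for [a]. *)
Lemma fubini_weighted (a : T1 -> R) (b : T1 -> T2 -> R) (f : T2 -> R) :
  measurable_fun [set: T1] a ->
  measurable_fun [set: T1 * T2] (fun z => b z.1 z.2) ->
  measurable_fun [set: T2] f ->
  (\int[m2]_y \int[m1]_r `|a r * b r y * f y|%:E < +oo)%E ->
  (\int[m1]_r (a r * \int[m2]_y (b r y * f y))%:E =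
   \int[m2]_y \int[m1]_r (a r * b r y * f y)%:E)%E.
Proof.
move=> ma mb mf fin.
pose F (z : T1 * T2) := a z.1 * b z.1 z.2 * f z.2.
have maf : measurable_fun [set: T1 * T2] (fun z => a z.1).
  exact: (measurableT_comp ma measurable_fst).
have mff : measurable_fun [set: T1 * T2] (fun z => f z.2).
  exact: (measurableT_comp mf measurable_snd).
have mF : measurable_fun [set: T1 * T2] F.
  by apply: measurable_funM => //; exact: measurable_funM.
have iF : (m1 \x m2)%E.-integrable [set: T1 * T2] (EFin \o F).
  by apply/integrable21ltyP => //; exact/measurable_EFinP.
rewrite -(Fubini iF) -integral_Rintegral//.
apply: eq_integral => r _; congr EFin; rewrite -RintegralZ//.
  by apply: eq_Rintegral => y _; rewrite /F/= mulrA.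
by apply: measurable_funM => //; exact: (measurable_fun_pair2 _ mb).
Qed.

End fubini_signed.

(** * Tonelli and Fubini theorems in the plane *)

Section planar.
Context {R : realType}.
Local Notation mu := (@lebesgue_measure R).
Implicit Type g : R -> R -> R.

Lemma measurable_integral2 g : measurable_fun [set: R * R] (fun z => g z.1 z.2) ->
  measurable_fun [set: R] (fun x => \int[mu]_y (g x y)%:E)%E.
Proof.
move=> mg; pose f (z : R * R) := (g z.1 z.2)%:E.
have mf : measurable_fun [set: R * R] f by exact/measurable_EFinP.
rewrite (_ : (fun x => _) = (fun x => \int[mu]_y f^\+ (x, y) - \int[mu]_y f^\- (x, y))%E); last first.
  apply/funext => x; rewrite integralE.
  by congr (_ - _)%E; apply: eq_integral => y _; rewrite ?funeposE ?funenegE.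
apply: emeasurable_funB.
- apply: (@measurable_fun_fubini_tonelli_F _ _ _ _ _ mu f^\+%E) => //; exact: measurable_funepos.
- apply: (@measurable_fun_fubini_tonelli_F _ _ _ _ _ mu f^\-%E) => //; exact: measurable_funeneg.
Qed.

Lemma measurable_Rintegral2 g : measurable_fun [set: R * R] (fun z => g z.1 z.2) ->
  measurable_fun [set: R] (fun x => \int[mu]_y g x y).
Proof.
by move=> mg; apply: (measurableT_comp (@fine_measurable _ setT measurableT)); exact: measurable_integral2.
Qed.

Lemma measurable_swap : measurable_fun [set: R * R] (fun z : R * R => (z.2, z.1)).
Proof. by apply: measurable_fun_pair. Qed.

Lemma measurable_fun_swap g : measurable_fun [set: R * R] (fun z => g z.1 z.2) ->
  measurable_fun [set: R * R] (fun z => g z.2 z.1).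
Proof. by move=> mg; exact: (measurableT_comp mg measurable_swap). Qed.

Lemma ge0_fubini g : measurable_fun [set: R * R] (fun z => g z.1 z.2) ->
  (forall x y, 0 <= g x y) ->
  (\int[mu]_x \int[mu]_y (g x y)%:E = \int[mu]_y \int[mu]_x (g x y)%:E)%E.
Proof.
move=> mg g0; apply: (@fubini_tonelli _ _ _ _ _ mu mu (fun z => (g z.1 z.2)%:E)).
- exact/measurable_EFinP.
- by move=> z; rewrite lee_fin.
Qed.

Lemma integrable_prod g : measurable_fun [set: R * R] (fun z => g z.1 z.2) ->
  (\int[mu]_x \int[mu]_y `|g x y|%:E < +oo)%E ->
  (mu \x mu)%E.-integrable [set: R * R] (fun z => (g z.1 z.2)%:E).
Proof. by move=> mg fin; apply/integrable12ltyP => //; exact/measurable_EFinP. Qed.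

Lemma fubini g : measurable_fun [set: R * R] (fun z => g z.1 z.2) ->
  (\int[mu]_x \int[mu]_y `|g x y|%:E < +oo)%E ->
  (\int[mu]_x \int[mu]_y (g x y)%:E = \int[mu]_y \int[mu]_x (g x y)%:E)%E.
Proof. by move=> mg fin; exact: (Fubini (integrable_prod mg fin)). Qed.

Lemma integral2D (f g : R -> R -> R) :
  measurable_fun [set: R * R] (fun z => f z.1 z.2) ->
  measurable_fun [set: R * R] (fun z => g z.1 z.2) ->
  (\int[mu]_x \int[mu]_y `|f x y|%:E < +oo)%E ->
  (\int[mu]_x \int[mu]_y `|g x y|%:E < +oo)%E ->
  (\int[mu]_x \int[mu]_y (f x y + g x y)%:E =
   \int[mu]_x \int[mu]_y (f x y)%:E + \int[mu]_x \int[mu]_y (g x y)%:E)%E.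
Proof.
move=> mf mg fin1 fin2.
have i1 := integrable_prod mf fin1; have i2 := integrable_prod mg fin2.
have i12 : (mu \x mu)%E.-integrable [set: R * R] (fun z => (f z.1 z.2 + g z.1 z.2)%:E).
  by under eq_fun do rewrite EFinD; exact: integrableD.
have := integral12_prod_meas1 i12; have := integral12_prod_meas1 i1.
have := integral12_prod_meas1 i2; rewrite /fubini_F /= => -> -> ->.
by under eq_integral do rewrite EFinD; rewrite integralD.
Qed.

Lemma integral2Zl (k : R) (f : R -> R -> R) :
  measurable_fun [set: R * R] (fun z => f z.1 z.2) ->
  (\int[mu]_x \int[mu]_y `|f x y|%:E < +oo)%E ->
  (\int[mu]_x \int[mu]_y (k * f x y)%:E = k%:E * \int[mu]_x \int[mu]_y (f x y)%:E)%E.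
Proof.
move=> mf fin.
have i1 := integrable_prod mf fin.
have i2 : (mu \x mu)%E.-integrable [set: R * R] (fun z => (k * f z.1 z.2)%:E).
  by under eq_fun do rewrite EFinM; exact: integrableZl.
have := integral12_prod_meas1 i2; have := integral12_prod_meas1 i1.
rewrite /fubini_F /= => -> ->.
by under eq_integral do rewrite EFinM; rewrite integralZl.
Qed.

Lemma ge0_integral2Zl (k : R) (f : R -> R -> R) : 0 <= k ->
  measurable_fun [set: R * R] (fun z => f z.1 z.2) -> (forall x y, 0 <= f x y) ->
  (\int[mu]_x \int[mu]_y (k * f x y)%:E = k%:E * \int[mu]_x \int[mu]_y (f x y)%:E)%E.
Proof.
move=> k0 mf f0; rewrite -ge0_integralZl//; last 2 first.
- exact: measurable_integral2.
- by move=> x _; apply: integral_ge0 => y _; rewrite lee_fin.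
apply: eq_integral => x _; under eq_integral do rewrite EFinM.
rewrite ge0_integralZl//.
- by apply/measurable_EFinP; exact: (measurable_fun_pair2 _ mf).
- by move=> y _; rewrite lee_fin.
Qed.

Lemma ae_integral_lty (f : R -> \bar R) : measurable_fun [set: R] f -> (forall x, 0 <= f x)%E ->
  (\int[mu]_x f x < +oo)%E -> {ae mu, forall x, (f x < +oo)%E}.
Proof.
move=> mf f0 fin.
have : mu.-integrable [set: R] f.
  apply/integrableP; split=> //; apply: le_lt_trans fin.
  by apply: ge0_le_integral => // [|x _]; [exact: measurableT_comp|rewrite gee0_abs].
move/integrable_ae => /(_ measurableT); apply: filterS => x /= /(_ I).
by rewrite ge0_fin_numE.
Qed.

End planar.

Ltac solve_measurable2 := cbv beta; repeat (first
 [ apply: measurable_integral2; cbv beta | apply: measurable_Rintegral2; cbv beta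
 | apply: measurable_fun_swap; assumption | measurable_step ]).

(** * The energy of a Riesz kernel of positive order *)

(** It holds without integrability, since a divergent real-valued integral is 0. *)
Lemma le_normr_Rintegral_ge0 d (T : measurableType d) (R : realType)
    (m : {measure set T -> \bar R}) (f : T -> R) : measurable_fun [set: T] f ->
  (`|\int[m]_x f x|%:E <= \int[m]_x `|f x|%:E)%E.
Proof.
move=> mf; have [intf|nintf] := pselect (m.-integrable [set: T] (EFin \o f)).
  by rewrite EFin_normr_Rintegral//; apply: le_abse_integral => //; exact/measurable_EFinP.
rewrite Rintegral_nonintegrable// normr0.
by apply: integral_ge0 => x _; rewrite lee_fin.
Qed.

(** * Pairing of two potentials *)

Section bilinear.
Context {R : realType}.
Local Notation mu := (@lebesgue_measure R).

(** Kernel identities may fail on the diagonal, and truncated powers differ from closed-interval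
    indicators at an end point; single points are negligible. *)
Lemma eq_integral_but1 (y : R) (f g : R -> \bar R) : measurable_fun [set: R] f ->
  measurable_fun [set: R] g -> (forall x, x != y -> f x = g x) ->
  (\int[mu]_x f x = \int[mu]_x g x)%E.
Proof.
move=> mf mg fg; apply: ae_eq_integral => //.
exists [set y]; split => //; first exact: lebesgue_measure_set1.
move=> x /= h; apply/eqP/negPn/negP => xy; apply: h => _; exact: fg.
Qed.

Variables (phi psi K : R -> R -> R) (f : R -> R).
Hypotheses (mphi : measurable_fun [set: R * R] (fun z => phi z.1 z.2))
  (mpsi : measurable_fun [set: R * R] (fun z => psi z.1 z.2))
  (mK : measurable_fun [set: R * R] (fun z => K z.1 z.2))
  (mf : measurable_fun [set: R] f).
Hypotheses (phi0 : forall x t, 0 <= phi x t) (psi0 : forall x t, 0 <= psi x t)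
  (K0 : forall x y, 0 <= K x y).
Hypothesis phipsi : forall x y, x != y ->
  (\int[mu]_t (phi x t * psi y t)%:E = (K x y)%:E)%E.
Hypothesis Kfin : (\int[mu]_y \int[mu]_x (`|f x| * `|f y| * K x y)%:E < +oo)%E.

(** Two exchanges, one for each potential. By [phipsi] the integral in [t] of the absolute values is
    the absolute energy, finite by [Kfin]. This justifies exchanging [t] with [y] globally, and then
    [t] with [x] for almost every [y]. *)
Lemma fubini_bilinear :
  (\int[mu]_t (\int[mu]_x (phi x t * f x) * \int[mu]_y (psi y t * f y))%:E =
   \int[mu]_y \int[mu]_x (f x * f y * K x y)%:E)%E.
Proof.
have mphit (x : R) : measurable_fun [set: R] (phi x) by exact: (measurable_fun_pair2 _ mphi).
have mpsit (x : R) : measurable_fun [set: R] (psi x) by exact: (measurable_fun_pair2 _ mpsi).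
have mphix (t : R) : measurable_fun [set: R] (phi ^~ t) by exact: (measurable_fun_pair1 _ mphi).
have mKx (y : R) : measurable_fun [set: R] (K ^~ y) by exact: (measurable_fun_pair1 _ mK).
have mphi' := measurable_fun_swap mphi.
have mpsi' := measurable_fun_swap mpsi.
have mK' := measurable_fun_swap mK.
have mJ : measurable_fun [set: R] (fun t => \int[mu]_x (phi x t * f x)) by solve_measurable2.
pose J t := \int[mu]_x (phi x t * f x).
have tonelli_abs y : (\int[mu]_x \int[mu]_t `|psi y t * f y * phi x t * f x|%:E =
   \int[mu]_x (`|f x| * `|f y| * K x y)%:E)%E.
  have mpsiy := mpsit y; have mKy := mKx y.
  apply: (@eq_integral_but1 y).
  - by solve_measurable2.
  - by solve_measurable2.
  - move=> x xy; rewrite EFinM -phipsi// -ge0_integralZl//; last 2 first.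
    + by have mphix1 := mphit x; solve_measurable2.
    + by move=> t _; rewrite lee_fin mulr_ge0.
    apply: eq_integral => t _; rewrite -EFinM; congr EFin.
    by rewrite !normrM (ger0_norm (phi0 _ _)) (ger0_norm (psi0 _ _)); ring.
have Jle y : (\int[mu]_t `|J t * psi y t * f y|%:E <=
    \int[mu]_x (`|f x| * `|f y| * K x y)%:E)%E.
  have mpsiy := mpsit y.
  rewrite -tonelli_abs ge0_fubini//; last by solve_measurable2.
  apply: ge0_le_integral => //.
  - by solve_measurable2.
  - by solve_measurable2.
  - move=> t _; rewrite -mulrA mulrC normrM EFinM.
    have mphit1 := mphix t.
    apply: (@le_trans _ _ (`|psi y t * f y|%:E * \int[mu]_x `|phi x t * f x|%:E)%E).
      by apply: lee_pmul => //; apply: le_normr_Rintegral_ge0; solve_measurable.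
    rewrite -ge0_integralZl//; last by solve_measurable2.
    under eq_integral do rewrite -EFinM -normrM mulrA.
    by [].
have finJ : (\int[mu]_y \int[mu]_t `|J t * psi y t * f y|%:E < +oo)%E.
  apply: le_lt_trans Kfin; apply: ge0_le_integral => //.
  - by move=> y _; apply: integral_ge0 => t _; rewrite lee_fin.
  - by solve_measurable2.
  - by solve_measurable2.
have mJ' : measurable_fun [set: R] J by exact: mJ.
rewrite (@fubini_weighted _ _ _ _ _ mu mu J (fun t y => psi y t) f);
  [|exact: mJ'|exact: mpsi'|exact: mf|exact: finJ].
apply: ae_eq_integral => //.
- by solve_measurable2.
- by solve_measurable2.
have : {ae mu, forall y, \int[mu]_x (`|f x| * `|f y| * K x y)%:E < +oo}%E.
  apply: ae_integral_lty => //; first by solve_measurable2.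
  by move=> y; apply: integral_ge0 => x _; rewrite lee_fin mulr_ge0// mulr_ge0.
apply: filterS; first exact: (ae_filter_ringOfSetsType mu).
move=> y /= fy _.
have mpsiy := mpsit y; have mKy := mKx y.
transitivity (\int[mu]_t (psi y t * f y * \int[mu]_x (phi x t * f x))%:E)%E.
  by apply: eq_integral => t _; congr EFin; rewrite -/(J t) -mulrA mulrC.
rewrite (@fubini_weighted _ _ _ _ _ mu mu (fun t => psi y t * f y) (fun t x => phi x t));
  [|by solve_measurable2|exact: mphi'|exact: mf|by rewrite tonelli_abs].
apply: (@eq_integral_but1 y).
- by solve_measurable2.
- by solve_measurable2.
- move=> x xy; have mphix1 := mphit x.
    transitivity (\int[mu]_t ((f x * f y)%:E * (phi x t * psi y t)%:E))%E.
      by apply: eq_integral => t _; rewrite -EFinM; congr EFin; ring.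
    rewrite integralZl//; first by rewrite phipsi// -EFinM.
    apply/integrableP; split; first by solve_measurable2.
    rewrite (_ : (\int[_]_x0 _)%E = (K x y)%:E) ?ltry// -phipsi//.
    by apply: eq_integral => t _; rewrite gee0_abs// lee_fin mulr_ge0.
Qed.

End bilinear.

Lemma ge0_integral2_dom2 (R : realType) (F g1 g2 : R -> R -> R) :
  let mu := @lebesgue_measure R in
  measurable_fun [set: R * R] (fun z => F z.1 z.2) ->
  measurable_fun [set: R * R] (fun z => g1 z.1 z.2) ->
  measurable_fun [set: R * R] (fun z => g2 z.1 z.2) ->
  (forall x y, 0 <= F x y) -> (forall x y, 0 <= g1 x y) -> (forall x y, 0 <= g2 x y) ->
  (forall x y, F x y <= g1 x y + g2 x y) ->
  (\int[mu]_x \int[mu]_y (F x y)%:E <=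
   \int[mu]_x \int[mu]_y (g1 x y)%:E + \int[mu]_x \int[mu]_y (g2 x y)%:E)%E.
Proof.
move=> mu mF mg1 mg2 F0 g10 g20 Fg.
have mFx x : measurable_fun [set: R] (F x) by exact: (measurable_fun_pair2 _ mF).
have mg1x x : measurable_fun [set: R] (g1 x) by exact: (measurable_fun_pair2 _ mg1).
have mg2x x : measurable_fun [set: R] (g2 x) by exact: (measurable_fun_pair2 _ mg2).
rewrite -ge0_integralD; [|by []|..]; last 4 first.
- by move=> x _; apply: integral_ge0 => y _; rewrite lee_fin.
- exact: measurable_integral2.
- by move=> x _; apply: integral_ge0 => y _; rewrite lee_fin.
- exact: measurable_integral2.
apply: ge0_le_integral; [by []|..].
- by move=> x _; apply: integral_ge0 => y _; rewrite lee_fin.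
- exact: measurable_integral2.
- by apply: emeasurable_funD; exact: measurable_integral2.
move=> x _; rewrite -ge0_integralD; [|by []|..]; last 4 first.
- by move=> y _; rewrite lee_fin.
- by apply/measurable_EFinP; exact: mg1x.
- by move=> y _; rewrite lee_fin.
- by apply/measurable_EFinP; exact: mg2x.
apply: ge0_le_integral; [by []|..].
- by move=> y _; rewrite lee_fin.
- by apply/measurable_EFinP; exact: mFx.
- by apply: emeasurable_funD; apply/measurable_EFinP; [exact: mg1x|exact: mg2x].
- by move=> y _; rewrite -EFinD lee_fin.
Qed.

Lemma amgm_weighted (R : realType) (l x y : R) : 0 < l ->
  x * y <= l / 2 * x ^+ 2 + (2 * l)^-1 * y ^+ 2.
Proof.
move=> l0; rewrite -subr_ge0.
have -> : l / 2 * x ^+ 2 + (2 * l)^-1 * y ^+ 2 - x * y = (l * x - y) ^+ 2 / (2 * l).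
  by field; rewrite gt_eqF.
by rewrite divr_ge0 ?sqr_ge0// mulr_ge0// ltW.
Qed.

(* AM-GM with the weight [l] chosen so that the second term absorbs half of the
   left-hand side. *)
Lemma absorb_energy (R : realType) (f g q : R -> R) (beta gamma p r b : R) :
  let mu := @lebesgue_measure R in
  measurable_fun [set: R] f -> measurable_fun [set: R] g -> measurable_fun [set: R] q ->
  0 < beta -> 0 <= gamma -> 0 <= p -> r = 2 * b ->
  (\int[mu]_t (f t * g t)%:E = (beta * b)%:E)%E ->
  (\int[mu]_t (g t * g t)%:E = (gamma * r)%:E)%E ->
  (\int[mu]_t (q t)%:E = p%:E)%E ->
  (forall l t, 0 < l -> f t * g t <= l / 2 * q t + (2 * l)^-1 * (g t * g t)) ->
  r <= 4 * (gamma + 1) / beta ^+ 2 * p.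
Proof.
move=> mu mf mg mq beta0 gamma0 p0 rb fg gg qp fgq.
have intfg : mu.-integrable [set: R] (EFin \o (fun t => f t * g t)).
  by apply/integrable_fin_numP; [solve_measurable2|rewrite fg].
have intq : mu.-integrable [set: R] (EFin \o q).
  by apply/integrable_fin_numP; [solve_measurable2|rewrite qp].
have intgg : mu.-integrable [set: R] (EFin \o (fun t => g t * g t)).
  by apply/integrable_fin_numP; [solve_measurable2|rewrite gg].
(* [gamma] is only known to be nonnegative; [gamma + 1] makes [l] positive. *)
pose l := 2 * (gamma + 1) / beta.
have g10 : 0 < gamma + 1 by rewrite ltr_wpDl.
have l0 : 0 < l by rewrite divr_gt0// mulr_gt0.
have key : beta * b <= l / 2 * p + (2 * l)^-1 * (gamma * r).
  rewrite -lee_fin EFinD !(EFinM (l / 2)) !(EFinM (2 * l)^-1) -fg -gg -qp.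
  rewrite -integralZl// -integralZl// -integralD//; last 2 first.
  - exact: integrableZl.
  - exact: integrableZl.
  apply: le_integral => //.
    by apply: integrableD => //; exact: integrableZl.
  by move=> t _; rewrite -!EFinM -EFinD lee_fin; exact: fgq.
have C0 : 0 < 4 * (gamma + 1) / beta ^+ 2.
  by rewrite divr_gt0// ?exprn_gt0// mulr_gt0.
(* The sign of the energy [r] is not given; for a negative [r] the bound is trivial. *)
have [r0|r0] := ltP r 0; first by rewrite (le_trans (ltW r0))// mulr_ge0// ltW.
have h : (2 * l)^-1 * (gamma * r) <= beta * r / 4.
  have -> : (2 * l)^-1 * (gamma * r) = beta * r / 4 * (gamma / (gamma + 1)).
    by rewrite /l; field; rewrite !gt_eqF.
  rewrite ler_piMr//; first by rewrite divr_ge0// mulr_ge0// ltW.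
  by rewrite ler_pdivrMr// mul1r lerDl.
have h2 : beta * r / 4 <= l / 2 * p.
  have -> : beta * r / 4 = beta * b - beta * r / 4 by rewrite rb; field.
  by rewrite lerBlDr (le_trans key)// lerD2l.
have -> : 4 * (gamma + 1) / beta ^+ 2 * p = l / 2 * p * (4 / beta).
  by rewrite /l; field; rewrite gt_eqF.
rewrite -ler_pdivrMr ?divr_gt0// (le_trans _ h2)//.
by rewrite le_eqVlt; apply/orP; left; apply/eqP; field; rewrite gt_eqF.
Qed.

Section riesz_energy.
Context {R : realType}.
Local Notation mu := (@lebesgue_measure R).
Variables (T : R) (G : R -> R).
Hypotheses (mG : measurable_fun [set: R] G)
  (G2 : (\int[mu]_x (G x ^+ 2)%:E < +oo)%E)
  (Gsupp : forall x, ~~ (0 <= x <= T) -> G x = 0).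

Lemma EFin_fine_Beta a b : -1 < a -> -1 < b -> (fine (@Beta R a b))%:E = Beta a b.
Proof. by move=> a1 b1; rewrite fineK// ge0_fin_numE ?Beta_lty// ltW// Beta_gt0. Qed.

Lemma Beta'_ge0 a b : (0 <= @Beta' R a b)%E.
Proof. by apply: integral_ge0 => x _; rewrite lee_fin mulr_ge0// tpow_ge0. Qed.

Lemma EFin_fine_Beta' a b : -1 < a -> a + b < -1 -> (fine (@Beta' R a b))%:E = Beta' a b.
Proof. by move=> a1 b1; rewrite fineK// ge0_fin_numE ?Beta'_lty// Beta'_ge0. Qed.

Lemma G2_bounded (w : R -> R) (M : R) : measurable_fun [set: R] w -> (forall x, 0 <= w x) ->
  0 <= M -> (forall x, 0 <= x <= T -> w x <= M) -> (\int[mu]_x (G x ^+ 2 * w x)%:E < +oo)%E.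
Proof.
move=> mw w0 M0 wM.
apply: (@le_lt_trans _ _ (M%:E * \int[mu]_x (G x ^+ 2)%:E)%E); last by rewrite lte_mul_pinfty.
rewrite -ge0_integralZl//; last 2 first.
- by solve_measurable2.
- by move=> x _; rewrite lee_fin sqr_ge0.
apply: ge0_le_integral => //.
- by move=> x _; rewrite lee_fin mulr_ge0// sqr_ge0.
- by solve_measurable2.
- by solve_measurable2.
- move=> x _; rewrite -EFinM lee_fin mulrC.
  have [xT|xT] := boolP (0 <= x <= T); last by rewrite Gsupp// expr0n/= !mulr0.
  by rewrite ler_wpM2r ?sqr_ge0// wM.
Qed.

(** By [|G x| |G y| <= G x ^ 2 + G y ^ 2] it is enough to integrate the kernel in one variable over
    a bounded interval. The interval is imposed by a factor [tpow 0], which makes the inner integral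
    a beta integral, bounded for the other variable in [0, T]. *)
Lemma energy_lty (c : R) : -1 < c ->
  (\int[mu]_y \int[mu]_x (`|G x| * `|G y| * tpow c (y - x))%:E < +oo)%E.
Proof.
move=> c1; have c10 : 0 < c + 1 by lra.
have B1 : (-1 < 0 :> R) by rewrite ltrN10.
(* The cut-offs leave a margin of 1 around [0, T], so that they equal 1 at the end points although
   [tpow 0 0 = 0]. *)
pose g1 x y := G x ^+ 2 * (tpow c (y - x) * tpow 0 (T + 1 - y)).
pose g2 x y := G y ^+ 2 * (tpow 0 (x - (-1)) * tpow c (y - x)).
have g10 x y : 0 <= g1 x y by exact: mulr_ge0 (sqr_ge0 _) (mulr_ge0 (tpow_ge0 _ _) (tpow_ge0 _ _)).
have g20 x y : 0 <= g2 x y by exact: mulr_ge0 (sqr_ge0 _) (mulr_ge0 (tpow_ge0 _ _) (tpow_ge0 _ _)).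
have mg1 : measurable_fun [set: R * R] (fun z => g1 z.2 z.1) by rewrite /g1; solve_measurable2.
have mg2 : measurable_fun [set: R * R] (fun z => g2 z.2 z.1) by rewrite /g2; solve_measurable2.
have mg1' : measurable_fun [set: R * R] (fun z => g1 z.1 z.2) by rewrite /g1; solve_measurable2.
have mg1x x : measurable_fun [set: R] (g1 x) by rewrite /g1; solve_measurable2.
have mg1y y : measurable_fun [set: R] (g1 ^~ y) by rewrite /g1; solve_measurable2.
have mg2y y : measurable_fun [set: R] (g2 ^~ y) by rewrite /g2; solve_measurable2.
have tpow_le (x : R) : x <= T -> 0 <= x + 1 -> tpow (c + 1) (x + 1) <= (T + 1) `^ (c + 1).
  move=> xT; rewrite /tpow; case: ifP => [x0|_]; last by rewrite powR_ge0.
  by rewrite ge0_ler_powR ?nnegrE//; lra.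
have i1 : (\int[mu]_y \int[mu]_x (g1 x y)%:E < +oo)%E.
  rewrite -ge0_fubini//.
  rewrite (_ : (\int[mu]_x _)%E = \int[mu]_x (G x ^+ 2 * (fine (Beta c 0) * tpow (c + 0 + 1) (T + 1 - x)))%:E)%E; last first.
    apply: eq_integral => x _; rewrite /g1; under eq_integral do rewrite EFinM.
    rewrite ge0_integralZl//; last 3 first.
    - by solve_measurable2.
    - by move=> y _; rewrite lee_fin mulr_ge0// tpow_ge0.
    - by rewrite lee_fin sqr_ge0.
    by rewrite integral_tpow_between -EFin_fine_Beta// -!EFinM.
  rewrite addr0.
  apply: (@G2_bounded _ (fine (Beta c 0) * (T + 1) `^ (c + 1))).
  - by solve_measurable2.
  - by move=> x; rewrite mulr_ge0 ?tpow_ge0// fine_ge0// ltW// Beta_gt0.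
  - by rewrite mulr_ge0 ?powR_ge0// fine_ge0// ltW// Beta_gt0.
  - move=> x /andP[x0 xT]; rewrite ler_wpM2l//; first by rewrite fine_ge0// ltW// Beta_gt0.
    rewrite (_ : T + 1 - x = T - x + 1); last by ring.
    by apply: tpow_le; lra.
have i2 : (\int[mu]_y \int[mu]_x (g2 x y)%:E < +oo)%E.
  rewrite (_ : (\int[mu]_y _)%E = \int[mu]_y (G y ^+ 2 * (fine (Beta 0 c) * tpow (0 + c + 1) (y - (-1))))%:E)%E; last first.
    apply: eq_integral => y _; rewrite /g2; under eq_integral do rewrite EFinM.
    rewrite ge0_integralZl//; last 3 first.
    - by solve_measurable2.
    - by move=> x _; rewrite lee_fin mulr_ge0// tpow_ge0.
    - by rewrite lee_fin sqr_ge0.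
    by rewrite integral_tpow_between -EFin_fine_Beta// -!EFinM.
  rewrite add0r.
  apply: (@G2_bounded _ (fine (Beta 0 c) * (T + 1) `^ (c + 1))).
  - by solve_measurable2.
  - by move=> x; rewrite mulr_ge0 ?tpow_ge0// fine_ge0// ltW// Beta_gt0.
  - by rewrite mulr_ge0 ?powR_ge0// fine_ge0// ltW// Beta_gt0.
  - move=> x /andP[x0 xT]; rewrite ler_wpM2l//; first by rewrite fine_ge0// ltW// Beta_gt0.
    by rewrite opprK; apply: tpow_le; lra.
apply: le_lt_trans (lte_add_pinfty i1 i2).
apply: (@ge0_integral2_dom2 R (fun y x => `|G x| * `|G y| * tpow c (y - x))
   (fun y x => g1 x y) (fun y x => g2 x y)).
- by solve_measurable2.
- exact: mg1.
- exact: mg2.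
- by move=> x y; rewrite mulr_ge0 ?tpow_ge0// mulr_ge0.
- by move=> x y; exact: g10.
- by move=> x y; exact: g20.
move=> y x.
have [xT|xT] := boolP (0 <= x <= T); last first.
  by rewrite [X in `|X| * _]Gsupp// normr0 !mul0r; apply: addr_ge0; [exact: g10|exact: g20].
have [yT|yT] := boolP (0 <= y <= T); last first.
  by rewrite [X in _ * `|X|]Gsupp// normr0 mulr0 mul0r; apply: addr_ge0; [exact: g10|exact: g20].
move/andP: xT => [x0 xT]; move/andP: yT => [y0 yT].
rewrite /g1 /g2 [tpow 0 (T + 1 - y)]tpowE; last by lra.
rewrite [tpow 0 (x - -1)]tpowE; last by lra.
rewrite !powRr0 mulr1 mul1r -mulrDl ler_wpM2r ?tpow_ge0//.
rewrite -[G x ^+ 2]real_normK ?num_real// -[G y ^+ 2]real_normK ?num_real//.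
have := normr_ge0 (G x); have := normr_ge0 (G y).
set p := `|G x|; set q := `|G y|; nra.
Qed.


Variable nu : R.
Hypotheses (nu0 : 0 < nu) (nuh : nu < 2^-1).

Local Notation a := (nu - 1).
Local Notation c := (2 * nu - 1).

Let a1 : -1 < a. Proof. by move: nu0 nuh => h1 h2; lra. Qed.
(** This makes [Beta' a a] converge: [Jm], of order [|t| ^ a] at -oo, is square integrable there. *)
Let aa1 : a + a < -1. Proof. by move: nu0 nuh => h1 h2; lra. Qed.
Let c1 : -1 < c. Proof. by move: nu0 nuh => h1 h2; lra. Qed.
Let c0 : c != 0. Proof. by move: nuh => h1; apply/eqP => h; lra. Qed.
Let acE : a + a + 1 = c. Proof. by ring. Qed.

Local Notation beta := (fine (@Beta R a a)).
Local Notation gamma := (fine (@Beta' R a a)).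

Let beta_gt0 : 0 < beta.
Proof. by rewrite fine_gt0// Beta_gt0/= Beta_lty. Qed.

Let gamma_ge0 : 0 <= gamma.
Proof. by rewrite fine_ge0// Beta'_ge0. Qed.

(** On the diagonal the left-hand side is 0 because [c != 0], in agreement with the truncated
    powers. *)
Let powR_norm (x y : R) : `|x - y| `^ c = tpow c (y - x) + tpow c (x - y).
Proof.
have [xy|xy|->] := ltgtP x y.
- by rewrite tpowE ?subr_gt0// tpow_le0 ?subr_le0 ?ltW// addr0 ltr0_norm ?subr_lt0// opprB.
- by rewrite (@tpow_le0 _ _ (y - x)) ?subr_le0 ?ltW// tpowE ?subr_gt0// add0r gtr0_norm ?subr_gt0.
- by rewrite subrr normr0 tpow_le0// powR0 ?addr0 ?c0.
Qed.

Let Jp t := \int[mu]_x (tpow a (t - x) * G x).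
Let Jm t := \int[mu]_x (tpow a (x - t) * G x).

Let B : \bar R := (\int[mu]_y \int[mu]_x (G x * G y * tpow c (y - x))%:E)%E.
Let A : \bar R := (\int[mu]_x \int[mu]_y (G x * G y * `|x - y| `^ c)%:E)%E.

Let abs1 : (\int[mu]_y \int[mu]_x `|G x * G y * tpow c (y - x)|%:E < +oo)%E.
Proof.
rewrite (_ : (\int[mu]_y _)%E = \int[mu]_y \int[mu]_x (`|G x| * `|G y| * tpow c (y - x))%:E)%E.
  exact: energy_lty c1.
apply: eq_integral => y _; apply: eq_integral => x _.
by rewrite !normrM (ger0_norm (tpow_ge0 _ _)).
Qed.

Let abs2 : (\int[mu]_x \int[mu]_y `|G x * G y * tpow c (y - x)|%:E < +oo)%E.
Proof. by rewrite ge0_fubini//; solve_measurable2. Qed.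

(** The integrand of [A] is symmetric, and [B] is its part on one side of the diagonal. *)
Let AE : A = (B + B)%E.
Proof.
have BE : B = (\int[mu]_x \int[mu]_y (G x * G y * tpow c (y - x))%:E)%E.
  by rewrite fubini//; solve_measurable2.
have BE' : B = (\int[mu]_x \int[mu]_y (G x * G y * tpow c (x - y))%:E)%E.
  by apply: eq_integral => x _; apply: eq_integral => y _; rewrite [G y * _]mulrC.
rewrite {1}BE {1}BE' /A -integral2D.
- by apply: eq_integral => x _; apply: eq_integral => y _; rewrite powR_norm mulrDr.
- by solve_measurable2.
- by solve_measurable2.
- exact: abs2.
- rewrite (_ : (\int[mu]_x _)%E = \int[mu]_y \int[mu]_x `|G x * G y * tpow c (y - x)|%:E)%E; first exact: abs1.
  by apply: eq_integral => x _; apply: eq_integral => y _; rewrite [G y * _]mulrC.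
Qed.

Let Kfin (k : R) : 0 <= k ->
  (\int[mu]_y \int[mu]_x (`|G x| * `|G y| * (k * tpow c (y - x)))%:E < +oo)%E.
Proof.
move=> k0.
rewrite (_ : (\int[mu]_y _)%E = \int[mu]_y \int[mu]_x (k * `|G x * G y * tpow c (y - x)|)%:E)%E; last first.
  apply: eq_integral => y _; apply: eq_integral => x _; congr EFin.
  by rewrite !normrM (ger0_norm (tpow_ge0 _ _)); ring.
rewrite (@ge0_integral2Zl _ k (fun y x => `|G x * G y * tpow c (y - x)|)) => [|//||//]; last by solve_measurable2.
by apply: lte_mul_pinfty; [rewrite lee_fin| |exact: abs1].
Qed.

(** A pair contributes only if [x < t < y], which produces the one-sided kernel of [B] by
    [integral_tpow_between]. *)
Let JpJm : (\int[mu]_t (Jp t * Jm t)%:E = beta%:E * B)%E.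
Proof.
rewrite /Jp /Jm (@fubini_bilinear _ (fun x t => tpow a (t - x)) (fun y t => tpow a (y - t))
  (fun x y => beta * tpow c (y - x)) G).
- rewrite -(@integral2Zl _ beta (fun y x => G x * G y * tpow c (y - x))); [|by solve_measurable2|exact: abs1].
  by apply: eq_integral => y _; apply: eq_integral => x _; congr EFin; rewrite mulrCA.
- by solve_measurable2.
- by solve_measurable2.
- by solve_measurable2.
- by solve_measurable2.
- by move=> x y; exact: tpow_ge0.
- by move=> x y; exact: tpow_ge0.
- by move=> x y; exact: mulr_ge0 (ltW beta_gt0) (tpow_ge0 _ _).
- by move=> x y _; rewrite integral_tpow_between -EFin_fine_Beta// -EFinM acE.
- exact: Kfin (ltW beta_gt0).
Qed.

Let Kfin' (k : R) : 0 <= k ->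
  (\int[mu]_y \int[mu]_x (`|G x| * `|G y| * (k * `|x - y| `^ c))%:E < +oo)%E.
Proof.
move=> k0.
have Kswap : (\int[mu]_y \int[mu]_x (`|G y| * `|G x| * (k * tpow c (x - y)))%:E < +oo)%E.
  rewrite ge0_fubini; first exact: (Kfin k0).
  - by solve_measurable2.
  - by move=> y x; rewrite mulr_ge0// mulr_ge0// tpow_ge0.
apply: le_lt_trans (lte_add_pinfty (Kfin k0) Kswap).
apply: (@ge0_integral2_dom2 _ (fun y x => `|G x| * `|G y| * (k * `|x - y| `^ c))
  (fun y x => `|G x| * `|G y| * (k * tpow c (y - x)))
  (fun y x => `|G y| * `|G x| * (k * tpow c (x - y)))).
- by solve_measurable2.
- by solve_measurable2.
- by solve_measurable2.
- by move=> y x; rewrite mulr_ge0// mulr_ge0// powR_ge0.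
- by move=> y x; rewrite mulr_ge0// mulr_ge0// tpow_ge0.
- by move=> y x; rewrite mulr_ge0// mulr_ge0// tpow_ge0.
- by move=> y x; rewrite powR_norm mulrDr mulrDr [`|G y| * `|G x|]mulrC.
Qed.

(** Now [t] lies below both [x] and [y]; whichever is smaller plays the role of [x] in
    [integral_tpow_above], and the kernel becomes the symmetric one of [A]. *)
Let JmJm : (\int[mu]_t (Jm t * Jm t)%:E = gamma%:E * A)%E.
Proof.
rewrite /Jm (@fubini_bilinear _ (fun x t => tpow a (x - t)) (fun y t => tpow a (y - t))
  (fun x y => gamma * `|x - y| `^ c) G).
- rewrite -(@integral2Zl _ gamma (fun x y => G x * G y * `|x - y| `^ c)); [|by solve_measurable2|].
    by apply: eq_integral => y _; apply: eq_integral => x _; congr EFin; rewrite mulrCA distrC [G x * _]mulrC.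
  rewrite (_ : (\int[mu]_x _)%E = \int[mu]_y \int[mu]_x (`|G x| * `|G y| * (1 * `|x - y| `^ c))%:E)%E.
    exact: Kfin'.
  apply: eq_integral => x _; apply: eq_integral => y _.
  by rewrite !normrM (ger0_norm (powR_ge0 _ _)) mul1r distrC [`|G x| * _]mulrC.
- by solve_measurable2.
- by solve_measurable2.
- by solve_measurable2.
- by solve_measurable2.
- by move=> x y; exact: tpow_ge0.
- by move=> x y; exact: tpow_ge0.
- by move=> x y; exact: mulr_ge0 gamma_ge0 (powR_ge0 _ _).
- move=> x y; rewrite neq_lt => /orP[xy|xy].
    rewrite integral_tpow_above// -EFin_fine_Beta'// -EFinM acE powR_norm.
    by rewrite (@tpow_le0 _ _ (x - y)) ?subr_le0 ?addr0// ltW.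
  under eq_integral do rewrite mulrC.
  rewrite integral_tpow_above// -EFin_fine_Beta'// -EFinM acE powR_norm.
  by rewrite (@tpow_le0 _ _ (y - x)) ?subr_le0 ?add0r// ltW.
- exact: Kfin'.
Qed.


Let Jp_lt0 t : t < 0 -> Jp t = 0.
Proof.
move=> t0; rewrite /Jp /Rintegral (_ : (fun x => _) = cst 0%E) ?integral0//.
apply/funext => x/=; have [xT|xT] := boolP (0 <= x <= T); last by rewrite Gsupp// mulr0.
by rewrite tpow_le0 ?mul0r// subr_le0 (le_trans (ltW t0))//; case/andP: xT.
Qed.

Let Jm_gtT t : T < t -> Jm t = 0.
Proof.
move=> t0; rewrite /Jm /Rintegral (_ : (fun x => _) = cst 0%E) ?integral0//.
apply/funext => x/=; have [xT|xT] := boolP (0 <= x <= T); last by rewrite Gsupp// mulr0.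
by rewrite tpow_le0 ?mul0r// subr_le0 (le_trans _ (ltW t0))//; case/andP: xT.
Qed.

Let mJp : measurable_fun [set: R] Jp. Proof. by rewrite /Jp; solve_measurable2. Qed.
Let mJm : measurable_fun [set: R] Jm. Proof. by rewrite /Jm; solve_measurable2. Qed.

Let Afin : A \is a fin_num.
Proof.
have i : (mu \x mu)%E.-integrable [set: R * R] (fun z => (G z.1 * G z.2 * `|z.1 - z.2| `^ c)%:E).
  apply: (@integrable_prod _ (fun x y => G x * G y * `|x - y| `^ c)); first by solve_measurable2.
  rewrite (_ : (\int[mu]_x _)%E = \int[mu]_y \int[mu]_x (`|G x| * `|G y| * (1 * `|x - y| `^ c))%:E)%E.
    exact: Kfin'.
  apply: eq_integral => x _; apply: eq_integral => y _.
  by rewrite !normrM (ger0_norm (powR_ge0 _ _)) mul1r distrC [`|G x| * _]mulrC.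
have := integral12_prod_meas1 i; rewrite /fubini_F/= -/A => ->.
exact: integrable_fin_num.
Qed.

(* [Jp] lives on [0, +oo[ and [Jm] on ]-oo, T], so that their pairing, which
   is the energy up to a constant, only sees [Jp] on [0, T]. *)
Lemma riesz_energy_bound :
  (A <= (4 * (gamma + 1) / beta ^+ 2)%:E * \int[mu]_(t in `[0%R, T]) (Jp t ^+ 2)%:E)%E.
Proof.
pose q := (fun t => Jp t ^+ 2) \_ `[0, T].
have q0 t : 0 <= q t by rewrite /q patchE; case: ifP => // _; exact: sqr_ge0.
have mq : measurable_fun [set: R] q.
  apply/(measurable_restrictT (fun t => Jp t ^+ 2)) => //; apply: measurable_funTS.
  by solve_measurable2.
rewrite integral_mkcond (_ : (\int[_]_x _)%E = \int[mu]_t (q t)%:E)%E; last first.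
  by apply: eq_integral => t _; rewrite restrict_EFin.
have : (0 <= \int[mu]_t (q t)%:E)%E by apply: integral_ge0 => t _; rewrite lee_fin.
(* If the right-hand integral is infinite, positivity of the constant is enough. *)
case Pp : (\int[mu]_t (q t)%:E)%E => [p| |] p0; [|clear Pp|by []]; last first.
  rewrite gt0_muley ?leey// lte_fin divr_gt0 ?exprn_gt0//.
  by apply: mulr_gt0; [exact: ltr0n|exact: ltr_wpDl].
rewrite lee_fin in p0.
have [r Ar] : exists r, A = r%:E by exists (fine A); rewrite fineK.
have [b Bb] : exists b, B = b%:E.
  move: AE; rewrite Ar; case: (B) => [b| |] // _; by exists b.
have rb : r = 2 * b.
  by move: AE; rewrite Ar Bb -EFinD => -[->]; ring.
rewrite Ar -EFinM lee_fin.
apply: (@absorb_energy _ Jp Jm q beta gamma p r b mJp mJm mq beta_gt0 gamma_ge0 p0 rb).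
- by rewrite JpJm Bb.
- by rewrite JmJm Ar.
- exact: Pp.
move=> l t l0; rewrite /q patchE.
case: ifPn => [_|]; first exact: amgm_weighted.
rewrite notin_setE/= in_itv/= => /negP; rewrite negb_and -!ltNge mulr0 add0r => /orP[t0|tT].
  rewrite (Jp_lt0 t0) mul0r mulr_ge0//; first by rewrite invr_ge0 mulr_ge0// ltW.
  by rewrite -expr2 sqr_ge0.
by rewrite (Jm_gtT tT) !mulr0.
Qed.

End riesz_energy.

Lemma eq_mule_pdivl (R : realType) (k c : R) (x y : \bar R) : 
  (c%:E * y = k%:E * x)%E -> 0 < k -> x = ((c / k)%:E * y)%E.
Proof.
move=> h k0; rewrite -[LHS]mul1e -(_ : (k^-1 * k)%:E = 1%E); last by rewrite mulVf ?gt_eqF.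
by rewrite EFinM -muleA -h muleA -EFinM mulrC.
Qed.

(** * The Gagliardo seminorm of step-function potentials *)

Section gagliardo.
Context {R : realType}.
Local Notation mu := (@lebesgue_measure R).
Local Notation tpow := (@tpow R).
Variable s : R.

Definition gagliardo (u : R -> R) : \bar R :=
  (\int[mu]_x \int[mu]_y ((u x - u y) ^+ 2 / `|x - y| `^ (1 + 2 * s))%:E)%E.

(** Product form of the integrand of [gagliardo], suited to the measurability tactics. *)
Definition gker (u : R -> R) (x y : R) : R := (u x - u y) ^+ 2 * `|x - y| `^ (- (1 + 2 * s)).

Lemma gagliardoE u : gagliardo u = (\int[mu]_x \int[mu]_y (gker u x y)%:E)%E.
Proof.
by apply: eq_integral => x _; apply: eq_integral => y _; rewrite /gker powRN.
Qed.

Lemma gker_ge0 u x y : 0 <= gker u x y.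
Proof. by rewrite mulr_ge0 ?sqr_ge0 ?powR_ge0. Qed.

Lemma measurable_gker u : measurable_fun [set: R] u ->
  measurable_fun [set: R * R] (fun z => gker u z.1 z.2).
Proof. by move=> mu_; rewrite /gker; solve_measurable2. Qed.

Lemma gagliardo_ge0 u : (0 <= gagliardo u)%E.
Proof.
rewrite gagliardoE; apply: integral_ge0 => x _; apply: integral_ge0 => y _.
by rewrite lee_fin gker_ge0.
Qed.

Lemma gagliardoZ (c : R) u : measurable_fun [set: R] u ->
  gagliardo (fun x => c * u x) = ((c ^+ 2)%:E * gagliardo u)%E.
Proof.
move=> mu_; rewrite !gagliardoE -ge0_integral2Zl; [|exact: sqr_ge0|exact: measurable_gker|exact: gker_ge0].
apply: eq_integral => x _; apply: eq_integral => y _; congr EFin.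
by rewrite /gker -mulrBr exprMn mulrA.
Qed.

(** The kernel contributes [|a| ^ (1 + 2 s)] and each of the two integrals a Jacobian [|a|^-1]. *)
Lemma gagliardo_affine (a b : R) u : a != 0 -> measurable_fun [set: R] u ->
  gagliardo (fun x => u (a * x + b)) = ((`|a| `^ (1 + 2 * s) / `|a| ^+ 2)%:E * gagliardo u)%E.
Proof.
move=> a0 mu_; have na0 : 0 < `|a| by rewrite normr_gt0.
have mg := measurable_gker mu_.
have mgx x : measurable_fun [set: R] (gker u x) by exact: (measurable_fun_pair2 _ mg).
rewrite !gagliardoE.
transitivity (\int[mu]_x \int[mu]_y
    (`|a| `^ (1 + 2 * s) * gker u (a * x + b) (a * y + b))%:E)%E.
  apply: eq_integral => x _; apply: eq_integral => y _; congr EFin.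
  rewrite /gker (_ : a * x + b - (a * y + b) = a * (x - y)); last by ring.
  rewrite [RHS]mulrCA; congr (_ * _).
  rewrite normrM powRM// mulrA -powRD; first by rewrite subrr powRr0 mul1r.
  by apply/implyP => _; rewrite gt_eqF.
rewrite (@ge0_integral2Zl _ (`|a| `^ (1 + 2 * s)) (fun x y => gker u (a * x + b) (a * y + b)));
  [|exact: powR_ge0|by rewrite /gker; solve_measurable2|by move=> x y; exact: gker_ge0].
rewrite EFinM -muleA; congr (_ * _)%E.
transitivity (\int[mu]_x ((`|a|^-1)%:E * \int[mu]_y (gker u (a * x + b) y)%:E))%E.
  apply: eq_integral => x _.
  apply: (@ge0_integral_affine _ a b (fun y => (gker u (a * x + b) y)%:E)) => //.
  - by apply/measurable_EFinP.
  - by move=> y; rewrite lee_fin gker_ge0.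
rewrite (@ge0_integral_affine _ a b (fun x => (`|a|^-1)%:E * \int[mu]_y (gker u x y)%:E)%E)//; last 2 first.
- by apply: emeasurable_funM => //; exact: measurable_integral2.
- move=> x; rewrite mule_ge0 ?lee_fin ?invr_ge0//.
  by apply: integral_ge0 => y _; rewrite lee_fin gker_ge0.
rewrite ge0_integralZl; [|by []|exact: measurable_integral2| |by rewrite lee_fin invr_ge0].
  by rewrite muleA -EFinM -invfM -expr2.
by move=> x _; apply: integral_ge0 => y _; rewrite lee_fin gker_ge0.
Qed.

Lemma gagliardo_reflect (b : R) u : measurable_fun [set: R] u ->
  gagliardo (fun x => u (b - x)) = gagliardo u.
Proof.
move=> mu_; have N1 : (-1 : R) != 0 by rewrite oppr_eq0 oner_eq0.
have := gagliardo_affine b N1 mu_.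
rewrite normrN1 powR1 expr1n divr1 mul1e => <-.
by congr gagliardo; apply/funext => x; rewrite mulN1r addrC.
Qed.

Lemma eq_gagliardo_ae (u v : R -> R) : measurable_fun [set: R] u -> measurable_fun [set: R] v ->
  {ae mu, forall x, u x = v x} -> gagliardo u = gagliardo v.
Proof.
move=> mu_ mv uv; rewrite !gagliardoE.
have mgu := measurable_gker mu_; have mgv := measurable_gker mv.
apply: ae_eq_integral => //; [exact: measurable_integral2|exact: measurable_integral2|].
move: (uv); apply: filterS; first exact: (ae_filter_ringOfSetsType mu).
move=> x /= uvx _.
apply: ae_eq_integral => //.
- by apply/measurable_EFinP; exact: (measurable_fun_pair2 _ mgu).
- by apply/measurable_EFinP; exact: (measurable_fun_pair2 _ mgv).
move: (uv); apply: filterS; first exact: (ae_filter_ringOfSetsType mu).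
by move=> y /= uvy _; rewrite /gker uvx uvy.
Qed.

(* Up to a constant, the fractional integral of order [s] of the indicator of
   ]a, b]. *)
Definition wdiff (a b x : R) : R := tpow s (x - a) - tpow s (x - b).

Lemma measurable_wdiff a b : measurable_fun [set: R] (wdiff a b).
Proof. by rewrite /wdiff; solve_measurable2. Qed.

(** Put [d = b - a]. Rescaling [a, b] to [0, 1] extracts [d ^ s] from the function, hence
    [d ^ (2 s)] from its square, while the seminorm scales with exponent [2 s - 1]. Exactly one
    power of [d] is left, as for the squared L^2 norm of an indicator. *)
Lemma gagliardo_wdiff (a b : R) :
  gagliardo (wdiff a b) = (`|a - b|%:E * gagliardo (wdiff 0 1))%E.
Proof.
wlog ab : a b / a <= b => [hw|].
  have [ab|/ltW ba] := leP a b; first exact: hw.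
  rewrite distrC -(hw _ _ ba) !gagliardoE.
  apply: eq_integral => x _; apply: eq_integral => y _; congr (_ * _)%:E.
  by rewrite -sqrrN; congr (_ ^+ 2); rewrite /wdiff; ring.
move: ab; rewrite le_eqVlt => /orP[/eqP ->|ab].
  rewrite subrr normr0 mul0e gagliardoE.
  apply: integral0_eq => x _; apply: integral0_eq => y _.
  by rewrite /gker /wdiff !subrr expr0n/= mul0r.
have d0 : 0 < b - a by rewrite subr_gt0.
have := gagliardo_affine a (lt0r_neq0 d0) (measurable_wdiff a b).
rewrite (_ : (fun x => _) = (fun x => (b - a) `^ s * wdiff 0 1 x)); last first.
  apply/funext => x; rewrite /wdiff addrK subr0 mulrBr -!tpowZ// mulrBr mulr1.
  by congr (_ - tpow _ _); ring.
rewrite gagliardoZ; last exact: measurable_wdiff.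
rewrite (gtr0_norm d0) => /eq_mule_pdivl H.
apply: (eq_trans (H _)); first by rewrite divr_gt0 ?powR_gt0 ?exprn_gt0.
congr (_ * _)%E; congr EFin; rewrite (ltr0_norm (_ : a - b < 0)) ?subr_lt0// opprB.
rewrite powRD ?(gt_eqF d0) ?implybT// powRr1 ?(ltW d0)//.
have -> : ((b - a) `^ s) ^+ 2 = (b - a) `^ (2 * s) by rewrite -powR_mulrn ?powR_ge0// -powRrM mulrC.
by field; rewrite (gt_eqF d0) gt_eqF ?powR_gt0.
Qed.

End gagliardo.

(** * Quadratic forms on coefficients of zero sum *)

Section quadratic_forms.
Context {R : realType}.

(** Expanding the square on the right, the terms in [f i ^ 2] and [f j ^ 2] carry the factor
    [\sum_j e j = 0]; only the cross terms survive. *)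
Lemma sqr_sum_diff (I : finType) (e f : I -> R) : \sum_i e i = 0 ->
  (\sum_i e i * f i) ^+ 2 = - (2^-1) * \sum_i \sum_j e i * e j * (f i - f j) ^+ 2.
Proof.
move=> e0.
have key : \sum_i \sum_j e i * e j * (f i - f j) ^+ 2 = - (2 * (\sum_i e i * f i) ^+ 2).
  transitivity (\sum_i ((e i * f i ^+ 2) * (\sum_j e j) + e i * (\sum_j e j * f j ^+ 2)
      - 2 * (e i * f i) * (\sum_j e j * f j))).
    apply: eq_bigr => i _; rewrite !mulr_sumr -!big_split/= -sumrB.
    by apply: eq_bigr => j _; ring.
  rewrite sumrB big_split/= -!mulr_suml e0 mul0r mulr0 !add0r -mulr_sumr.
  by rewrite expr2; ring.
by rewrite key; field.
Qed.

(* The energy of a combination with zero total weight only depends on the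
   energies of the differences. *)
Lemma integral_sqr_sum_diff d (X : measurableType d) (m : {measure set X -> \bar R})
    (I : finType) (e t : I -> R) (f : I -> X -> R) (w : X -> R) (c : R) :
  (forall i, measurable_fun [set: X] (f i)) -> measurable_fun [set: X] w ->
  (forall x, 0 <= w x) -> \sum_i e i = 0 ->
  (forall i j, \int[m]_x ((f i x - f j x) ^+ 2 * w x)%:E = (c * `|t i - t j|)%:E)%E ->
  (\int[m]_x ((\sum_i e i * f i x) ^+ 2 * w x)%:E =
   (c * (- 2^-1 * \sum_i \sum_j e i * e j * `|t i - t j|))%:E)%E.
Proof.
move=> mf mw w0 e0 fc.
have mfij i j : measurable_fun [set: X] (fun x => (f i x - f j x) ^+ 2 * w x).
  by apply: measurable_funM => //; apply: measurable_funX; exact: measurable_funB.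
have int i j k : m.-integrable [set: X] (fun x => (k * ((f i x - f j x) ^+ 2 * w x))%:E).
  under eq_fun do rewrite EFinM.
  by apply: integrableZl => //; apply/integrable_fin_numP => //; rewrite fc.
under eq_integral do rewrite sqr_sum_diff// -mulrA mulr_suml.
transitivity (\int[m]_x (\sum_i \sum_j (- 2^-1 * (e i * e j) * ((f i x - f j x) ^+ 2 * w x))%:E))%E.
  apply: eq_integral => x _; rewrite mulr_sumr -sumEFin; apply: eq_bigr => i _.
  rewrite mulr_suml mulr_sumr -sumEFin; apply: eq_bigr => j _; congr EFin; ring.
rewrite integral_sum//; last by move=> i; apply: integrable_sum => // j; exact: int.
rewrite mulr_sumr mulr_sumr -sumEFin; apply: eq_bigr => i _.
rewrite integral_sum//.
rewrite mulr_sumr mulr_sumr -sumEFin; apply: eq_bigr => j _.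
under eq_integral do rewrite EFinM.
rewrite integralZl//; last by apply/integrable_fin_numP => //; rewrite fc.
by rewrite fc -EFinM; congr EFin; ring.
Qed.

End quadratic_forms.

Section step_functions.
Context {R : realType}.
Local Notation mu := (@lebesgue_measure R).
Local Notation tpow := (@tpow R).
Variables (I : finType) (e t : I -> R).
Hypothesis e0 : \sum_i e i = 0.

Lemma integral_heaviside_diff (a b : R) :
  (\int[mu]_y ((tpow 0 (y - a) - tpow 0 (y - b)) ^+ 2)%:E = `|a - b|%:E)%E.
Proof.
wlog ab : a b / a <= b => [hw|].
  have [ab|/ltW ba] := leP a b; first exact: hw.
  rewrite distrC -(hw _ _ ba); apply: eq_integral => y _; congr EFin.
  by rewrite -sqrrN opprB.
have -> : `|a - b|%:E = mu `]a, b].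
  rewrite lebesgue_measure_itv/= lte_fin distrC.
  case: ltP => [_|ba]; first by rewrite -EFinB ger0_norm// subr_ge0.
  by rewrite (le_anti (_ : a <= b <= a)) ?ab// subrr normr0.
rewrite -(setIT `]a, b]%classic) -integral_indic//; apply: eq_integral => y _; congr EFin.
rewrite indicE/= /tpow !subr_gt0 !powRr0.
case: (ltP a y) => ay/=; case: (ltP b y) => yb/=.
- by rewrite memNset/= ?subrr ?expr0n//= in_itv/= ay leNgt yb.
- by rewrite mem_set/= ?in_itv/= ?ay// subr0 expr1n.
- by move: (le_lt_trans ay (le_lt_trans ab yb)); rewrite ltxx.
- by rewrite memNset/= ?subrr ?expr0n//= in_itv/= ltNge ay.
Qed.

Lemma integral_sqr_step : (\int[mu]_y ((\sum_i e i * tpow 0 (y - t i)) ^+ 2)%:E =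
   (- 2^-1 * \sum_i \sum_j e i * e j * `|t i - t j|)%:E)%E.
Proof.
have := @integral_sqr_sum_diff R _ _ mu I e t (fun i y => tpow 0 (y - t i)) (fun=> 1) 1.
rewrite mul1r => <- //.
- by apply: eq_integral => y _; rewrite mulr1.
- by move=> i; solve_measurable2.
- by move=> i j; under eq_integral do rewrite mulr1; rewrite integral_heaviside_diff mul1r.
Qed.

(** [integral_sqr_sum_diff] is used twice: on the line with weight 1, and on the plane with the
    weight of the seminorm. The energies of pairs are [|t i - t j|] and [S1 |t i - t j|], so the two
    quadratic forms are proportional. *)
Lemma gagliardo_step (s S1 : R) : gagliardo s (wdiff s 0 1) = S1%:E ->
  gagliardo s (fun x => \sum_i e i * tpow s (x - t i)) =
  (S1%:E * \int[mu]_y ((\sum_i e i * tpow 0 (y - t i)) ^+ 2)%:E)%E.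
Proof.
move=> S1E; rewrite integral_sqr_step -EFinM gagliardoE.
pose f i (z : R * R) := tpow s (z.1 - t i) - tpow s (z.2 - t i).
pose w (z : R * R) := `|z.1 - z.2| `^ (- (1 + 2 * s)).
have mfi i : measurable_fun [set: R * R] (f i) by rewrite /f; solve_measurable2.
have mw : measurable_fun [set: R * R] w by rewrite /w; solve_measurable2.
have w0 z : 0 <= w z by exact: powR_ge0.
have := @integral_sqr_sum_diff R _ _ (mu \x mu)%E I e t f w S1 mfi mw w0 e0.
rewrite fubini_tonelli1.
- move=> <- /=.
    apply: eq_integral => x _; apply: eq_integral => y _; congr EFin.
    rewrite /gker /w/= -sumrB; congr (_ ^+ 2 * _).
    by apply: eq_bigr => i _; rewrite mulrBr.
  move=> i j; rewrite fubini_tonelli1.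
  + rewrite mulrC EFinM -S1E -gagliardo_wdiff gagliardoE.
    apply: eq_integral => x _; apply: eq_integral => y _; congr EFin.
    by rewrite /gker /w /f/= /wdiff; congr (_ ^+ 2 * _); ring.
  + by solve_measurable2.
  + by move=> z; rewrite lee_fin mulr_ge0// sqr_ge0.
- apply/measurable_EFinP; apply: measurable_funM => //; apply: measurable_funX.
  apply: (@measurable_sum _ _ _ _ _ _ (fun i x => e i * f i x)) => i.
  by apply: measurable_funM; [exact: measurable_cst|exact: mfi].
- by move=> z; rewrite lee_fin mulr_ge0// sqr_ge0.
Qed.

End step_functions.

(** * Finite energy of an increment of the power x_+^s *)

Section wdiff_energy.
Context {R : realType}.
Local Notation mu := (@lebesgue_measure R).
Local Notation tpow := (@tpow R).

Lemma sqr_le_2D (x y : R) : (x - y) ^+ 2 <= 2 * x ^+ 2 + 2 * y ^+ 2.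
Proof. by have := sqr_ge0 (x + y); rewrite -subr_ge0 => h; nra. Qed.

Lemma integral_sqrB_le (f g : R -> R) (M N : R) :
  measurable_fun [set: R] f -> measurable_fun [set: R] g ->
  (\int[mu]_x (f x ^+ 2)%:E <= M%:E)%E -> (\int[mu]_x (g x ^+ 2)%:E <= N%:E)%E ->
  (\int[mu]_x ((f x - g x) ^+ 2)%:E <= (2 * M + 2 * N)%:E)%E.
Proof.
move=> mf mg fM gN.
apply: (@le_trans _ _ (2%:E * \int[mu]_x (f x ^+ 2)%:E + 2%:E * \int[mu]_x (g x ^+ 2)%:E)%E); last first.
  by rewrite (EFinD (2 * M) (2 * N)) (EFinM 2 M) (EFinM 2 N) leeD// lee_pmul2l.
rewrite -!ge0_integralZl//; last 4 first.
- by solve_measurable2.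
- by move=> x _; rewrite lee_fin sqr_ge0.
- by solve_measurable2.
- by move=> x _; rewrite lee_fin sqr_ge0.
rewrite -ge0_integralD//; last 4 first.
- by move=> x _; rewrite mule_ge0// lee_fin sqr_ge0.
- by solve_measurable2.
- by move=> x _; rewrite mule_ge0// lee_fin sqr_ge0.
- by solve_measurable2.
apply: ge0_le_integral => //.
- by move=> x _; rewrite lee_fin sqr_ge0.
- by solve_measurable2.
- by solve_measurable2.
- by move=> x _; rewrite -!EFinM -EFinD lee_fin; exact: sqr_le_2D.
Qed.

Variable s : R.
Hypotheses (s0 : 0 < s) (sh : s < 2^-1).

Let dw (d x : R) : R := tpow s x - tpow s (x + d).

Let mdw d : measurable_fun [set: R] (dw d).
Proof. by rewrite /dw; solve_measurable2. Qed.

(** On ]-1, 0] the increment is at most 1. For x > 0, with [q = x / (1 + x) <= 1], the bound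
    [q <= q ^ s] gives [(1 + x) ^ s (1 - q ^ s) <= (1 + x) ^ s (1 - q) = (1 + x) ^ (s - 1)], whose
    square is integrable at infinity since [s < 1/2]. *)
Let dw1_le (x : R) : dw 1 x ^+ 2 <= tpow 0 (x - (-1)) * tpow 0 (1 - x) + tpow 0 x * tpow (2 * s - 2) (1 + x).
Proof.
move: s0 sh => s0' sh'.
have r0 : 0 <= tpow 0 x * tpow (2 * s - 2) (1 + x) by rewrite mulr_ge0// tpow_ge0.
have l0 : 0 <= tpow 0 (x - (-1)) * tpow 0 (1 - x) by rewrite mulr_ge0// tpow_ge0.
rewrite /dw; have [x0|x0] := leP x 0.
  rewrite [tpow s x]tpow_le0// sub0r sqrrN; apply: ler_wpDr => //.
  rewrite opprK; have [x1|x1] := leP (x + 1) 0.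
    by rewrite tpow_le0// expr0n/= mulr_ge0// tpow_ge0.
  rewrite !tpowE//; last by lra.
  rewrite !powRr0 mulr1 exprn_ile1 ?powR_ge0//.
  have p1 : 1 `^ s = 1 :> R by rewrite powR1.
  by rewrite -[leRHS]p1 ge0_ler_powR ?nnegrE//; lra.
apply: ler_wpDl => //; rewrite !tpowE//; [|lra|lra].
rewrite powRr0 mul1r -sqrrN opprB (addrC x 1).
have x10 : 0 < 1 + x by lra.
have -> : (1 + x) `^ (2 * s - 2) = ((1 + x) `^ (s - 1)) ^+ 2.
  by rewrite -powR_mulrn ?powR_ge0// -powRrM; congr (_ `^ _); ring.
have xs : x `^ s <= (1 + x) `^ s by rewrite ge0_ler_powR ?nnegrE//; lra.
rewrite ler_sqr ?nnegrE ?subr_ge0 ?powR_ge0//.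
have -> : (1 + x) `^ (s - 1) = (1 + x) `^ s / (1 + x).
  by rewrite powRB ?powRr1 ?ltW//; apply/implyP => _; rewrite gt_eqF.
have -> : x `^ s = (1 + x) `^ s * (x / (1 + x)) `^ s.
  rewrite -powRM ?ltW ?divr_gt0//; congr (_ `^ _).
  by rewrite mulrC divfK// gt_eqF.
rewrite -{1}[(1 + x) `^ s]mulr1 -mulrBr ler_wpM2l ?powR_ge0//.
have xq : 0 < x / (1 + x) <= 1 by rewrite divr_gt0//= ler_pdivrMr// mul1r; lra.
have := ger1_powR xq (_ : s <= 1) => /(_ ltac:(lra)) h.
rewrite lerBlDr; apply: (le_trans _ (lerD (lexx _) h)).
rewrite le_eqVlt; apply/orP; left; apply/eqP; field.
by rewrite gt_eqF.
Qed.

Let D1 : R := fine (\int[mu]_x (dw 1 x ^+ 2)%:E)%E.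

Let D1E : (\int[mu]_x (dw 1 x ^+ 2)%:E = D1%:E)%E.
Proof.
move: s0 sh => s0' sh'.
rewrite /D1 fineK// ge0_fin_numE; last by apply: integral_ge0 => x _; rewrite lee_fin sqr_ge0.
apply: (@ge0_integral_dom2 _ _ (fun x => tpow 0 (x - (-1)) * tpow 0 (1 - x))
   (fun x => tpow 0 x * tpow (2 * s - 2) (1 + x)) 1 1).
- by have mdw1 := mdw 1; solve_measurable2.
- by solve_measurable2.
- by solve_measurable2.
- by [].
- by [].
- by move=> x; exact: sqr_ge0.
- by move=> x; rewrite mulr_ge0// tpow_ge0.
- by move=> x; rewrite mulr_ge0// tpow_ge0.
- by move=> x; rewrite !mul1r dw1_le.
- rewrite integral_tpow_between -EFin_fine_Beta ?ltrN10// -EFinM.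
  exact: ltry.
- by apply: Beta'_lty; lra.
Qed.

Let D1_ge0 : 0 <= D1.
Proof. by rewrite /D1 fine_ge0//; apply: integral_ge0 => x _; rewrite lee_fin sqr_ge0. Qed.

Let dw_gt0 d : 0 < d -> (\int[mu]_x (dw d x ^+ 2)%:E = (D1 * d `^ (1 + 2 * s))%:E)%E.
Proof.
move=> d0; have mdw1 := mdw 1; have mdwd := mdw d.
rewrite (@ge0_integral_scale _ _ 0 _ d0); last 2 first.
- by solve_measurable2.
- by move=> x; rewrite lee_fin sqr_ge0.
transitivity (d%:E * \int[mu]_z (((d `^ s) ^+ 2)%:E * (dw 1 z ^+ 2)%:E))%E.
  congr (_ * _)%E; apply: eq_integral => z _; rewrite -EFinM; congr EFin.
  rewrite /dw addr0 -exprMn mulrBr -!tpowZ//; congr ((_ - tpow _ _) ^+ 2); ring.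
rewrite ge0_integralZl//; last 3 first.
- by solve_measurable2.
- by move=> x _; rewrite lee_fin sqr_ge0.
- by rewrite lee_fin sqr_ge0.
rewrite D1E -!EFinM; congr EFin; rewrite mulrA mulrC; congr (_ * _).
rewrite powRD ?(gt_eqF d0) ?implybT// powRr1 ?(ltW d0)//; congr (_ * _).
by rewrite -powR_mulrn ?powR_ge0// -powRrM mulrC.
Qed.

Let dwE d : (\int[mu]_x (dw d x ^+ 2)%:E = (D1 * `|d| `^ (1 + 2 * s))%:E)%E.
Proof.
have [d0|d0|->] := ltgtP d 0.
- have nd0 : 0 < - d by rewrite oppr_gt0.
  rewrite (ltr0_norm d0) -(dw_gt0 nd0).
  rewrite -(@ge0_integral_shift _ (- d) (fun x => (dw d x ^+ 2)%:E)); last 2 first.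
  + by have mdwd := mdw d; solve_measurable2.
  + by move=> x; rewrite lee_fin sqr_ge0.
  apply: eq_integral => x _; congr EFin.
  by rewrite /dw subrK -sqrrN opprB.
- by rewrite gtr0_norm// dw_gt0.
- rewrite normr0 powR0 ?mulr0; last by move: s0 => s0'; apply/eqP => h; lra.
  by apply: integral0_eq => x _; rewrite /dw addr0 subrr expr0n.
Qed.

Let u := wdiff s 0 1.
Let mu_ : measurable_fun [set: R] u. Proof. exact: measurable_wdiff. Qed.
Let uE x : u x = dw (-1) x. Proof. by rewrite /u /wdiff /dw subr0. Qed.

Let K d : \bar R := (\int[mu]_x ((u x - u (x + d)) ^+ 2)%:E)%E.

Let K_le1 d : (K d <= (4 * D1)%:E)%E.
Proof.
have u2 : (\int[mu]_x (u x ^+ 2)%:E = D1%:E)%E.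
  under eq_integral do rewrite uE.
  by rewrite dwE normrN1 powR1 mulr1.
have -> : 4 * D1 = 2 * D1 + 2 * D1 by ring.
apply: integral_sqrB_le; [exact: mu_|by solve_measurable2|by rewrite u2|].
rewrite (@ge0_integral_shift _ d (fun x => (u x ^+ 2)%:E)); first by rewrite u2.
- by solve_measurable2.
- by move=> x; rewrite lee_fin sqr_ge0.
Qed.

(* [K d] is of order [|d| ^ (1 + 2 s)] near 0 because the increment of
   [u] is a difference of two translates of [dw d]. *)
Let K_le2 d : (K d <= (4 * D1 * `|d| `^ (1 + 2 * s))%:E)%E.
Proof.
have mdwd := mdw d.
rewrite /K (_ : (\int[mu]_x _)%E = \int[mu]_x ((dw d x - dw d (x - 1)) ^+ 2)%:E)%E; last first.
  apply: eq_integral => x _; congr (_ ^+ 2)%:E; rewrite /u /wdiff /dw !subr0.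
  by rewrite (_ : x - 1 + d = x + d - 1); ring.
have -> : 4 * D1 * `|d| `^ (1 + 2 * s) = 2 * (D1 * `|d| `^ (1 + 2 * s)) + 2 * (D1 * `|d| `^ (1 + 2 * s)).
  by ring.
apply: integral_sqrB_le; [exact: mdwd|by solve_measurable2|by rewrite dwE|].
rewrite (@ge0_integral_shift _ (-1) (fun x => (dw d x ^+ 2)%:E)); first by rewrite dwE.
- by solve_measurable2.
- by move=> x; rewrite lee_fin sqr_ge0.
Qed.

(** An integrable majorant of min(1, d ^ (- 1 - 2 s)) on d > 0; up to the factor [4 D1] it bounds
    the weighted [K d]. *)
Let G1 (d : R) : R := (tpow 0 \_ `]0, 1]) d + (tpow (- (1 + 2 * s)) \_ `[1, +oo[) d.

Let G1_ge0 d : 0 <= G1 d.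
Proof. by rewrite addr_ge0//; exact: restrict_tpow_ge0. Qed.

Let mG1 : measurable_fun [set: R] G1.
Proof. by apply: measurable_funD; exact: measurable_restrict_tpow. Qed.

Let G1_lty : (\int[mu]_d (G1 d)%:E < +oo)%E.
Proof.
move: s0 => s0'.
apply: (@ge0_integral_dom2 _ _ (tpow 0 \_ `]0, 1]) (tpow (- (1 + 2 * s)) \_ `[1, +oo[) 1 1).
- exact: mG1.
- exact: measurable_restrict_tpow.
- exact: measurable_restrict_tpow.
- by [].
- by [].
- exact: G1_ge0.
- by move=> x; exact: restrict_tpow_ge0.
- by move=> x; exact: restrict_tpow_ge0.
- by move=> x; rewrite !mul1r.
- by apply: integral_restrict_lty => //; apply: integral_tpow01_lty; lra.
- by apply: integral_restrict_lty => //; apply: integral_tpow1y_lty; lra.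
Qed.

Let G1_bound (e : R) (k : \bar R) : 0 < e -> (0 <= k)%E ->
  (k <= (4 * D1)%:E)%E -> (k <= (4 * D1 * e `^ (1 + 2 * s))%:E)%E ->
  ((e `^ (- (1 + 2 * s)))%:E * k <= (4 * D1 * G1 e)%:E)%E.
Proof.
case: k => [k| |]// e_gt0; rewrite !lee_fin => k0 k1 k2.
have D0 : 0 <= 4 * D1 by rewrite mulr_ge0.
rewrite /G1; have [e1|e1] := leP e 1.
  apply: (@le_trans _ _ (4 * D1 * 1)).
    apply: le_trans (ler_wpM2l (powR_ge0 _ _) k2) _.
    rewrite mulrCA -powRD; first by rewrite addNr powRr0.
    by apply/implyP => _; rewrite gt_eqF.
  rewrite ler_wpM2l// [X in X + _]patchE mem_set/= ?in_itv/= ?e_gt0// tpowE// powRr0.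
  by rewrite lerDl restrict_tpow_ge0.
apply: (@le_trans _ _ (4 * D1 * e `^ (- (1 + 2 * s)))).
  by rewrite mulrC ler_wpM2r ?powR_ge0.
have -> : (tpow (- (1 + 2 * s)) \_ `[1, +oo[) e = e `^ (- (1 + 2 * s)).
  by rewrite patchE mem_set/= ?in_itv/= ?(ltW e1)// tpowE.
rewrite ler_wpM2l//.
by rewrite lerDr restrict_tpow_ge0.
Qed.

(** With [y = x + d] and Tonelli the seminorm is the integral of [K d] against [|d| ^ (- 1 - 2 s)]:
    [K_le2] cancels the weight near 0 and [K_le1] leaves an integrable tail. *)
Lemma gagliardo_wdiff01_lty : (gagliardo s (wdiff s 0 1) < +oo)%E.
Proof.
have mg := measurable_gker s mu_.
rewrite gagliardoE -/u.
have -> : (\int[mu]_x \int[mu]_y (gker s u x y)%:E = \int[mu]_x \int[mu]_d (gker s u x (d + x))%:E)%E.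
  apply: eq_integral => x _.
  rewrite -(@ge0_integral_shift _ x (fun y => (gker s u x y)%:E))//.
  - by apply/measurable_EFinP; exact: (measurable_fun_pair2 _ mg).
  - by move=> y; rewrite lee_fin gker_ge0.
rewrite ge0_fubini; [|by rewrite /gker; solve_measurable2|by move=> x d; exact: gker_ge0].
have -> : (\int[mu]_d \int[mu]_x (gker s u x (d + x))%:E = \int[mu]_d ((`|d| `^ (- (1 + 2 * s)))%:E * K d))%E.
  apply: eq_integral => d _; rewrite /K -ge0_integralZl; [|by []|by solve_measurable2| |].
  - apply: eq_integral => x _; rewrite -EFinM mulrC; congr EFin.
    by rewrite /gker (_ : x - (d + x) = - d) ?normrN ?(addrC d x)//; ring.
  - by move=> x _; rewrite lee_fin sqr_ge0.
  - by rewrite lee_fin powR_ge0.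
have K0 d : (0 <= K d)%E by apply: integral_ge0 => x _; rewrite lee_fin sqr_ge0.
apply: (@le_lt_trans _ _ (\int[mu]_d (4 * D1 * G1 d + 4 * D1 * G1 (0 - d))%:E)%E).
  apply: ge0_le_integral.
  - by [].
  - by move=> d _; rewrite mule_ge0// lee_fin powR_ge0.
  - by apply: emeasurable_funM; [by solve_measurable2|rewrite /K; solve_measurable2].
  - by solve_measurable2.
  move=> d _; have D0 : 0 <= 4 * D1 by rewrite mulr_ge0.
  have [d0|d0|->] := ltgtP d 0.
  - have nd0 : 0 < - d by rewrite oppr_gt0.
    rewrite (ltr0_norm d0) sub0r; apply: (@le_trans _ _ (4 * D1 * G1 (- d))%:E).
      apply: G1_bound => //; have := K_le2 d; by rewrite (ltr0_norm d0).
    by rewrite lee_fin lerDr mulr_ge0.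
  - rewrite (gtr0_norm d0); apply: (@le_trans _ _ (4 * D1 * G1 d)%:E).
      apply: G1_bound => //; have := K_le2 d; by rewrite (gtr0_norm d0).
    by rewrite lee_fin lerDl mulr_ge0.
  (* At [d = 0] the weight is a nonzero power of 0, which is 0 by convention. *)
  - rewrite normr0 powR0 ?mul0e; first by rewrite lee_fin addr_ge0// mulr_ge0.
    by move: s0 => s0'; apply/eqP => h; lra.
apply: (@ge0_integral_dom2 _ _ G1 (fun d => G1 (0 - d)) (4 * D1) (4 * D1)).
- by solve_measurable2.
- exact: mG1.
- by solve_measurable2.
- by rewrite mulr_ge0.
- by rewrite mulr_ge0.
- by move=> x; rewrite addr_ge0// mulr_ge0// mulr_ge0.
- exact: G1_ge0.
- by move=> x; exact: G1_ge0.
- by [].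
- exact: G1_lty.
- rewrite (@ge0_integral_reflect _ 0 (fun d => (G1 d)%:E)); first exact: G1_lty.
  + by solve_measurable2.
  + by move=> d; rewrite lee_fin.
Qed.

End wdiff_energy.

(** * The Gagliardo seminorm of fractional integrals *)

Section gagliardo_fatou.
Context {R : realType}.
Local Notation mu := (@lebesgue_measure R).
Variable s : R.

Lemma limn_einf_le_cvg (u : (\bar R)^nat) (M : R^nat) (m : R) :
  (forall n, u n <= (M n)%:E)%E -> M n @[n --> \oo] --> m -> (limn_einf u <= m%:E)%E.
Proof.
move=> uM Mm; apply/lee_addgt0Pr => e e0.
rewrite limn_einf_lim; apply: lime_le; first exact: is_cvg_einfs.
have /cvgrPdist_lt /(_ _ e0) := Mm; apply: filterS => n /= mn.
apply: (@le_trans _ _ (u n)).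
  by apply: ereal_inf_lbound; exists n => //=.
rewrite (le_trans (uM n))// -EFinD lee_fin -lerBlDl.
by rewrite (le_trans _ (ltW mn))// distrC ler_norm.
Qed.

Lemma gagliardo_prod (u : R -> R) : measurable_fun [set: R] u ->
  gagliardo s u = (\int[mu \x mu]_z (gker s u z.1 z.2)%:E)%E.
Proof.
move=> mu_; rewrite gagliardoE fubini_tonelli1//.
- by apply/measurable_EFinP; exact: measurable_gker.
- by move=> z; rewrite lee_fin gker_ge0.
Qed.

(** Multiplication by the indicator of the complement of the exceptional set turns convergence
    almost everywhere on the line into convergence at every point, hence at every pair of points;
    Fatou's lemma is then applied in the plane. The seminorms are unchanged. *)
Lemma gagliardo_fatou (v_ : nat -> R -> R) (v : R -> R) (M : R^nat) (m : R) :
  (forall n, measurable_fun [set: R] (v_ n)) -> measurable_fun [set: R] v ->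
  {ae mu, forall x, v_ n x @[n --> \oo] --> v x} ->
  (forall n, gagliardo s (v_ n) <= (M n)%:E)%E -> M n @[n --> \oo] --> m ->
  (gagliardo s v <= m%:E)%E.
Proof.
move=> mv_ mv vv vM Mm.
have [N [mN N0 sN]] := vv.
pose u_ n x := v_ n x * \1_(~` N) x; pose u x := v x * \1_(~` N) x.
have mI : measurable_fun [set: R] (\1_(~` N) : R -> R).
  by apply: measurable_indic; exact: measurableC.
have mu_ n : measurable_fun [set: R] (u_ n) by apply: measurable_funM.
have mu0 : measurable_fun [set: R] u by apply: measurable_funM.
have aeN (f g : R -> R) : (forall x, ~ N x -> f x = g x) -> {ae mu, forall x, f x = g x}.
  move=> fg; exists N; split => // x /= h; apply: contrapT => /fg; exact: h.
have -> : gagliardo s v = gagliardo s u.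
  apply: eq_gagliardo_ae => //; apply: aeN => x Nx.
  by rewrite /u indicE mem_set ?mulr1.
have {}vM n : (gagliardo s (u_ n) <= (M n)%:E)%E.
  have -> : gagliardo s (u_ n) = gagliardo s (v_ n).
    apply: eq_gagliardo_ae; [exact: mu_|exact: mv_|apply: aeN => x Nx].
    by rewrite /u_ indicE mem_set ?mulr1.
  exact: vM.
have uu x : u_ n x @[n --> \oo] --> u x.
  rewrite /u_ /u indicE; have [xN|xN] := pselect (N x).
    rewrite memNset/=; last by move=> h; exact: h.
    by rewrite mulr0; under eq_fun do rewrite mulr0; exact: cvg_cst.
  rewrite mem_set//= mulr1; under eq_fun do rewrite mulr1.
  by apply: contrapT => h; apply: xN; exact: sN.
rewrite gagliardo_prod//.
apply: (@le_trans _ _ (\int[mu \x mu]_z limn_einf (fun n => (gker s (u_ n) z.1 z.2)%:E))%E).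
  rewrite le_eqVlt; apply/orP; left; apply/eqP; apply: eq_integral => z _.
  apply/esym; apply: (cvg_limn_einf_sup _).1.
  apply: cvg_EFin; first exact: nearW.
  rewrite (_ : fine \o _ = fun n => gker s (u_ n) z.1 z.2)//.
  rewrite /gker; apply: cvgMl; apply: (@cvg_comp _ _ _ _ (fun x => x ^+ 2) _ (nbhs (u z.1 - u z.2))).
    exact: cvgB.
  exact: exprn_continuous.
apply: (@le_trans _ _ (limn_einf (fun n => \int[mu \x mu]_z (gker s (u_ n) z.1 z.2)%:E))%E).
  apply: fatou => //.
  - by move=> n; apply/measurable_EFinP; exact: measurable_gker.
  - by move=> n z _; rewrite lee_fin gker_ge0.
apply: limn_einf_le_cvg Mm => n.
by rewrite -gagliardo_prod.
Qed.

End gagliardo_fatou.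

(** * Potentials of step functions *)

Section step_bound.
Context {R : realType}.
Local Notation mu := (@lebesgue_measure R).
Local Notation tpow := (@tpow R).
Variable s : R.
Hypotheses (s0 : 0 < s) (sh : s < 2^-1).

(* Without the factor [(Gamma s)^-1]; the value is 0 where the integral
   diverges. *)
Definition frac_int (h : R -> R) (x : R) : R := \int[mu]_y (tpow (s - 1) (x - y) * h y).

Lemma measurable_frac_int h : measurable_fun [set: R] h -> measurable_fun [set: R] (frac_int h).
Proof. by move=> mh; rewrite /frac_int; solve_measurable2. Qed.

(** The potential of a Heaviside function is [Beta 0 (s - 1)], that is 1 / s, times a translate of
    [tpow s]; the square of this factor multiplies the energy of [wdiff s 0 1]. *)
Definition step_cst : R := fine (@Beta R 0 (s - 1)) ^+ 2 * fine (gagliardo s (wdiff s 0 1)).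

Lemma step_cst_ge0 : 0 <= step_cst.
Proof. by rewrite mulr_ge0 ?sqr_ge0// fine_ge0// gagliardo_ge0. Qed.

Lemma frac_int_heaviside (a x : R) : 
  (\int[mu]_y (tpow (s - 1) (x - y) * tpow 0 (y - a))%:E = (fine (Beta 0 (s - 1)) * tpow s (x - a))%:E)%E.
Proof.
move: s0 => s0'; under eq_integral do rewrite mulrC.
rewrite integral_tpow_between -EFin_fine_Beta; [|by rewrite ltrN10|by lra].
by rewrite -EFinM add0r subrK.
Qed.

Lemma gagliardo_frac_int_step (I : finType) (e t : I -> R) (h : R -> R) : \sum_i e i = 0 ->
  (forall y, h y = \sum_i e i * tpow 0 (y - t i)) ->
  gagliardo s (frac_int h) = (step_cst%:E * \int[mu]_y (h y ^+ 2)%:E)%E.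
Proof.
move=> e0 hE.
have inte i x : mu.-integrable [set: R] (fun y => (e i * (tpow (s - 1) (x - y) * tpow 0 (y - t i)))%:E).
  under eq_fun do rewrite EFinM.
  apply: integrableZl => //; apply/integrable_fin_numP; first by solve_measurable2.
  by rewrite frac_int_heaviside.
have -> : frac_int h = (fun x => fine (Beta 0 (s - 1)) * \sum_i e i * tpow s (x - t i)).
  apply/funext => x; rewrite /frac_int /Rintegral.
  transitivity (fine (\int[mu]_y (\sum_i (e i * (tpow (s - 1) (x - y) * tpow 0 (y - t i)))%:E)))%E.
    congr fine; apply: eq_integral => y _; rewrite sumEFin hE mulr_sumr; congr EFin.
    by apply: eq_bigr => i _; ring.
  rewrite integral_sum// mulr_sumr.
  under eq_bigr do under eq_integral do rewrite EFinM.
  under eq_bigr => i _.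
    rewrite integralZl//; last by apply/integrable_fin_numP; [solve_measurable2|rewrite frac_int_heaviside].
    rewrite frac_int_heaviside -EFinM mulrCA.
    over.
  by rewrite sumEFin.
rewrite gagliardoZ; last by apply: measurable_sum => i; solve_measurable2.
have S1E : gagliardo s (wdiff s 0 1) = (fine (gagliardo s (wdiff s 0 1)))%:E.
  by rewrite fineK// ge0_fin_numE ?gagliardo_ge0// gagliardo_wdiff01_lty.
rewrite (@gagliardo_step _ _ e t e0 _ _ S1E) muleA -EFinM; congr (_ * _)%E.
by apply: eq_integral => y _; rewrite hE.
Qed.

End step_bound.

(** * Averages over uniform grids *)

Section grid.
Context {R : realType}.
Local Notation mu := (@lebesgue_measure R).
Local Notation tpow := (@tpow R).
Variables (h : R -> R) (T N : R).
Hypotheses (mh : measurable_fun [set: R] h) (N0 : 0 <= N)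
  (hN : forall x, `|h x| <= N) (hsupp : forall x, ~~ (0 <= x <= T) -> h x = 0).

(** An integer above [T]: for every mesh [1 / n.+1], the cells then fill ]0, M] exactly. *)
Let M : nat := (Num.truncn T).+1.
Let m n : nat := (M * n.+1)%N.
Let dl n : R := n.+1%:R^-1.

Let dl0 n : 0 < dl n. Proof. by rewrite invr_gt0 ltr0n. Qed.

Definition cell n (j : R) : set R := `](j * n.+1%:R^-1), ((j + 1) * n.+1%:R^-1)]%classic.

Definition cell_avg n (j : R) : R := n.+1%:R * \int[mu]_(y in cell n j) h y.

(** Indicators of cells are written as differences of Heaviside functions, the form required by the
    exact energy formula. *)
Definition grid_step n (y : R) : R :=
  \sum_(j < (m n)) cell_avg n j%:R * (tpow 0 (y - j%:R * dl n) - tpow 0 (y - (j%:R + 1) * dl n)).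

(** The boolean selects an end of the cell. The average enters with opposite signs at the two ends,
    hence the zero sum. *)
Lemma grid_step_sum n : exists (I : finType) (e t : I -> R), \sum_i e i = 0 /\
  forall y, grid_step n y = \sum_i e i * tpow 0 (y - t i).
Proof.
exists ('I_(m n) * bool)%type.
exists (fun i : 'I_(m n) * bool => if i.2 then cell_avg n i.1%:R else - cell_avg n i.1%:R).
exists (fun i : 'I_(m n) * bool => (if i.2 then i.1%:R else i.1%:R + 1) * dl n); split.
  rewrite -(pair_bigA _ (fun (i : 'I_(m n)) (b : bool) => if b then cell_avg n i%:R else - cell_avg n i%:R))/=.
  by apply: big1 => i _; rewrite big_bool/= subrr.
move=> y; rewrite -(pair_bigA _ (fun (i : 'I_(m n)) (b : bool) =>
   (if b then cell_avg n i%:R else - cell_avg n i%:R) *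
   tpow 0 (y - (if b then i%:R else i%:R + 1) * dl n)))/=.
by apply: eq_bigr => i _; rewrite big_bool/= mulrBr mulNr.
Qed.

Lemma measure_cell n j : mu (cell n j) = (n.+1%:R^-1)%:E.
Proof.
rewrite /cell lebesgue_measure_itv/= lte_fin ltr_pM2r ?dl0// ltrDl ltr01.
by rewrite -EFinB mulrDl mul1r addrAC subrr add0r.
Qed.

Lemma cell_avg_bound n j : `|cell_avg n j| <= N.
Proof.
rewrite /cell_avg normrM ger0_norm// mulrC -ler_pdivlMr ?ltr0n//.
rewrite -lee_fin Rintegral_mkcond.
have mp : measurable_fun [set: R] (h \_ (cell n j)).
  by apply/(measurable_restrictT h); [exact: measurable_itv|exact: measurable_funTS].
apply: le_trans; first exact: (@le_normr_Rintegral_ge0 _ _ _ mu _ mp).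
apply: (@le_trans _ _ (\int[mu]_x (N%:E * (\1_(cell n j) x)%:E))%E).
  apply: ge0_le_integral => //.
  - by apply/measurable_EFinP; exact: (measurableT_comp (@normr_measurable _ _) mp).
  - by apply: emeasurable_funM => //; apply/measurable_EFinP; apply: measurable_indic; exact: measurable_itv.
  - move=> x _; rewrite -EFinM lee_fin patchE indicE; case: ifPn => _; first by rewrite mulr1.
    by rewrite normr0 mulr0.
rewrite ge0_integralZl//.
- rewrite (_ : (\int[mu]_x (\1_(cell n j) x)%:E)%E = mu (cell n j)); first by rewrite measure_cell -EFinM.
  by rewrite integral_indic ?setIT//; exact: measurable_itv.
- by apply/measurable_EFinP; apply: measurable_indic; exact: measurable_itv.
Qed.

Lemma grid_step_le0 n y : y <= 0 -> grid_step n y = 0.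
Proof.
move=> y0; apply: big1 => j _; rewrite !tpow_le0 ?subrr ?mulr0// subr_le0 (le_trans y0)//.
  by rewrite mulr_ge0// ltW.
by rewrite mulr_ge0 ?addr_ge0// ltW.
Qed.

(** Cells are closed on the right, so the cell of [y > 0] has index the ceiling of [y n.+1] minus
    one. *)
Let kidx (n : nat) (y : R) : nat := `|Num.ceil (y * n.+1%:R)|%N.-1.

Let kidxP n y : 0 < y -> (kidx n y)%:R < y * n.+1%:R <= (kidx n y)%:R + 1 /\
  (Num.ceil (y * n.+1%:R))%:~R = (kidx n y)%:R + 1 :> R.
Proof.
move=> y0; have z0 : 0 < y * n.+1%:R by rewrite mulr_gt0// ltr0n.
have c0 : (0 < Num.ceil (y * n.+1%:R))%R by rewrite ceil_gt0.
have E : (Num.ceil (y * n.+1%:R))%:~R = (kidx n y)%:R + 1 :> R.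
  rewrite /kidx; case: (Num.ceil _) c0 => [[|k]|k]// _.
  by rewrite /= -pmulrn -natr1.
split=> //; have := ceil_itv (y * n.+1%:R).
by rewrite intrD E/= addrK.
Qed.

Lemma grid_stepE n y : 0 < y ->
  grid_step n y = if (kidx n y < m n)%N then cell_avg n (kidx n y)%:R else 0.
Proof.
move=> y0; have [/andP[k1 k2] _] := kidxP n y0.
have E (j : nat) : tpow 0 (y - j%:R * dl n) - tpow 0 (y - (j%:R + 1) * dl n) = (j == kidx n y)%:R.
  rewrite /tpow !subr_gt0 /dl !ltr_pdivrMr ?ltr0n// !powRr0.
  have -> : (j%:R < y * n.+1%:R) = (j <= kidx n y)%N.
    apply/idP/idP => [jy|jk].
      by rewrite -ltnS -(ltr_nat R) -natr1 (lt_le_trans jy).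
    by rewrite (le_lt_trans _ k1)// ler_nat.
  have -> : (j%:R + 1 < y * n.+1%:R) = (j < kidx n y)%N.
    rewrite natr1; apply/idP/idP => [jy|jk].
      by rewrite -ltnS -(ltr_nat R) -[X in _ < X]natr1 (lt_le_trans jy).
    by rewrite (le_lt_trans _ k1)// ler_nat.
  by case: (ltngtP j (kidx n y)) => _; rewrite /= ?subrr ?subr0.
rewrite /grid_step; case: ifPn => [km|km].
  rewrite (bigD1 (Ordinal km))//= E eqxx mulr1 big1 ?addr0// => j jk.
  rewrite E (_ : (_ == _) = false) ?mulr0//; apply/eqP => jE; move/eqP: jk; apply.
  exact: val_inj.
apply: big1 => j _; rewrite E (_ : (_ == _) = false) ?mulr0//.
by apply/eqP => jE; move: km; rewrite -jE ltn_ord.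
Qed.

Lemma grid_step_bound n y : `|grid_step n y| <= N.
Proof.
have [y0|y0] := leP y 0; first by rewrite grid_step_le0// normr0.
by rewrite grid_stepE//; case: ifP => _; [exact: cell_avg_bound|rewrite normr0].
Qed.

Let TM : T < M%:R. Proof. exact: Num.Theory.truncnS_gt. Qed.

Lemma grid_step_gtM n y : M%:R < y -> grid_step n y = 0.
Proof.
move=> My; have y0 : 0 < y by rewrite (le_lt_trans _ My).
rewrite grid_stepE// ifF//; apply/negbTE; rewrite -leqNgt.
have [/andP[k1 k2] _] := kidxP n y0.
rewrite -ltnS -(ltr_nat R) -natr1; apply: (lt_le_trans _ k2).
by rewrite natrM ltr_pM2r ?ltr0n.
Qed.


Lemma nicely_shrinking_cell y :
  nicely_shrinking y (fun n => cell n ((Num.ceil (y * n.+1%:R))%:~R - 1)).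
Proof.
split; first by move=> n; exact: measurable_itv.
have r0 (n : nat) : (0 : R) < 2 * n.+1%:R^-1 by rewrite mulr_gt0// dl0.
(* The cell of [y] has length [1 / n.+1] and lies in the ball of radius [2 / n.+1] about [y], whose
   measure is four times as large. *)
exists (4, fun n => PosNum (r0 n)); split => //=.
- rewrite -[X in _ --> X](mulr0 2); apply: cvgMr; exact: cvg_harmonic.
- move=> n z; rewrite /ball/= /cell/= in_itv/= subrK => /andP[z1 z2].
  have /andP[c1 c2] := ceil_itv (y * n.+1%:R); have n0 : (0 : R) < n.+1%:R by rewrite ltr0n.
  have {}z1 : (Num.ceil (y * n.+1%:R))%:~R - 1 < z * n.+1%:R by rewrite -ltr_pdivrMr.
  have {}z2 : z * n.+1%:R <= (Num.ceil (y * n.+1%:R))%:~R by rewrite -ler_pdivlMr.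
  rewrite intrD/= in c1.
  rewrite -(ltr_pM2r n0) mulrVK ?unitfE ?gt_eqF// -{1}(gtr0_norm n0) -normrM mulrBl.
  by rewrite ltr_norml; apply/andP; split; lra.
- move=> n; rewrite lebesgue_measure_ball; last exact: ltW.
  by rewrite measure_cell -EFinM lee_fin -mulrnAl ler_wpM2r ?invr_ge0// -mulr_natr; lra.
Qed.

Lemma integrable_bounded_supp : mu.-integrable [set: R] (EFin \o h).
Proof.
apply/integrableP; split; first exact/measurable_EFinP.
apply: (@le_lt_trans _ _ (\int[mu]_y (N%:E * (tpow 0 (y - (-1)) * tpow 0 (T + 1 - y))%:E))%E).
  apply: ge0_le_integral => //.
  - by apply: measurableT_comp => //; exact/measurable_EFinP.
  - by solve_measurable2.
  - move=> y _; rewrite -EFinM lee_fin.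
    have [yT|yT] := boolP (0 <= y <= T); last by rewrite hsupp// normr0 !mulr_ge0// tpow_ge0.
    move: yT => /andP[y1 y2].
    by rewrite !tpowE ?powRr0 ?mulr1//; lra.
rewrite ge0_integralZl//.
- rewrite integral_tpow_between -EFin_fine_Beta ?ltrN10// -!EFinM.
  exact: ltry.
- by solve_measurable2.
- by move=> x _; rewrite lee_fin mulr_ge0// tpow_ge0.
Qed.

(** At a Lebesgue point the averages over its cells converge. The point 0 is discarded: it lies in
    no cell, whereas [h 0] may be nonzero. *)
Lemma grid_step_cvg : {ae mu, forall y, grid_step n y @[n --> \oo] --> h y}.
Proof.
have loch : locally_integrable setT h.
  by apply: open_integrable_locally; [exact: openT|exact: integrable_bounded_supp].
have ae0 : {ae mu, forall y : R, y != 0}.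
  exists [set 0]; split => //; first exact: lebesgue_measure_set1.
  by move=> x /= /negP; rewrite negbK => /eqP.
have := lebesgue_differentiation loch; move: ae0; apply: filterS2; first exact: (ae_filter_ringOfSetsType mu).
move=> y y0 ly; have [yn|yp] := leP y 0.
  rewrite hsupp; last by rewrite negb_and -ltNge lt_neqAle y0 yn.
  by under eq_fun do rewrite grid_step_le0//; exact: cvg_cst.
have [yM|yM] := ltP M%:R y.
  rewrite hsupp; last by rewrite negb_and -!ltNge (lt_trans TM yM) orbT.
  by under eq_fun do rewrite grid_step_gtM//; exact: cvg_cst.
have := nice_lebesgue_differentiation nicely_shrinking_cell loch ly.
move=> /fine_cvgP[_]; apply: cvg_trans; apply: near_eq_cvg; apply: nearW => n /=.
rewrite grid_stepE//; have [/andP[k1 k2] ->] := kidxP n yp.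
rewrite ifT; last first.
  rewrite -(ltr_nat R) (lt_le_trans k1)// natrM ler_pM2r// ltr0n.
rewrite addrK measure_cell /cell_avg inver ?invr_eq0 ?pnatr_eq0//= invrK.
by rewrite fineM//; apply: integrable_fin_num => //; [exact: measurable_itv|apply: integrableS integrable_bounded_supp => //; exact: measurable_itv].
Qed.

End grid.

Section dominated.
Context d (T : measurableType d) {R : realType} (m : {measure set T -> \bar R}).

Lemma cvg_Rintegral_dominated (f_ : nat -> T -> R) (f F : T -> R) :
  (forall n, measurable_fun [set: T] (f_ n)) -> measurable_fun [set: T] f ->
  {ae m, forall x, f_ n x @[n --> \oo] --> f x} ->
  m.-integrable [set: T] (EFin \o F) -> (forall n x, `|f_ n x| <= F x) ->
  \int[m]_x f_ n x @[n --> \oo] --> \int[m]_x f x.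
Proof.
move=> mf_ mf fcvg intF fF.
have [] := @dominated_convergence _ _ _ m setT measurableT (fun n => EFin \o f_ n) (EFin \o f) (EFin \o F).
- by move=> n; exact/measurable_EFinP.
- exact/measurable_EFinP.
- move: fcvg; apply: filterS => x /= fx _.
  by apply: cvg_EFin; [exact: nearW|exact: fx].
- exact: intF.
- by apply: aeW => x n _; rewrite /= lee_fin.
move=> intf _ h; apply: fine_cvg; rewrite /Rintegral fineK; first exact: h.
exact: integrable_fin_num.
Qed.

End dominated.

Section frac_int_energy.
Context {R : realType}.
Local Notation mu := (@lebesgue_measure R).
Local Notation tpow := (@tpow R).
Local Notation frac_int := (@frac_int R).
Variable s : R.
Hypotheses (s0 : 0 < s) (sh : s < 2^-1).

Lemma cvg_frac_int (h_ : nat -> R -> R) (h F : R -> R) (x : R) :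
  (forall n, measurable_fun [set: R] (h_ n)) -> measurable_fun [set: R] h ->
  measurable_fun [set: R] F ->
  {ae mu, forall y, h_ n y @[n --> \oo] --> h y} -> (forall n y, `|h_ n y| <= F y) ->
  (\int[mu]_y (tpow (s - 1) (x - y) * F y)%:E < +oo)%E ->
  frac_int s (h_ n) x @[n --> \oo] --> frac_int s h x.
Proof.
move=> mh_ mh mF hcvg hF Ffin.
have F0 y : 0 <= F y by rewrite (le_trans _ (hF 0%N y)).
apply: (@cvg_Rintegral_dominated _ _ _ mu (fun n y => tpow (s - 1) (x - y) * h_ n y) _
   (fun y => tpow (s - 1) (x - y) * F y)).
- by move=> n; have mhn := mh_ n; solve_measurable2.
- by solve_measurable2.
- move: hcvg; apply: filterS => [|y hy]; first exact: (ae_filter_ringOfSetsType mu).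
  by apply: cvgMr; exact: hy.
- apply/integrable_fin_numP; first by solve_measurable2.
  rewrite ge0_fin_numE//; apply: integral_ge0 => y _; rewrite lee_fin mulr_ge0 ?tpow_ge0//.
- by move=> n y; rewrite normrM ger0_norm ?tpow_ge0// ler_wpM2l ?tpow_ge0.
Qed.

Section bounded.
Variables (h : R -> R) (T N : R).
Hypotheses (mh : measurable_fun [set: R] h) (N0 : 0 <= N)
  (hN : forall x, `|h x| <= N) (hsupp : forall x, ~~ (0 <= x <= T) -> h x = 0).

(** The grid averages satisfy the bound with equality. Dominated convergence gives the convergence
    of their potentials at every point and of their squared norms, and [gagliardo_fatou]
    concludes. *)
Lemma gagliardo_frac_int_bounded :
  (gagliardo s (frac_int s h) <= (step_cst s * \int[mu]_y (h y ^+ 2))%:E)%E.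
Proof.
pose M : R := (Num.truncn T).+1%:R.
have M0 : 0 < M by rewrite ltr0n.
(* The indicator of ]-1, M + 1[, an interval containing the supports of all the averages; as
   [w ^ 2 = w], it also dominates their squares. *)
pose w (y : R) := tpow 0 (y - (-1)) * tpow 0 (M + 1 - y).
have w0 y : 0 <= w y by rewrite mulr_ge0// tpow_ge0.
have mw : measurable_fun [set: R] w by rewrite /w; solve_measurable2.
have gw n y : `|grid_step h T n y| <= N * w y.
  have [y0|y0] := leP y 0.
    by rewrite grid_step_le0// normr0 mulr_ge0.
  have [yM|yM] := ltP M y.
    by rewrite grid_step_gtM// normr0 mulr_ge0.
  by rewrite /w !tpowE ?powRr0 ?mulr1; [exact: grid_step_bound|lra|lra].
have mg n : measurable_fun [set: R] (grid_step h T n).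
  rewrite /grid_step; apply: measurable_sum => j; solve_measurable2.
have wfin : (\int[mu]_y (w y)%:E < +oo)%E.
  by rewrite integral_tpow_between -EFin_fine_Beta ?ltrN10// -EFinM ltry.
have ww y : w y ^+ 2 = w y.
  by rewrite /w /tpow !powRr0; case: ifP; case: ifP; rewrite ?mulr0 ?mulr1 ?mul0r ?expr0n ?expr1n.
have intw (c : R) : mu.-integrable [set: R] (EFin \o (fun y => c * w y)).
  rewrite (_ : EFin \o _ = fun y => (c%:E * (w y)%:E)%E); last by apply/funext => y; rewrite -EFinM.
  apply: integrableZl => //; apply/integrable_fin_numP => //.
  by rewrite ge0_fin_numE//; apply: integral_ge0 => y _; rewrite lee_fin.
have intg n : (\int[mu]_y (grid_step h T n y ^+ 2)%:E = (\int[mu]_y (grid_step h T n y ^+ 2))%:E)%E.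
  rewrite /Rintegral fineK//; apply: integrable_fin_num => //.
  apply: (le_integrable _ _ _ (intw (N ^+ 2))) => //.
    by have mgn := mg n; solve_measurable2.
  move=> y _; rewrite /= lee_fin -ww -exprMn !ger0_norm ?sqr_ge0// -[leLHS]real_normK ?num_real// ler_sqr ?nnegrE ?(mulr_ge0 N0 (w0 _))//.
apply: (@gagliardo_fatou _ s (fun n => frac_int s (grid_step h T n)) _
  (fun n => step_cst s * \int[mu]_y (grid_step h T n y ^+ 2))).
- by move=> n; apply: measurable_frac_int.
- exact: measurable_frac_int.
- apply: aeW => x.
  apply: (@cvg_frac_int _ _ (fun y => N * w y)) => //.
  + by solve_measurable2.
  + exact: grid_step_cvg mh N0 hN hsupp.
  + apply: (@le_lt_trans _ _ (\int[mu]_y (N%:E * (tpow (s - 1) (x - y) * tpow 0 (y - (-1)))%:E))%E).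
      apply: ge0_le_integral => //.
      * by move=> y _; rewrite lee_fin !mulr_ge0// tpow_ge0.
      * by solve_measurable2.
      * by solve_measurable2.
      * move=> y _; rewrite -EFinM lee_fin mulrCA ler_wpM2l// ler_wpM2l ?tpow_ge0//.
        rewrite /w -[leRHS]mulr1 ler_wpM2l ?tpow_ge0//.
        by rewrite /tpow powRr0; case: ifP.
    rewrite ge0_integralZl//.
    * by rewrite frac_int_heaviside// -EFinM ltry.
    * by solve_measurable2.
    * by move=> y _; rewrite lee_fin mulr_ge0// tpow_ge0.
- move=> n; have [I [e [t [e0 gE]]]] := grid_step_sum h T n.
  by rewrite (gagliardo_frac_int_step s0 sh e0 gE) intg -EFinM.
- apply: cvgMr; apply: (@cvg_Rintegral_dominated _ _ _ mu (fun n y => grid_step h T n y ^+ 2) _ (fun y => N ^+ 2 * w y)).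
  + by move=> n; have mgn := mg n; solve_measurable2.
  + by solve_measurable2.
  + have := grid_step_cvg mh N0 hN hsupp; apply: filterS => [|y hy].
      exact: (ae_filter_ringOfSetsType mu).
    by apply: (@cvg_comp _ _ _ _ (fun x => x ^+ 2) _ (nbhs (h y))); [exact: hy|exact: exprn_continuous].
  + exact: intw.
  + move=> n y; rewrite -ww -exprMn normrX ler_sqr ?nnegrE ?(mulr_ge0 N0 (w0 _))//.
Qed.

End bounded.

Section square_integrable.
Variables (h : R -> R) (T : R).
Hypotheses (mh : measurable_fun [set: R] h)
  (h2 : (\int[mu]_y (h y ^+ 2)%:E < +oo)%E) (hsupp : forall x, ~~ (0 <= x <= T) -> h x = 0).

Lemma integral_normr_lty : (\int[mu]_y `|h y|%:E < +oo)%E.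
Proof.
apply: (@ge0_integral_dom2 _ _ (fun y => tpow 0 (y - (-1)) * tpow 0 (T + 1 - y))
   (fun y => h y ^+ 2) 1 1) => //.
- by solve_measurable2.
- by solve_measurable2.
- by solve_measurable2.
- by move=> y; rewrite mulr_ge0// tpow_ge0.
- by move=> y; exact: sqr_ge0.
- move=> y; rewrite !mul1r -[h y ^+ 2]real_normK ?num_real//.
  have [/andP[y0 yT]|yT] := boolP (0 <= y <= T).
    rewrite !tpowE ?powRr0 ?mulr1; [|lra|lra].
    have := normr_ge0 (h y); have := sqr_ge0 (`|h y| - 1); nra.
  by rewrite hsupp// normr0 expr0n/= addr0 mulr_ge0// tpow_ge0.
- by rewrite integral_tpow_between -EFin_fine_Beta ?ltrN10// -EFinM ltry.
Qed.

(** The potential of [|h|] is integrable over every half-line x < n: by Tonelli its integral there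
    is at most [B n ^ s] times the L^1 norm of [h]. Countably many null sets are discarded. *)
Lemma ae_frac_int_lty : {ae mu, forall x, (\int[mu]_y (tpow (s - 1) (x - y) * `|h y|)%:E < +oo)%E}.
Proof.
move: s0 => s0'.
have mn : measurable_fun [set: R] (fun y => `|h y|) by solve_measurable2.
have [B B0 BE'] : exists2 B, 0 <= B & (@Beta R (s - 1) 0 = B%:E)%E.
  exists (fine (@Beta R (s - 1) 0)); first by rewrite fine_ge0// ltW// Beta_gt0.
  by rewrite -EFin_fine_Beta//; lra.
have H (n : nat) : {ae mu, forall x, (\int[mu]_y (tpow 0 (n%:R - x) * (tpow (s - 1) (x - y) * `|h y|))%:E < +oo)%E}.
  apply: ae_integral_lty.
  - by solve_measurable2.
  - by move=> x; apply: integral_ge0 => y _; rewrite lee_fin !mulr_ge0// tpow_ge0.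
  rewrite (@ge0_fubini _ (fun x y => tpow 0 (n%:R - x) * (tpow (s - 1) (x - y) * `|h y|))); last 2 first.
  - by solve_measurable2.
  - by move=> x y; rewrite !mulr_ge0// tpow_ge0.
  apply: (@le_lt_trans _ _ (\int[mu]_y ((B * n%:R `^ s)%:E * (`|h y|)%:E))%E).
    apply: ge0_le_integral => //.
    - by move=> y _; apply: integral_ge0 => x _; rewrite lee_fin !mulr_ge0// tpow_ge0.
    - apply: (@measurable_integral2 _ (fun y x => tpow 0 (n%:R - x) * (tpow (s - 1) (x - y) * `|h y|))).
      by solve_measurable2.
    - by solve_measurable2.
    - move=> y _.
      rewrite (_ : (\int[mu]_x _)%E = \int[mu]_x ((`|h y|)%:E * (tpow (s - 1) (x - y) * tpow 0 (n%:R - x))%:E))%E; last first.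
        by apply: eq_integral => x _; rewrite -EFinM; congr EFin; ring.
      rewrite ge0_integralZl//; last 2 first.
      + by solve_measurable2.
      + by move=> x _; rewrite lee_fin mulr_ge0// tpow_ge0.
      rewrite integral_tpow_between BE' -!EFinM lee_fin addr0 subrK mulrC.
      have [/andP[y0 yT]|yT] := boolP (0 <= y <= T); last by rewrite hsupp// normr0 !mulr0.
      rewrite ler_wpM2r// ler_wpM2l//; have [ny|ny] := leP (n%:R - y) 0; first by rewrite tpow_le0// powR_ge0.
      by rewrite tpowE// ge0_ler_powR ?nnegrE//; lra.
  rewrite ge0_integralZl//; [|by solve_measurable2|by rewrite lee_fin mulr_ge0// powR_ge0].
  by rewrite lte_mul_pinfty ?lee_fin ?mulr_ge0 ?powR_ge0// integral_normr_lty.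
have := ae_foralln H; apply: filterS => x hx.
have := hx (Num.truncn x).+1; rewrite tpowE; last by rewrite subr_gt0; exact: Num.Theory.truncnS_gt.
by rewrite powRr0; under eq_integral do rewrite mul1r.
Qed.

(** The truncation [h_ n] keeps [h] where [|h| < n] and is 0 elsewhere. The potentials of the
    truncations converge wherever that of [|h|] is finite, hence almost everywhere. *)
Lemma gagliardo_frac_int :
  (gagliardo s (frac_int s h) <= (step_cst s * \int[mu]_y (h y ^+ 2))%:E)%E.
Proof.
pose h_ (n : nat) y := h y * tpow 0 (n%:R - `|h y|).
have hh n y : `|h_ n y| <= `|h y|.
  rewrite /h_ normrM -[leRHS]mulr1 ler_wpM2l//.
  by rewrite /tpow powRr0; case: ifP => _; rewrite ?normr1 ?normr0.
have mh_ n : measurable_fun [set: R] (h_ n) by rewrite /h_; solve_measurable2.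
have int2 n : (\int[mu]_y (h_ n y ^+ 2)%:E <= \int[mu]_y (h y ^+ 2)%:E)%E.
  apply: ge0_le_integral => //.
  - by move=> y _; rewrite lee_fin sqr_ge0.
  - by have mhn := mh_ n; solve_measurable2.
  - by solve_measurable2.
  - move=> y _; rewrite lee_fin -[leLHS]real_normK ?num_real// -[leRHS]real_normK ?num_real//.
    by rewrite ler_sqr ?nnegrE.
apply: (@gagliardo_fatou _ s (fun n => frac_int s (h_ n)) _
  (fun=> step_cst s * \int[mu]_y (h y ^+ 2))).
- by move=> n; apply: measurable_frac_int.
- exact: measurable_frac_int.
- have := ae_frac_int_lty; apply: filterS => [|x hx]; first exact: (ae_filter_ringOfSetsType mu).
  apply: (@cvg_frac_int _ _ (fun y => `|h y|)) => //.
  + by solve_measurable2.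
  + apply: aeW => y; apply/cvgrPdist_lt => e e0.
    exists (Num.truncn `|h y|).+1 => //= n /= ny; rewrite /h_ tpowE; last first.
      by rewrite subr_gt0 (lt_le_trans (Num.Theory.truncnS_gt _))// ler_nat.
    by rewrite powRr0 mulr1 subrr normr0.
- move=> n; apply: (@le_trans _ _ (step_cst s * \int[mu]_y (h_ n y ^+ 2))%:E).
    apply: (@gagliardo_frac_int_bounded _ T n%:R) => //.
    + move=> x; rewrite /h_ normrM [`|tpow _ _|]ger0_norm ?tpow_ge0//.
      have [hx|hx] := leP (n%:R - `|h x|) 0; first by rewrite tpow_le0// mulr0.
      by rewrite tpowE// powRr0 mulr1; lra.
    + by move=> x xT; rewrite /h_ hsupp// mul0r.
  rewrite lee_fin ler_wpM2l ?step_cst_ge0// /Rintegral fine_le//.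
  + rewrite ge0_fin_numE; first exact: le_lt_trans h2.
    by apply: integral_ge0 => y _; rewrite lee_fin sqr_ge0.
  + rewrite ge0_fin_numE//.
    by apply: integral_ge0 => y _; rewrite lee_fin sqr_ge0.
- exact: cvg_cst.
Qed.

End square_integrable.
End frac_int_energy.

Ltac solve_ge0 := cbv beta; repeat first
  [ exact: sqr_ge0 | exact: tpow_ge0 | exact: powR_ge0 | exact: normr_ge0
  | assumption | apply: mulr_ge0 | apply: addr_ge0 ].

(** * Cutting off at the right end point *)

Section cut_off.
Context {R : realType}.
Local Notation mu := (@lebesgue_measure R).
Local Notation tpow := (@tpow R).
Variables (s T : R) (v : R -> R).
Hypotheses (s0 : 0 < s) (mv : measurable_fun [set: R] v).

Let u x := v x * tpow 0 (T - x).
(** The contribution of the pairs [x < T <= y], for which the increment of [u] is [v x] itself. *)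
Let A x y := tpow 0 (T - x) * (1 - tpow 0 (T - y)) * tpow (- (1 + 2 * s)) (y - x) * v x ^+ 2.

Let mA : measurable_fun [set: R * R] (fun z => A z.1 z.2).
Proof. by rewrite /A; solve_measurable2. Qed.

Let tpow0_le1 (x : R) : 0 <= 1 - tpow 0 x.
Proof. by rewrite subr_ge0 /tpow powRr0; case: ifP. Qed.

Let A0 x y : 0 <= A x y.
Proof.
by rewrite /A; apply: mulr_ge0; [rewrite !mulr_ge0 ?tpow_ge0|exact: sqr_ge0].
Qed.

Let gker_cut x y : gker s u x y <= gker s v x y + (A x y + A y x).
Proof.
have g0 : 0 <= gker s v x y by exact: gker_ge0.
have Axy := A0 x y; have Ayx := A0 y x.
have [xT|Tx] := ltP x T; have [yT|Ty] := ltP y T.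
- have -> : gker s u x y = gker s v x y.
    by rewrite /gker /u !tpowE ?subr_gt0// !powRr0 !mulr1.
  by rewrite lerDl addr_ge0.
- have -> : gker s u x y = A x y.
    have yx : 0 < y - x by rewrite subr_gt0 (lt_le_trans xT).
    rewrite /gker /u /A [tpow 0 (T - y)]tpow_le0 ?subr_le0// mulr0 subr0 subr0.
    rewrite !tpowE ?subr_gt0 ?(lt_le_trans xT)//.
    by rewrite !powRr0 !mul1r mulr1 distrC gtr0_norm// mulrC.
  by rewrite addrCA lerDl addr_ge0.
- have -> : gker s u x y = A y x.
    have yx : 0 < x - y by rewrite subr_gt0 (lt_le_trans yT).
    rewrite /gker /u /A [tpow 0 (T - x)]tpow_le0 ?subr_le0// mulr0 sub0r subr0.
    rewrite !tpowE ?subr_gt0 ?(lt_le_trans yT)//.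
    by rewrite !powRr0 !mul1r mulr1 gtr0_norm// mulrC sqrrN.
  by rewrite addrA lerDr addr_ge0.
- have -> : gker s u x y = 0.
    by rewrite /gker /u ![tpow 0 _]tpow_le0 ?subr_le0// !mulr0 subrr expr0n/= mul0r.
  by rewrite !addr_ge0.
Qed.

Let integral_A : (\int[mu]_x \int[mu]_y (A x y)%:E <=
  (fine (@Beta' R 0 (- (1 + 2 * s))))%:E * \int[mu]_x (v x ^+ 2 * tpow (- (2 * s)) (T - x))%:E)%E.
Proof.
move: s0 => s0'.
set B := fine _; have B0 : 0 <= B by rewrite fine_ge0 ?Beta'_ge0.
rewrite -ge0_integralZl//; last 2 first.
- by solve_measurable2.
- by move=> x _; rewrite lee_fin; solve_ge0.
apply: ge0_le_integral => //.
- by move=> x _; apply: integral_ge0 => y _; rewrite lee_fin; exact: A0.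
- exact: measurable_integral2.
- by solve_measurable2.
- move=> x _; have [Tx|xT] := leP T x.
    rewrite integral0_eq.
      by rewrite -EFinM lee_fin; solve_ge0.
    by move=> y _; rewrite /A tpow_le0 ?subr_le0// !mul0r.
  (* At [y = T] the factor [1 - tpow 0 (T - y)] is 1 but [tpow 0 (y - T)] is 0; this point is
     discarded. *)
  rewrite (@eq_integral_but1 _ T _ (fun y => (v x ^+ 2)%:E *
     (tpow 0 (y - T) * tpow (- (1 + 2 * s)) (y - x))%:E)%E); last 3 first.
  + by apply/measurable_EFinP; exact: (measurable_fun_pair2 _ mA).
  + by solve_measurable2.
  + move=> y yT; rewrite -EFinM /A; congr EFin; rewrite tpowE ?subr_gt0// powRr0 mul1r mulrC.
    congr (_ * (_ * _)); rewrite /tpow !powRr0 !subr_gt0.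
    by case: (ltgtP y T) yT => // _ _; rewrite ?subrr ?subr0.
  rewrite ge0_integralZl//; last 3 first.
  + by solve_measurable2.
  + by move=> y _; rewrite lee_fin; solve_ge0.
  + by rewrite lee_fin; solve_ge0.
  (* Changing [y] into [- y] moves the integration below both points, as [integral_tpow_above]
     requires. *)
  rewrite -(@ge0_integral_reflect _ 0); last 2 first.
  + by solve_measurable2.
  + by move=> y; rewrite lee_fin; solve_ge0.
  rewrite (_ : (\int[mu]_y _)%E = \int[mu]_y (tpow 0 (- T - y) * tpow (- (1 + 2 * s)) (- x - y))%:E)%E; last first.
    by apply: eq_integral => y _; congr (tpow _ _ * tpow _ _)%:E; ring.
  rewrite integral_tpow_above ?ltrN2// -EFin_fine_Beta' -?EFinM; [|by rewrite ltrN10|by lra].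
  rewrite lee_fin mulrCA (_ : - x - - T = T - x); last by ring.
  by rewrite (_ : 0 + - (1 + 2 * s) + 1 = - (2 * s))//; ring.
Qed.

Lemma gagliardo_cut : (gagliardo s (fun x => (v x * tpow 0 (T - x))%R) <=
  gagliardo s v + 2%:E * ((fine (@Beta' R 0 (- (1 + 2 * s))))%:E *
    \int[mu]_x (v x ^+ 2 * tpow (- (2 * s)) (T - x))%:E))%E.
Proof.
have mu_ : measurable_fun [set: R] u by rewrite /u; solve_measurable2.
have mA' := measurable_fun_swap mA.
rewrite !gagliardoE.
apply: le_trans.
  apply: (@ge0_integral2_dom2 _ _ (gker s v) (fun x y => A x y + A y x)).
  - exact: measurable_gker.
  - exact: measurable_gker.
  - exact: (measurable_funD mA mA').
  - by move=> x y; exact: gker_ge0.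
  - by move=> x y; exact: gker_ge0.
  - by move=> x y; apply: addr_ge0; exact: A0.
  - exact: gker_cut.
apply: leeD; first by [].
apply: le_trans.
  apply: (@ge0_integral2_dom2 _ _ A (fun x y => A y x)).
  - exact: (measurable_funD mA mA').
  - exact: mA.
  - exact: mA'.
  - by move=> x y; apply: addr_ge0; exact: A0.
  - exact: A0.
  - by move=> x y; exact: A0.
  - by [].
rewrite (@ge0_fubini _ (fun x y => A y x)); [|exact: mA'|by move=> x y; exact: A0].
rewrite mule_natl mule2n; apply: leeD; exact: integral_A.
Qed.

End cut_off.

(** * A Hardy inequality at the right end point *)

Section hardy.
Context {R : realType}.
Local Notation mu := (@lebesgue_measure R).
Local Notation tpow := (@tpow R).
Local Notation frac_int := (@frac_int R).
Variable s : R.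
Hypotheses (s0 : 0 < s) (sh : s < 2^-1).
Variables (h : R -> R) (T : R).
Hypothesis mh : measurable_fun [set: R] h.

(** The added 1 provides a positive constant, since the next proof divides by a multiple of it. *)
Let B' : R := fine (@Beta' R (s - 1) (- 2^-1)) + 1.

Let B'_gt0 : 0 < B'.
Proof. by rewrite ltr_wpDl// fine_ge0// Beta'_ge0. Qed.

(* Cauchy-Schwarz with the weight [(T - y) ^ (1 / 2)] *)
Let sqr_frac_int_le x : x < T ->
  ((frac_int s h x ^+ 2)%:E <= (B' * tpow (s - 2^-1) (T - x))%:E *
   \int[mu]_y (tpow (s - 1) (x - y) * (tpow (2^-1) (T - y) * h y ^+ 2))%:E)%E.
Proof.
move: s0 sh => s0' sh' xT.
set X := B' * _; set Y := integral _ _ _.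
have Y0 : (0 <= Y)%E by apply: integral_ge0 => y _; rewrite lee_fin; solve_ge0.
have X0 : 0 < X by rewrite mulr_gt0// tpow_gt0// subr_gt0.
have XE : (\int[mu]_y (tpow (s - 1) (x - y) * tpow (- 2^-1) (T - y))%:E <= X%:E)%E.
  rewrite integral_tpow_above// -EFin_fine_Beta' -?EFinM; [|lra|lra].
  rewrite (_ : s - 1 + - 2^-1 + 1 = s - 2^-1); last by field.
  by rewrite lee_fin ler_wpM2r ?tpow_ge0// lerDl.
set v := frac_int s h x.
have [->|v0] := eqVneq v 0; first by rewrite expr0n/= mule_ge0// lee_fin ltW.
have nv0 : 0 < `|v| by rewrite normr_gt0.
have mn : measurable_fun [set: R] (fun y => tpow (s - 1) (x - y) * h y) by solve_measurable2.
have vle : (`|v|%:E <= \int[mu]_y `|tpow (s - 1) (x - y) * h y|%:E)%E.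
  exact: (@le_normr_Rintegral_ge0 _ _ _ mu _ mn).
(* Cauchy-Schwarz through AM-GM: the multiplier [|v| / X] gives [|v| <= |v| / 2 + X Y / (2 |v|)],
   that is [v ^ 2 <= X Y]. *)
have L0 : 0 < `|v| / X by rewrite divr_gt0.
have key : (\int[mu]_y `|tpow (s - 1) (x - y) * h y|%:E <=
    (`|v| / X / 2)%:E * X%:E + ((2 * (`|v| / X))^-1)%:E * Y)%E.
  apply: (@le_trans _ _ ((`|v| / X / 2)%:E * \int[mu]_y (tpow (s - 1) (x - y) * tpow (- 2^-1) (T - y))%:E
     + ((2 * (`|v| / X))^-1)%:E * Y)%E); last first.
    by rewrite leeD2r// lee_wpmul2l// lee_fin ltW// divr_gt0.
  rewrite -!ge0_integralZl//; last 6 first.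
  - by solve_measurable2.
  - by move=> y _; rewrite lee_fin; solve_ge0.
  - by rewrite lee_fin invr_ge0 mulr_ge0// ltW.
  - by solve_measurable2.
  - by move=> y _; rewrite lee_fin; solve_ge0.
  - by rewrite lee_fin ltW// divr_gt0.
  rewrite -ge0_integralD//; last 4 first.
  - by move=> y _; rewrite -EFinM lee_fin mulr_ge0 ?divr_ge0//; [exact: ltW|solve_ge0].
  - by solve_measurable2.
  - by move=> y _; rewrite -EFinM lee_fin; apply: mulr_ge0; [by rewrite invr_ge0 mulr_ge0// ltW|solve_ge0].
  - by solve_measurable2.
  apply: ge0_le_integral => //.
  - by solve_measurable2.
  - by solve_measurable2.
  - move=> y _; rewrite -!EFinM -EFinD lee_fin normrM ger0_norm ?tpow_ge0//.
    have [yx|yx] := leP x y; first by rewrite tpow_le0 ?subr_le0// !mul0r !mulr0 addr0.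
    have Ty : 0 < T - y by rewrite subr_gt0 (lt_trans yx).
    have := @amgm_weighted R _ (tpow (- 4^-1) (T - y)) (tpow 4^-1 (T - y) * `|h y|) L0.
    rewrite mulrA -tpowD addNr tpowE// powRr0 mul1r => H.
    have k0 : 0 <= tpow (s - 1) (x - y) by exact: tpow_ge0.
    apply: (le_trans (ler_wpM2l k0 H)).
    rewrite mulrDr exprMn real_normK ?num_real// !expr2 -!tpowD.
    rewrite (_ : - 4^-1 + - 4^-1 = - 2^-1 :> R); last by field.
    rewrite (_ : 4^-1 + 4^-1 = 2^-1 :> R); last by field.
    by rewrite le_eqVlt; apply/orP; left; apply/eqP; ring.
move: vle => /le_trans/(_ key).
case: Y Y0 {key} => [Y| |]// Y0; last by move=> _; rewrite gt0_muley ?lte_fin// leey.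
rewrite -!EFinM -EFinD !lee_fin -[v ^+ 2]real_normK ?num_real// => H.
have := ler_wpM2l (ltW nv0) H.
have -> : `|v| * (`|v| / X / 2 * X + (2 * (`|v| / X))^-1 * Y) = `|v| ^+ 2 / 2 + X * Y / 2.
  by field; rewrite !gt_eqF.
by rewrite -expr2; lra.
Qed.

Definition hardy_cst : R := B' * fine (@Beta R (s - 1) (- s - 2^-1)).

Lemma hardy_cst_ge0 : 0 <= hardy_cst.
Proof. by rewrite mulr_ge0 ?(ltW B'_gt0)// fine_ge0// ltW// Beta_gt0. Qed.

(* Schur's test: the weights of the previous bound are integrated out in [x]. *)
Lemma hardy : (\int[mu]_x (frac_int s h x ^+ 2 * tpow (- (2 * s)) (T - x))%:E <=
  hardy_cst%:E * \int[mu]_y (h y ^+ 2)%:E)%E.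
Proof.
move: s0 sh => s0' sh'.
have mv : measurable_fun [set: R] (frac_int s h) by exact: measurable_frac_int.
have B'0 := ltW B'_gt0.
(* The exponent is [(s - 1/2) - 2 s]: the weight left by Cauchy-Schwarz times that of the
   inequality. It exceeds -1 because [s < 1/2]. *)
pose f x y := tpow (- s - 2^-1) (T - x) * (tpow (s - 1) (x - y) * (tpow (2^-1) (T - y) * h y ^+ 2)).
have f0 x y : 0 <= f x y by rewrite /f; solve_ge0.
have mf : measurable_fun [set: R * R] (fun z => f z.1 z.2) by rewrite /f; solve_measurable2.
apply: (@le_trans _ _ (\int[mu]_x (B'%:E * \int[mu]_y (f x y)%:E))%E).
  apply: ge0_le_integral => //.
  - by move=> x _; rewrite lee_fin; solve_ge0.
  - by solve_measurable2.
  - by apply: emeasurable_funM => //; exact: measurable_integral2.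
  - move=> x _; have [Tx|xT] := leP T x.
      rewrite tpow_le0 ?subr_le0// mulr0 mule_ge0// integral_ge0// => y _.
      by rewrite lee_fin.
    rewrite EFinM; apply: (@le_trans _ _ ((B' * tpow (s - 2^-1) (T - x))%:E *
       \int[mu]_y (tpow (s - 1) (x - y) * (tpow (2^-1) (T - y) * h y ^+ 2))%:E * (tpow (- (2 * s)) (T - x))%:E)%E).
      by rewrite lee_wpmul2r ?lee_fin ?tpow_ge0// sqr_frac_int_le.
    rewrite /f; under [in leRHS]eq_integral do rewrite EFinM.
    rewrite ge0_integralZl//; last 3 first.
    - by solve_measurable2.
    - by move=> y _; rewrite lee_fin; solve_ge0.
    - by rewrite lee_fin tpow_ge0.
    rewrite muleAC -EFinM -mulrA -tpowD [in leRHS]muleA -EFinM.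
    by rewrite (_ : s - 2^-1 + - (2 * s) = - s - 2^-1)//; ring.
rewrite ge0_integralZl//; last 2 first.
- exact: measurable_integral2.
- by move=> x _; apply: integral_ge0 => y _; rewrite lee_fin.
rewrite /hardy_cst EFinM -muleA lee_wpmul2l ?lee_fin//.
have B0 : 0 <= fine (@Beta R (s - 1) (- s - 2^-1)) by rewrite fine_ge0// ltW// Beta_gt0.
rewrite ge0_fubini// -ge0_integralZl//; last 2 first.
- by solve_measurable2.
- by move=> y _; rewrite lee_fin sqr_ge0.
have mf' := measurable_fun_swap mf.
apply: ge0_le_integral => //.
- by move=> y _; apply: integral_ge0 => x _; rewrite lee_fin.
- exact: (@measurable_integral2 _ (fun y x => f x y)).
- by solve_measurable2.
- move=> y _.
  rewrite (_ : (\int[mu]_x _)%E = \int[mu]_x ((tpow (2^-1) (T - y) * h y ^+ 2)%:E *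
      (tpow (s - 1) (x - y) * tpow (- s - 2^-1) (T - x))%:E))%E; last first.
    by apply: eq_integral => x _; rewrite -EFinM /f; congr EFin; ring.
  rewrite ge0_integralZl//; last 3 first.
  - by solve_measurable2.
  - by move=> x _; rewrite lee_fin; solve_ge0.
  - by rewrite lee_fin; solve_ge0.
  rewrite integral_tpow_between -EFin_fine_Beta -?EFinM; [|lra|lra].
  rewrite lee_fin mulrC -!mulrA ler_wpM2l//.
  (* The powers of [T - y] cancel, so the unweighted L^2 norm of [h] remains. *)
  rewrite mulrA -tpowD -[leRHS]mul1r ler_wpM2r ?sqr_ge0//.
  rewrite (_ : s - 1 + (- s - 2^-1) + 1 + 2^-1 = 0); last by field.
  by rewrite /tpow powRr0; case: ifP.
Qed.

Definition energy_cst : R := step_cst s + 2 * (fine (@Beta' R 0 (- (1 + 2 * s))) * hardy_cst).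

Let B2 : 0 <= fine (@Beta' R 0 (- (1 + 2 * s))).
Proof. by rewrite fine_ge0// Beta'_ge0. Qed.

Lemma energy_cst_ge0 : 0 <= energy_cst.
Proof.
have h0 := hardy_cst_ge0; have b2 := B2.
by rewrite /energy_cst; apply: addr_ge0; [exact: step_cst_ge0|solve_ge0].
Qed.

Hypotheses (h2 : (\int[mu]_y (h y ^+ 2)%:E < +oo)%E)
  (hsupp : forall x, ~~ (0 <= x <= T) -> h x = 0).

Lemma gagliardo_frac_int_cut :
  (gagliardo s (fun x => (frac_int s h x * tpow 0 (T - x))%R) <= energy_cst%:E * \int[mu]_y (h y ^+ 2)%:E)%E.
Proof.
have h0 := hardy_cst_ge0; have b2 := B2.
apply: (le_trans (gagliardo_cut T s0 (measurable_frac_int s mh))).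
rewrite /energy_cst (EFinD (step_cst s)) ge0_muleDl; [|by rewrite lee_fin; exact: step_cst_ge0|by rewrite lee_fin; solve_ge0].
apply: leeD.
  apply: (le_trans (gagliardo_frac_int s0 sh mh h2 hsupp)).
  rewrite EFinM /Rintegral fineK; first by [].
  rewrite ge0_fin_numE; first exact: h2.
  by apply: integral_ge0 => y _; rewrite lee_fin sqr_ge0.
rewrite (EFinM 2) EFinM -!muleA; apply: lee_wpmul2l; first by [].
by apply: lee_wpmul2l; [by rewrite lee_fin|exact: hardy].
Qed.

End hardy.

(** * Inversion of the fractional derivative *)

Section gamma.
Context {R : realType}.
Local Notation mu := (@lebesgue_measure R).
Local Notation tpow := (@tpow R).

Lemma Rintegral_gt0 (f : R -> R) (D : set R) : measurable D -> (0 < mu D)%E ->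
  measurable_fun [set: R] f -> (forall x, 0 <= f x) -> (forall x, D x -> 0 < f x) ->
  (\int[mu]_x (f x)%:E < +oo)%E -> 0 < \int[mu]_x f x.
Proof.
move=> mD D0 mf f0 fD fin; rewrite /Rintegral fine_gt0// fin andbT lt0e.
rewrite integral_ge0 ?andbT => [|x _]; last by rewrite lee_fin.
apply/eqP => I0.
have : (\int[mu]_z `|(f z)%:E| = 0)%E.
  by rewrite -[RHS]I0; apply: eq_integral => x _; rewrite gee0_abs// lee_fin.
move/ae_eq_integral_abs => -[]//; first exact/measurable_EFinP.
move=> N [mN N0 sN].
have : (mu D <= mu N)%E.
  apply: le_measure; rewrite ?inE// => x Dx; apply: sN => /= h.
  have {h} := h I; apply/eqP.
  by rewrite eqe gt_eqF// fD.
by rewrite N0 leNgt D0.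
Qed.

(** Positivity of the real-valued integral includes its convergence, obtained from [x ^ (nu - 1)] on
    ]0, 1] and from the exponential density beyond 1. *)
Lemma Gamma_gt0 (nu : R) : 0 < nu < 1 -> 0 < Gamma nu.
Proof.
move=> /andP[nu0 nu1].
pose f x := tpow (nu - 1) x * expR (- x).
have f0 x : 0 <= f x by rewrite mulr_ge0 ?tpow_ge0// expR_ge0.
have mf : measurable_fun [set: R] f.
  apply: measurable_funM; first by solve_measurable2.
  by apply: measurableT_comp => //; exact: measurable_funN.
have -> : Gamma nu = \int[mu]_x f x.
  rewrite /Gamma Rintegral_mkcond; apply: eq_Rintegral => x _.
  rewrite patchE /f /tpow; case: ifPn; rewrite ?inE ?notin_setE/= in_itv/= andbT.
    by move=> ->.
  by move=> /negP/negbTE ->; rewrite mul0r.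
apply: (@Rintegral_gt0 _ `]0, 1[%classic) => //.
- by rewrite lebesgue_measure_itv/= lte01 oppr0 adde0 lte01.
- move=> x /=; rewrite in_itv/= => /andP[x0 _].
  by rewrite mulr_gt0 ?tpow_gt0// expR_gt0.
have Ia := integral_restrict_lty (measurable_itv _) (@integral_tpow01_lty R (nu - 1) ltac:(lra)).
apply: (ge0_integral_dom2 _ _ _ _ _ _ _ _ _ Ia (c1 := 1) (c2 := 1) (g2 := exponential_pdf 1)) => //.
- exact: measurable_restrict_tpow.
- exact: measurable_exponential_pdf.
- exact: restrict_tpow_ge0.
- by move=> x; exact: exponential_pdf_ge0.
- move=> x; rewrite !mul1r /f patchE; have [x0|x0] := leP x 0.
    rewrite [X in X * _]tpow_le0// mul0r addr_ge0 ?exponential_pdf_ge0//.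
    by case: ifP => // _; exact: tpow_ge0.
  have -> : exponential_pdf 1 x = expR (- x).
    rewrite /exponential_pdf patchE mem_set/= ?in_itv/= ?(ltW x0)//.
    by rewrite mul1r mulN1r.
  have e1 : expR (- x) <= 1 by rewrite -[leRHS]expR0 ler_expR oppr_le0 ltW.
  case: ifPn; rewrite ?inE ?notin_setE/= in_itv/= x0/= => x1.
    apply: ler_wpDr; first exact: expR_ge0.
    by rewrite -[leRHS]mulr1 ler_wpM2l// tpow_ge0.
  rewrite add0r -[leRHS]mul1r ler_wpM2r ?expR_ge0// tpowE//.
  have {}x1 : 1 < x by rewrite ltNge; exact/negP.
  rewrite -[leRHS](powRr0 x) ler_powR//; [exact: ltW|lra].
- by rewrite integral_exponential_pdf// ltry.
Qed.

End gamma.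

(** * Composition of fractional integrals *)

Section fractional_integrals.
Context {R : realType}.
Local Notation mu := (@lebesgue_measure R).
Local Notation tpow := (@tpow R).
Local Notation frac_int := (@frac_int R).

Lemma BetaC (a b : R) : Beta a b = Beta b a.
Proof.
rewrite /Beta -(@ge0_integral_reflect _ 1); last 2 first.
- by solve_measurable2.
- by move=> x; rewrite lee_fin; solve_ge0.
by apply: eq_integral => x _; rewrite subKr mulrC.
Qed.

(** At [xi = t] the two kernels agree because [nu != 1]: a nonzero power of 0 is 0, like the
    truncated one. *)
Lemma RL_integral_frac_int (nu T t : R) (g : R -> R) : nu != 1 -> 0 <= t <= T ->
  RL_integral nu g t = (Gamma nu)^-1 * frac_int nu (g \_ `[0, T]) t.
Proof.
move=> nu1 /andP[t0 tT]; rewrite /RL_integral /frac_int; congr (_ * _).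
rewrite Rintegral_mkcond; apply: eq_Rintegral => x _; rewrite !patchE.
case: ifPn; rewrite ?inE ?notin_setE/= in_itv/=.
  move=> /andP[x0 xt]; rewrite mem_set/= ?in_itv/= ?x0 ?(le_trans xt)//.
  congr (_ * _); move: xt; rewrite le_eqVlt => /predU1P[->|xt]; last by rewrite tpowE// subr_gt0.
  by rewrite subrr tpow_le0// powR0// subr_eq0.
move=> /negP; rewrite negb_and -!ltNge => /orP[x0|tx].
  by rewrite memNset ?mulr0//= in_itv/= leNgt x0.
by rewrite tpow_le0 ?mul0r// subr_le0 ltW.
Qed.

Lemma eq_frac_int_ae nu (f g : R -> R) t : measurable_fun [set: R] f -> measurable_fun [set: R] g ->
  {ae mu, forall x, x < t -> f x = g x} -> frac_int nu f t = frac_int nu g t.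
Proof.
move=> mf mg fg; rewrite /frac_int /Rintegral; congr fine.
apply: ae_eq_integral => //; [by solve_measurable2|by solve_measurable2|].
move: fg; apply: filterS => [|x fg _]; first exact: (ae_filter_ringOfSetsType mu).
have [tx|xt] := leP t x; first by rewrite tpow_le0 ?subr_le0// !mul0r.
by rewrite fg.
Qed.

Lemma frac_intZ nu k (f : R -> R) t : measurable_fun [set: R] f ->
  frac_int nu (fun x => k * f x) t = k * frac_int nu f t.
Proof.
move=> mf; rewrite /frac_int -RintegralZ; last by solve_measurable2.
by apply: eq_Rintegral => x _; ring.
Qed.

Lemma ae_exists_itv (P : R -> Prop) a b : {ae mu, forall x, P x} -> a < b ->
  exists x, a < x < b /\ P x.
Proof.
move=> [N [mN N0 sN]] ab; apply: contrapT => h.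
have : (mu `]a, b[ <= mu N)%E.
  apply: le_measure; rewrite ?inE// => x /=; rewrite in_itv/= => axb.
  by apply: sN => /= Px; apply: h; exists x.
by rewrite N0 lebesgue_measure_itv/= lte_fin ab -EFinB lee_fin leNgt subr_gt0 ab.
Qed.

Lemma at_right0_ltP (P : R -> Prop) : (\forall t \near 0^'+, P t) ->
  exists2 d : R, 0 < d & forall t, 0 < t < d -> P t.
Proof.
move=> [d /= d0 hd]; exists d => // t /andP[t0 td]; apply: hd => //=.
by rewrite sub0r normrN gtr0_norm.
Qed.

Section integrable_half_line.
Variable f : R -> R.
Hypotheses (mf : measurable_fun [set: R] f) (intf : (\int[mu]_y `|f y|%:E < +oo)%E)
  (f0 : forall y, y < 0 -> f y = 0).

Lemma tpow_integral_lty (a t : R) : 0 <= a -> (\int[mu]_y `|tpow a (t - y) * f y|%:E < +oo)%E.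
Proof.
move=> a0; apply: (@le_lt_trans _ _ (\int[mu]_y ((`|t| `^ a)%:E * `|f y|%:E))%E).
  apply: ge0_le_integral => //.
  - by solve_measurable2.
  - by solve_measurable2.
  - move=> y _; rewrite -EFinM lee_fin normrM ger0_norm ?tpow_ge0//.
    have [y0|y0] := ltP y 0; first by rewrite f0// normr0 !mulr0.
    rewrite ler_wpM2r//; have [ty|yt] := leP (t - y) 0; first by rewrite tpow_le0// powR_ge0.
    rewrite tpowE// ge0_ler_powR ?nnegrE//; first exact: ltW.
    by rewrite (le_trans _ (ler_norm t))// lerBlDr lerDl.
rewrite ge0_integralZl//; last by solve_measurable2.
by rewrite lte_mul_pinfty// lee_fin powR_ge0.
Qed.

(** The semigroup law by Fubini and a beta integral. With [1 <= p + q] the composed kernel is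
    bounded on the relevant range, so convergence is absolute at every [t] and not merely at almost
    every one. *)
Lemma frac_int_comp p q t : 0 < p -> 0 < q -> 1 <= p + q ->
  frac_int q (frac_int p f) t = fine (Beta (p - 1) (q - 1)) * frac_int (p + q) f t.
Proof.
move=> p0 q0 pq.
have BE : (fine (@Beta R (p - 1) (q - 1)))%:E = Beta (p - 1) (q - 1).
  by rewrite EFin_fine_Beta//; lra.
set B := fine _ in BE *.
have B0 : 0 <= B by rewrite fine_ge0// ltW// Beta_gt0.
have eE : p - 1 + (q - 1) + 1 = p + q - 1 by ring.
have kE y : (\int[mu]_x (tpow (p - 1) (x - y) * tpow (q - 1) (t - x))%:E = (B * tpow (p + q - 1) (t - y))%:E)%E.
  by rewrite integral_tpow_between -BE eE EFinM.
change (\int[mu]_x (tpow (q - 1) (t - x) * \int[mu]_y (tpow (p - 1) (x - y) * f y)) =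
  B * \int[mu]_y (tpow (p + q - 1) (t - y) * f y)).
rewrite -RintegralZ; last by solve_measurable2.
rewrite /Rintegral; congr fine.
rewrite (@fubini_weighted _ _ _ _ _ mu mu (fun x => tpow (q - 1) (t - x)) (fun x y => tpow (p - 1) (x - y)) f); last 4 first.
- by solve_measurable2.
- by solve_measurable2.
- exact: mf.
- rewrite (_ : (\int[mu]_y _)%E = \int[mu]_y (B%:E * `|tpow (p + q - 1) (t - y) * f y|%:E))%E.
    rewrite ge0_integralZl//; last by solve_measurable2.
    rewrite lte_mul_pinfty//; apply: tpow_integral_lty; lra.
  apply: eq_integral => y _.
  rewrite (_ : (\int[mu]_x _)%E = \int[mu]_x (`|f y|%:E * (tpow (p - 1) (x - y) * tpow (q - 1) (t - x))%:E))%E; last first.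
    apply: eq_integral => x _; rewrite -EFinM !normrM !(ger0_norm (tpow_ge0 _ _)).
    by congr EFin; ring.
  rewrite ge0_integralZl//; last 2 first.
  + by solve_measurable2.
  + by move=> x _; rewrite lee_fin; solve_ge0.
  by rewrite kE -!EFinM normrM (ger0_norm (tpow_ge0 _ _)); congr EFin; ring.
apply: eq_integral => y _.
rewrite (_ : (\int[mu]_x _)%E = \int[mu]_x ((f y)%:E * (tpow (p - 1) (x - y) * tpow (q - 1) (t - x))%:E))%E; last first.
  by apply: eq_integral => x _; rewrite -EFinM; congr EFin; ring.
rewrite integralZl//; last first.
  apply/integrable_fin_numP; first by solve_measurable2.
  by rewrite kE.
by rewrite kE -EFinM; congr EFin; ring.
Qed.

(** [frac_int 1 f] is the primitive of [f] that starts at 0. *)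
Lemma frac_int1_cvg0 : frac_int 1 f t @[t --> 0^'+] --> 0.
Proof.
apply/cvg_at_rightP => u [u0 uc].
have -> : 0 = \int[mu]_y (cst 0 y) :> R by rewrite /Rintegral integral0.
apply: (@cvg_Rintegral_dominated _ _ _ mu (fun n y => tpow (1 - 1) (u n - y) * f y) _ (fun y => `|f y|)).
- by move=> n; solve_measurable2.
- by solve_measurable2.
- have ae0 : {ae mu, forall y : R, y != 0}.
    exists [set 0]; split => //; first exact: lebesgue_measure_set1.
    by move=> x /= /negP; rewrite negbK => /eqP.
  move: ae0; apply: filterS => [|y y0]; first exact: (ae_filter_ringOfSetsType mu).
  have [yn|yp] := ltP y 0; first by rewrite f0//; under eq_fun do rewrite mulr0; exact: cvg_cst.
  have {}yp : 0 < y by rewrite lt_neqAle eq_sym y0.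
  apply/cvgrPdist_lt => e e0.
  have /cvgrPdist_lt /(_ _ yp) := uc; apply: filterS => n /=.
  rewrite sub0r normrN gtr0_norm// => uy.
  by rewrite tpow_le0 ?mul0r ?subrr ?normr0// subr_le0 ltW.
- apply/integrable_fin_numP; first by solve_measurable2.
  by rewrite ge0_fin_numE// integral_ge0// => y _; rewrite lee_fin.
- move=> n y; rewrite normrM ger0_norm ?tpow_ge0// -[leRHS]mul1r ler_wpM2r//.
  by rewrite subrr /tpow powRr0; case: ifP.
Qed.

End integrable_half_line.

(** * Recovering a function from its fractional derivative *)

Section identification.
Variables (s T : R) (G h : R -> R) (c gam : R).
Hypotheses (s0 : 0 < s) (sh : s < 2^-1) (T0 : 0 < T) (gam0 : 0 < gam)
  (mG : measurable_fun [set: R] G) (G2 : (\int[mu]_y (G y ^+ 2)%:E < +oo)%E)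
  (Gsupp : forall x, ~~ (0 <= x <= T) -> G x = 0)
  (mh : measurable_fun [set: R] h) (h2 : (\int[mu]_y (h y ^+ 2)%:E < +oo)%E)
  (hsupp : forall x, ~~ (0 <= x <= T) -> h x = 0).
Hypothesis GE : {ae mu, forall t, 0 <= t <= T ->
  frac_int (1 - s) G t = gam * (c + frac_int 1 h t)}.

Let intG : (\int[mu]_y `|G y|%:E < +oo)%E.
Proof. exact: (integral_normr_lty mG G2 Gsupp). Qed.

Let inth : (\int[mu]_y `|h y|%:E < +oo)%E.
Proof. exact: (integral_normr_lty mh h2 hsupp). Qed.

Let neg_supp (f : R -> R) : (forall x, ~~ (0 <= x <= T) -> f x = 0) -> forall x, x < 0 -> f x = 0.
Proof. by move=> fs x x0; rewrite fs// negb_and -ltNge x0. Qed.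

Let B := fine (@Beta R 0 (- (2 * s))).
Let p := 1 - 2 * s.

(** Under the integral, [(t - y) ^ (- s) |G y| <= (t - y) ^ (- 2 s) + G y ^ 2]. As [2 s < 1], both
    resulting terms tend to 0 with [t]. *)
Let frac_int_le t : 0 < t ->
  `|frac_int (1 - s) G t| <= B * (2 `^ p * t `^ p) + frac_int 1 (fun y => G y ^+ 2) t.
Proof.
move: s0 sh => s0' sh' t0; rewrite -lee_fin.
have mn : measurable_fun [set: R] (fun y => tpow (1 - s - 1) (t - y) * G y) by solve_measurable2.
apply: (le_trans (@le_normr_Rintegral_ge0 _ _ _ mu _ mn)).
have BE : (fine (@Beta R 0 (- (2 * s))))%:E = Beta 0 (- (2 * s)).
  by rewrite EFin_fine_Beta ?ltrN10//; lra.
(* The integral starts at [- t] so that the majorant also holds at [y = 0], where a truncation at 0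
   would vanish; this is the origin of the power of 2. *)
have i1 : (\int[mu]_y (tpow 0 (y - (- t)) * tpow (- (2 * s)) (t - y))%:E = (B * (2 `^ p * t `^ p))%:E)%E.
  rewrite integral_tpow_between -BE -EFinM; congr (_ * _)%:E.
  have -> : t - - t = 2 * t by ring.
  rewrite tpowE; last by rewrite mulr_gt0.
  by rewrite powRM ?ltW//; congr (_ `^ _ * _ `^ _); rewrite /p; ring.
have i2 : (\int[mu]_y (tpow (1 - 1) (t - y) * G y ^+ 2)%:E = (frac_int 1 (fun y => G y ^+ 2) t)%:E)%E.
  rewrite /frac_int /Rintegral fineK// ge0_fin_numE; last first.
    by apply: integral_ge0 => y _; rewrite lee_fin; solve_ge0.
  apply: le_lt_trans G2; apply: ge0_le_integral => //.
  - by move=> y _; rewrite lee_fin; solve_ge0.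
  - by solve_measurable2.
  - by solve_measurable2.
  - move=> y _; rewrite lee_fin -[leRHS]mul1r ler_wpM2r ?sqr_ge0// subrr /tpow powRr0.
    by case: ifP.
rewrite EFinD -i1 -i2 -ge0_integralD//; last 4 first.
- by move=> y _; rewrite lee_fin; solve_ge0.
- by solve_measurable2.
- by move=> y _; rewrite lee_fin; solve_ge0.
- by solve_measurable2.
apply: ge0_le_integral => //.
- by solve_measurable2.
- by solve_measurable2.
- move=> y _; rewrite -EFinD lee_fin normrM (ger0_norm (tpow_ge0 _ _)).
  have [y0|y0] := ltP y 0.
    by rewrite (neg_supp Gsupp)// normr0 mulr0; apply: addr_ge0; solve_ge0.
  have [ty|yt] := leP t y; first by rewrite ![tpow _ (t - y)]tpow_le0 ?subr_le0// mul0r mulr0 mul0r addr0.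
  rewrite subrr ![tpow 0 _]tpowE ?subr_gt0//; last by rewrite (lt_le_trans _ y0)// oppr_lt0.
  rewrite !powRr0 !mul1r (_ : 1 - s - 1 = - s); last by ring.
  have -> : tpow (- (2 * s)) (t - y) = tpow (- s) (t - y) ^+ 2.
    by rewrite expr2 -tpowD; congr tpow; ring.
  rewrite -[G y ^+ 2]real_normK ?num_real//.
  have := sqr_ge0 (tpow (- s) (t - y) - `|G y|).
  have := sqr_ge0 (tpow (- s) (t - y) + `|G y|).
  by nra.
Qed.

Let normr_frac_int1_le t : `|frac_int 1 h t| <= frac_int 1 (fun y => `|h y|) t.
Proof.
have mn : measurable_fun [set: R] (fun y => tpow (1 - 1) (t - y) * h y) by solve_measurable2.
rewrite -lee_fin; apply: (le_trans (@le_normr_Rintegral_ge0 _ _ _ mu _ mn)).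
have H := @tpow_integral_lty h mh inth (neg_supp hsupp) (1 - 1) t ltac:(by rewrite subrr).
rewrite /frac_int /Rintegral (_ : (\int[mu]_y (tpow (1 - 1) (t - y) * `|h y|)%:E)%E =
   (\int[mu]_y `|tpow (1 - 1) (t - y) * h y|%:E)%E) ?fineK//.
  by rewrite ge0_fin_numE// integral_ge0// => y _; rewrite lee_fin.
by apply: eq_integral => y _; rewrite normrM (ger0_norm (tpow_ge0 _ _)).
Qed.

(* Near 0 both fractional integrals tend to 0. *)
Let c_eq0 : c = 0.
Proof.
move: s0 sh gam0 => s0' sh' gam0'.
apply: contrapT => /eqP c0.
have e0 : 0 < gam * `|c| by rewrite mulr_gt0// normr_gt0.
pose phi t := B * (2 `^ p * t `^ p) + frac_int 1 (fun y => G y ^+ 2) t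
  + gam * frac_int 1 (fun y => `|h y|) t.
have phi0 : phi t @[t --> 0^'+] --> 0.
  suff : phi t @[t --> 0^'+] --> B * (2 `^ p * 0) + 0 + gam * 0 by rewrite !mulr0 !addr0.
  apply: cvgD; last first.
    apply: cvgMr; apply: frac_int1_cvg0.
    - by solve_measurable2.
    - by under eq_integral do rewrite normr_id.
    - by move=> y y0; rewrite (neg_supp hsupp)// normr0.
  apply: cvgD; last first.
    apply: frac_int1_cvg0.
    - by solve_measurable2.
    - by under eq_integral do rewrite ger0_norm ?sqr_ge0//.
    - by move=> y y0; rewrite (neg_supp Gsupp)// expr0n.
  by apply: cvgMr; apply: cvgMr; apply: powR_cvg0; rewrite /p; lra.
have /cvgrPdist_lt /(_ _ e0) /at_right0_ltP[d d0 hd] := phi0.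
(* [GE] holds only almost everywhere, hence a point is selected in an interval of positive
   length. *)
have [|t [/andP[t0 td] tE]] := @ae_exists_itv _ 0 (Num.min d T) GE; first by rewrite lt_min d0.
move: td; rewrite lt_min => /andP[td tT].
have := hd t ltac:(by rewrite t0); rewrite sub0r normrN => /(le_lt_trans (ler_norm _)).
rewrite ltNge => /negP; apply.
have {}tE := tE ltac:(by rewrite !ltW).
have J1 := frac_int_le t0; have V1 := normr_frac_int1_le t.
rewrite -[X in X * _](gtr0_norm gam0) -normrM.
have -> : gam * c = frac_int (1 - s) G t - gam * frac_int 1 h t by rewrite tE; ring.
by rewrite (le_trans (ler_normB _ _))// lerD// normrM gtr0_norm// ler_wpM2l// ltW.
Qed.

Let beta := fine (@Beta R (1 - s - 1) (s - 1)).

Let beta_gt0 : 0 < beta.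
Proof.
by move: s0 sh => s0' sh'; rewrite fine_gt0// Beta_gt0 Beta_lty//; lra.
Qed.

Let v := frac_int s h.

Let mv : measurable_fun [set: R] v.
Proof. exact: measurable_frac_int. Qed.

Let frac_int_neg nu f : (forall x, ~~ (0 <= x <= T) -> f x = 0) ->
  forall x, x <= 0 -> frac_int nu f x = 0.
Proof.
move=> fs x x0; rewrite /frac_int /Rintegral integral0_eq// => y _.
have [y0|y0] := ltP y 0; first by rewrite (neg_supp fs)// mulr0.
by rewrite tpow_le0 ?mul0r// subr_le0 (le_trans x0).
Qed.

(** [frac_int s] is applied to both sides of [GE], with [c = 0]. The composed orders are 1 on the
    left and [1 + s] on the right, where the integrals of orders 1 and [s] are interchanged; the
    beta factors of both orders of composition agree by [BetaC]. *)
Let primitiveE t : t <= T -> beta * frac_int 1 G t = gam * frac_int 1 v t.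
Proof.
move: s0 sh => s0' sh' tT.
have := @frac_int_comp G mG intG (neg_supp Gsupp) (1 - s) s t.
have -> : 1 - s + s = 1 by ring.
move=> <-; [|lra|lra|lra].
transitivity (frac_int s (fun x => gam * frac_int 1 h x) t).
  apply: eq_frac_int_ae.
  - exact: measurable_frac_int.
  - by apply: measurable_funM; [exact: measurable_cst|exact: measurable_frac_int].
  - move: GE; apply: filterS => [|x xE xt]; first exact: (ae_filter_ringOfSetsType mu).
    have [x0|x0] := leP x 0; first by rewrite !frac_int_neg// mulr0.
    by rewrite xE ?c_eq0 ?add0r// ltW//= (le_trans (ltW xt)).
rewrite frac_intZ; last exact: measurable_frac_int.
apply: (congr1 (fun z => gam * z)).
rewrite (frac_int_comp mh inth (neg_supp hsupp)); [|lra|lra|lra].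
rewrite (frac_int_comp mh inth (neg_supp hsupp)); [|lra|lra|lra].
by rewrite BetaC (addrC s 1).
Qed.

(** The difference [D] of the two sides, up to the factor [beta], is integrable with zero integral
    over every half-line ]-oo, x]; by Lebesgue differentiation it vanishes almost everywhere. *)
Lemma frac_int_inversion :
  {ae mu, forall x, G x = gam / beta * (v x * tpow 0 (T - x))}.
Proof.
move: s0 sh => s0' sh'.
pose D x := beta * G x - gam * (v x * tpow 0 (T - x)).
have mvT : measurable_fun [set: R] (fun x => v x * tpow 0 (T - x)) by solve_measurable2.
have vneg y : y < 0 -> v y * tpow 0 (T - y) = 0.
  by move=> y0; rewrite /v frac_int_neg ?mul0r// ltW.
have intv : (\int[mu]_x `|(v x * tpow 0 (T - x))%R|%:E < +oo)%E.
  (* Integrability of [v] up to [T] comes from the Hardy inequality, by [|v| <= v ^ 2 (T - x) ^ (- 2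
     s) + (T - x) ^ (2 s)]. *)
  apply: (@ge0_integral_dom2 _ _ (fun x => v x ^+ 2 * tpow (- (2 * s)) (T - x))
     (fun x => tpow 0 (x - 0) * tpow (2 * s) (T - x)) 1 1) => //.
  - by solve_measurable2.
  - by solve_measurable2.
  - by solve_measurable2.
  - by move=> x; solve_ge0.
  - by move=> x; solve_ge0.
  - move=> x; rewrite !mul1r normrM (ger0_norm (tpow_ge0 _ _)) subr0.
    have [x0|x0] := leP x 0.
      by rewrite /v frac_int_neg// normr0 mul0r; apply: addr_ge0; solve_ge0.
    have [Tx|xT] := leP T x; first by rewrite ![tpow _ (T - x)]tpow_le0 ?subr_le0// !mulr0 addr0.
    rewrite [tpow 0 x]tpowE// powRr0 mul1r -[v x ^+ 2]real_normK ?num_real//.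
    have -> : tpow (- (2 * s)) (T - x) = tpow (- s) (T - x) ^+ 2.
      by rewrite expr2 -tpowD; congr tpow; ring.
    have -> : tpow (2 * s) (T - x) = tpow s (T - x) ^+ 2.
      by rewrite expr2 -tpowD; congr tpow; ring.
    have -> : tpow 0 (T - x) = tpow (- s) (T - x) * tpow s (T - x).
      by rewrite -tpowD; congr tpow; ring.
    rewrite -exprMn mulrA.
    have := sqr_ge0 (`|v x| * tpow (- s) (T - x) - tpow s (T - x)).
    have := sqr_ge0 (`|v x| * tpow (- s) (T - x) + tpow s (T - x)).
    by nra.
  - apply: (le_lt_trans (hardy s0 sh T mh)).
    by rewrite lte_mul_pinfty// lee_fin hardy_cst_ge0.
  - rewrite integral_tpow_between -EFin_fine_Beta ?ltrN10// -?EFinM ?ltry//; lra.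
have intble (f : R -> R) : measurable_fun [set: R] f -> (\int[mu]_x `|f x|%:E < +oo)%E -> mu.-integrable [set: R] (EFin \o f).
  by move=> mf fi; apply/integrableP; split; [exact/measurable_EFinP|exact: fi].
have intD : mu.-integrable [set: R] (EFin \o D).
  rewrite (_ : EFin \o D = (fun x => beta%:E * (G x)%:E - gam%:E * (v x * tpow 0 (T - x))%:E)%E); last first.
    by apply/funext => x; rewrite -!EFinM -EFinB.
  by apply: integrableB => //; apply: integrableZl => //; exact: intble.
have D0 x : \int[mu]_(t in `]-oo, x]) D t = 0.
  transitivity (frac_int 1 D x).
    rewrite Rintegral_mkcond /frac_int /Rintegral; congr fine.
    apply: (@eq_integral_but1 _ x).
    - by apply/measurable_EFinP; apply/(measurable_restrictT D) => //; apply: measurable_funTS; rewrite /D; solve_measurable2.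
    - by rewrite /D; solve_measurable2.
    - move=> t tx; congr EFin; rewrite patchE subrr /tpow powRr0 subr_gt0.
      case: ifPn; rewrite ?inE ?notin_setE/= in_itv/=.
        by rewrite le_eqVlt (negbTE tx)/= => ->; rewrite mul1r.
      by move=> /negP; rewrite -ltNge => xt; rewrite ltNge (ltW xt)/= mul0r.
  have key z : z <= T -> frac_int 1 D z = 0.
    move=> zT.
    have i1 : mu.-integrable [set: R] (EFin \o (fun t => beta * (tpow (1 - 1) (z - t) * G t))).
      rewrite (_ : EFin \o _ = fun t => (beta%:E * (tpow (1 - 1) (z - t) * G t)%:E)%E); last first.
        by apply/funext => t; rewrite -EFinM.
      apply: integrableZl => //; apply: intble; first by solve_measurable2.
      by apply: (tpow_integral_lty mG intG (neg_supp Gsupp)); rewrite subrr.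
    have i2 : mu.-integrable [set: R] (EFin \o (fun t => gam * (tpow (1 - 1) (z - t) * (v t * tpow 0 (T - t))))).
      rewrite (_ : EFin \o _ = fun t => (gam%:E * (tpow (1 - 1) (z - t) * (v t * tpow 0 (T - t)))%:E)%E); last first.
        by apply/funext => t; rewrite -EFinM.
      apply: integrableZl => //; apply: intble; first by solve_measurable2.
      by apply: (tpow_integral_lty mvT intv vneg); rewrite subrr.
    transitivity (\int[mu]_t (beta * (tpow (1 - 1) (z - t) * G t) - gam * (tpow (1 - 1) (z - t) * (v t * tpow 0 (T - t))))).
      by apply: eq_Rintegral => t _; rewrite /D; ring.
    rewrite RintegralB//.
    rewrite RintegralZ; last by solve_measurable2.
    rewrite RintegralZ; last by solve_measurable2.
    have := primitiveE zT; rewrite /frac_int => ->.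
    apply/eqP; rewrite subr_eq0; apply/eqP; apply: (congr1 (fun r => gam * r)).
    apply: eq_Rintegral => t _; rewrite subrr.
    have [zt|tz] := leP z t; first by rewrite tpow_le0 ?subr_le0// !mul0r.
    by rewrite [tpow 0 (T - t)]tpowE ?powRr0 ?mulr1// subr_gt0 (lt_le_trans tz).
  have [xT|Tx] := leP x T; first exact: key.
  (* [D] vanishes after [T], so its primitive keeps there its value at [T]. *)
  rewrite -(key T (lexx T)) /frac_int /Rintegral; congr fine.
  apply: (@eq_integral_but1 _ T).
  - by rewrite /D; solve_measurable2.
  - by rewrite /D; solve_measurable2.
  - move=> t tT; congr EFin; rewrite subrr; case: (ltgtP t T) tT => // [tT _|Tt _].
      have Tt0 : 0 < T - t by rewrite subr_gt0.
      have xt0 : 0 < x - t by rewrite subr_gt0 (lt_trans tT).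
      by rewrite (tpowE 0 xt0) (tpowE 0 Tt0) !powRr0.
    rewrite (_ : D t = 0) ?mulr0// /D Gsupp; last by rewrite negb_and -!ltNge Tt orbT.
    by rewrite tpow_le0 ?subr_le0 ?ltW// !mulr0 subrr.
have intDy y : mu.-integrable `]-oo, y] (EFin \o D) by apply: integrableS intD.
have := FTC1Ny intDy (open_integrable_locally openT intD).
apply: filterS => [|x]; first exact: (ae_filter_ringOfSetsType mu).
rewrite (_ : (fun _ => _) = cst 0); last by apply/funext.
rewrite derive1_cst => -[_ /esym/eqP].
rewrite subr_eq0 => /eqP GvE.
by rewrite mulrAC -GvE mulrC mulKf// gt_eqF.
Qed.

End identification.
End fractional_integrals.

(** * The variance of the Wiener integral *)

Section square_integrable_functions.
Context {R : realType}.
Local Notation mu := (@lebesgue_measure R).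

Lemma sqr_Lnorm2 (f : R -> R) :
  ('N[mu]_2%:E[EFin \o f] ^+ 2 = \int[mu]_x (f x ^+ 2)%:E)%E.
Proof.
have E : (\int[mu]_x (f x ^+ 2)%:E = 'N[mu]_2%:E[EFin \o f] `^ 2)%E.
  rewrite poweR_Lnorm ?pnatr_eq0//; apply: eq_integral => x _.
  transitivity ((`|f x| `^ 2)%:E); last by rewrite -poweR_EFin.
  by rewrite powR_mulrn// real_normK ?num_real.
rewrite E; have := Lnorm_ge0 mu 2%:E (EFin \o f).
case: ('N[mu]_2%:E[EFin \o f])%E => [r| |]// r0.
- by rewrite poweR_EFin powR_mulrn// expe2 -EFinM.
- by rewrite poweRyr ?pnatr_eq0// expe2 mulyy.
Qed.

Lemma Lfun2P (f : R -> R) : f \in Lfun mu 2%:E <->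
  measurable_fun [set: R] f /\ (\int[mu]_x (f x ^+ 2)%:E < +oo)%E.
Proof.
rewrite -sqr_Lnorm2; split => [|[mf f2]].
  rewrite inE => /andP[]; rewrite !inE/= => mf; rewrite /finite_norm => fN; split => //.
  have := Lnorm_ge0 mu 2%:E (EFin \o f).
  move: fN; case: ('N[mu]_2%:E[EFin \o f])%E => [r| |]// _ _.
  by rewrite ?expe2 -EFinM ltry.
rewrite inE; apply/andP; rewrite !inE/=; split => //; rewrite /finite_norm.
have := Lnorm_ge0 mu 2%:E (EFin \o f).
move: f2; case: ('N[mu]_2%:E[EFin \o f])%E => [r| |]//; by move=> *; exact: ltry.
Qed.

Lemma restrict_supp (T : R) (f : R -> R) x : ~~ (0 <= x <= T) -> (f \_ `[0, T]) x = 0.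
Proof. by move=> xT; rewrite patchE memNset//= in_itv/=; exact/negP. Qed.

Lemma restrict_reflect (T : R) (g : R -> R) :
  (fun r => g (T - r)) \_ `[0, T] = (fun x => (g \_ `[0, T]) (T - x)).
Proof.
apply/funext => x; rewrite !patchE; congr (if _ then _ else _).
by apply/idP/idP; rewrite !inE/= !in_itv/= => /andP[? ?]; apply/andP; split; lra.
Qed.

Lemma integral_restrict_sqr (T : R) (f : R -> R) :
  (\int[mu]_x ((f \_ `[0, T]) x ^+ 2)%:E = \int[mu]_(x in `[0%R, T]) (f x ^+ 2)%:E)%E.
Proof.
rewrite [RHS]integral_mkcond; apply: eq_integral => x _.
by rewrite !patchE; case: ifP => // _; rewrite expr0n.
Qed.

Lemma L2_on_reflect (T : R) (g : R -> R) : L2_on T g -> L2_on T (fun r => g (T - r)).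
Proof.
rewrite /L2_on restrict_reflect => /Lfun2P[mg g2]; apply/Lfun2P; split; first by solve_measurable2.
rewrite (@ge0_integral_reflect _ T (fun x => ((g \_ `[0, T]) x ^+ 2)%:E)) => //.
- by solve_measurable2.
- by move=> x; rewrite lee_fin sqr_ge0.
Qed.

End square_integrable_functions.

Section integrands.
Context {R : realType}.
Local Notation mu := (@lebesgue_measure R).
Variables T H : R.

Lemma integrand_prod_lt (g : R -> R) : H < 2^-1 ->
  integrand_prod T H g g =
  ((2^-1 * H * (1 - 2 * H))%:E * gagliardo ((1 - 2 * H) / 2) (g \_ `[0%R, T]))%E.
Proof.
move=> Hh; rewrite /integrand_prod Hh /gagliardo; cbv iota.
apply: (congr1 (fun z => ((2^-1 * H * (1 - 2 * H))%:E * z)%E)).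
apply: eq_integral => x _; apply: eq_integral => y _; rewrite expr2.
by congr (_ / _ `^ _)%:E; field.
Qed.

Lemma integrand_prod_gt (g : R -> R) : 2^-1 < H ->
  integrand_prod T H g g =
  ((H * (2 * H - 1))%:E * \int[mu]_x \int[mu]_y
    ((g \_ `[0%R, T]) x * (g \_ `[0%R, T]) y * `|x - y| `^ (2 * H - 2))%:E)%E.
Proof.
move=> Hh; rewrite /integrand_prod ltNge (ltW Hh) (gt_eqF Hh); cbv iota.
apply: (congr1 (fun z => ((H * (2 * H - 1))%:E * z)%E)).
rewrite integral_mkcond; apply: eq_integral => x _; rewrite !patchE.
case: ifP => _; last by rewrite integral0_eq// => y _; rewrite !mul0r.
rewrite integral_mkcond; apply: eq_integral => y _; rewrite !patchE.
by case: ifP => // _; rewrite mulr0 mul0r.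
Qed.

Lemma integrand_prod_eq (g : R -> R) : H = 2^-1 ->
  integrand_prod T H g g = (\int[mu]_x ((g \_ `[0, T]) x ^+ 2)%:E)%E.
Proof.
move=> Hh; rewrite /integrand_prod Hh ltxx eqxx integral_restrict_sqr.
by apply: eq_integral => x _; rewrite expr2.
Qed.

Lemma integrand_reflect (g : R -> R) : integrand T H g -> integrand T H (fun r => g (T - r)).
Proof.
rewrite /integrand; case: ifP => _; last exact: L2_on_reflect.
move=> [L2g Sg]; split; first exact: L2_on_reflect.
rewrite restrict_reflect; have [mg _] := (Lfun2P _).1 L2g.
have := gagliardo_reflect ((1 - 2 * H) / 2) T mg; rewrite /gagliardo => ->; exact: Sg.
Qed.

(** Both kernels depend on [|x - y|] only, which reflection preserves. *)
Lemma integrand_prod_reflect (g : R -> R) : L2_on T g ->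
  integrand_prod T H (fun r => g (T - r)) (fun r => g (T - r)) = integrand_prod T H g g.
Proof.
move=> /Lfun2P[mg g2]; have [Hh|Hh|Hh] := ltgtP H 2^-1.
- apply: (eq_trans (integrand_prod_lt _ Hh)); apply: (eq_trans _ (esym (integrand_prod_lt _ Hh))).
  apply: (congr1 (fun z => ((2^-1 * H * (1 - 2 * H))%:E * z)%E)); rewrite restrict_reflect.
  exact: gagliardo_reflect.
- apply: (eq_trans (integrand_prod_gt _ Hh)); apply: (eq_trans _ (esym (integrand_prod_gt _ Hh))).
  apply: (congr1 (fun z => ((H * (2 * H - 1))%:E * z)%E)); rewrite restrict_reflect.
  set G := g \_ `[0, T].
  have mG : measurable_fun [set: R * R] (fun z => G z.1 * G z.2 * `|z.1 - z.2| `^ (2 * H - 2)).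
    by solve_measurable2.
  rewrite -[RHS](@integral_reflect _ T); last exact: (@measurable_integral2 _ (fun x y => G x * G y * `|x - y| `^ (2 * H - 2))).
  apply: eq_integral => x _.
  rewrite -[RHS](@integral_reflect _ T); last by solve_measurable2.
  apply: eq_integral => y _; congr (_ * _ `^ _)%:E.
  by rewrite (_ : T - x - (T - y) = - (x - y)) ?normrN//; ring.
- rewrite !integrand_prod_eq// restrict_reflect.
  rewrite (@ge0_integral_reflect _ T (fun x => ((g \_ `[0, T]) x ^+ 2)%:E)) => //.
  + by solve_measurable2.
  + by move=> x; rewrite lee_fin sqr_ge0.
Qed.

End integrands.

(** * Energy bounds in the three regimes *)

Section energy_bounds.
Context {R : realType}.
Local Notation mu := (@lebesgue_measure R).
Variables T H : R.
Hypotheses (T0 : 0 < T) (H01 : 0 < H < 1).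

(** Membership in the space of integrands is part of the claim: the isometry is available for
    integrands only, and for H < 1/2 the finiteness of the seminorm follows from the bound. *)
Let bounded_by (C : R) := forall g Dg : R -> R,
  L2_on T g -> is_RL T ((1 - 2 * H) / 2) g Dg -> L2_on T Dg ->
  integrand T H g /\
  (integrand_prod T H g g <= C%:E * \int[mu]_x ((Dg \_ `[0, T]) x ^+ 2)%:E)%E.

Lemma energy_bound_eq : H = 2^-1 -> bounded_by 1.
Proof.
move=> Hh g Dg L2g; rewrite /is_RL /integrand integrand_prod_eq// Hh.
rewrite (_ : (1 - 2 * 2^-1) / 2 = 0 :> R); last by field.
rewrite !ltxx eqxx => RL L2D; split => //.
have [mg _] := (Lfun2P _).1 L2g; have [mD _] := (Lfun2P _).1 L2D.
rewrite mul1e le_eqVlt; apply/orP; left; apply/eqP.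
apply: ae_eq_integral => //; [by solve_measurable2|by solve_measurable2|].
move: RL; apply: filterS => [|x xE _]; first exact: (ae_filter_ringOfSetsType mu).
rewrite !patchE; case: ifPn => //; rewrite inE/= => xT.
by rewrite xE.
Qed.

Lemma energy_bound_gt : 2^-1 < H -> exists2 C, 0 <= C & bounded_by C.
Proof.
move: H01 => /andP[H0 H1] Hh; pose nu := H - 2^-1.
have nu0 : 0 < nu by rewrite subr_gt0.
have nuh : nu < 2^-1 by rewrite /nu; lra.
have gam0 : 0 < Gamma nu by apply: Gamma_gt0; rewrite nu0/=; lra.
set K := 4 * (fine (@Beta' R (nu - 1) (nu - 1)) + 1) / fine (@Beta R (nu - 1) (nu - 1)) ^+ 2.
have K0 : 0 <= K.
  by rewrite divr_ge0 ?sqr_ge0// mulr_ge0// addr_ge0// fine_ge0// Beta'_ge0.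
have c0 : 0 <= H * (2 * H - 1) by rewrite mulr_ge0//; lra.
exists (H * (2 * H - 1) * (K * Gamma nu ^+ 2)).
  by rewrite mulr_ge0// mulr_ge0// sqr_ge0.
move=> g Dg L2g RL L2D; split; first by rewrite /integrand ltNge (ltW Hh).
have [mg g2] := (Lfun2P _).1 L2g; have [mD _] := (Lfun2P _).1 L2D.
rewrite integrand_prod_gt// (EFinM (H * (2 * H - 1))) -muleA lee_wpmul2l ?lee_fin//.
pose J := frac_int nu (g \_ `[0, T]).
have mJ : measurable_fun [set: R] J by exact: measurable_frac_int.
have mJT : measurable_fun [set: R] (J \_ `[0, T]).
  by apply/(measurable_restrictT J) => //; apply: measurable_funTS.
have : (\int[mu]_x \int[mu]_y ((g \_ `[0%R, T]) x * (g \_ `[0%R, T]) y * `|x - y| `^ (2 * H - 2))%:E <=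
    K%:E * \int[mu]_x ((J \_ `[0%R, T]) x ^+ 2)%:E)%E.
  have := riesz_energy_bound mg g2 (@restrict_supp _ T g) nu0 nuh.
  rewrite integral_restrict_sqr (_ : 2 * nu - 1 = 2 * H - 2); first exact.
  by rewrite /nu; field.
move=> /le_trans; apply; rewrite (EFinM K) -muleA lee_wpmul2l ?lee_fin//.
rewrite -ge0_integralZl//; last 3 first.
- by solve_measurable2.
- by move=> x _; rewrite lee_fin sqr_ge0.
- by rewrite lee_fin sqr_ge0.
rewrite le_eqVlt; apply/orP; left; apply/eqP.
apply: ae_eq_integral => //; [by solve_measurable2|by solve_measurable2|].
move: RL; rewrite /is_RL ifF; last by apply/negbTE; rewrite -leNgt; lra.
rewrite ifF; last by apply/negbTE/eqP; lra.
apply: filterS => [|t tE _]; first exact: (ae_filter_ringOfSetsType mu).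
rewrite -EFinM -exprMn !patchE; case: ifPn; last by rewrite mulr0.
rewrite inE/= in_itv/= => tT; congr ((_ ^+ 2)%:E).
rewrite tE ?in_itv//= (_ : - ((1 - 2 * H) / 2) = nu); last by rewrite /nu; field.
rewrite (@RL_integral_frac_int _ _ T)//; last by apply/eqP; lra.
by rewrite mulrA mulfV ?mul1r// gt_eqF.
Qed.

Lemma energy_bound_lt : H < 2^-1 -> exists2 C, 0 <= C & bounded_by C.
Proof.
move: H01 => /andP[H0 H1] Hh; pose s := (1 - 2 * H) / 2.
have s0 : 0 < s by rewrite /s; lra.
have sh : s < 2^-1 by rewrite /s; lra.
have gam0 : 0 < Gamma (1 - s) by apply: Gamma_gt0; apply/andP; split; lra.
(* The factor between the extension of [g] and the cut-off potential in [frac_int_inversion]. *)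
pose kap := Gamma (1 - s) / fine (@Beta R (1 - s - 1) (s - 1)).
pose c := 2^-1 * H * (1 - 2 * H).
have c0 : 0 <= c by rewrite /c !mulr_ge0//; lra.
have E0 : 0 <= energy_cst s by exact: energy_cst_ge0.
exists (c * (kap ^+ 2 * energy_cst s)); first by rewrite mulr_ge0// mulr_ge0// sqr_ge0.
move=> g Dg L2g; rewrite /is_RL -/s s0 => -[intD [k RL]] L2D.
have [mg g2] := (Lfun2P _).1 L2g; have [mD D2] := (Lfun2P _).1 L2D.
set h := Dg \_ `[0, T] in mD D2 *.
have GE : {ae mu, forall t, 0 <= t <= T ->
    frac_int (1 - s) (g \_ `[0, T]) t = Gamma (1 - s) * (k + frac_int 1 h t)}.
  move: RL; apply: filterS => [|t tE tT]; first exact: (ae_filter_ringOfSetsType mu).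
  have := tE ltac:(by rewrite in_itv); rewrite (@RL_integral_frac_int _ _ T)//; last by apply/eqP; lra.
  move=> /(congr1 (fun z => Gamma (1 - s) * z)); rewrite mulrA mulfV ?mul1r ?gt_eqF// => ->.
  congr (_ * (_ + _)).
  have ht : Dg \_ `[0, t] = h \_ `[0, t].
    apply/funext => y; rewrite /h !patchE; case: ifPn => //; rewrite inE/= in_itv/= => /andP[y0 yt].
    by rewrite mem_set//= in_itv/= y0 (le_trans yt)//; case/andP: tT.
  rewrite Rintegral_mkcond ht /frac_int /Rintegral; congr fine.
  apply: (@eq_integral_but1 _ t).
  - by apply/measurable_EFinP; apply/(measurable_restrictT h) => //; exact: measurable_funTS.
  - by solve_measurable2.
  - move=> y yt; congr EFin; rewrite patchE subrr /tpow powRr0 subr_gt0.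
    case: ifPn; rewrite ?inE ?notin_setE/= in_itv/=.
      by move=> /andP[_]; rewrite le_eqVlt (negbTE yt)/= => ->; rewrite mul1r.
    move=> /negP; rewrite negb_and -!ltNge => /orP[y0|ty].
      by rewrite /h restrict_supp ?mulr0// negb_and -ltNge y0.
    by rewrite ltNge (ltW ty)/= mul0r.
have vE := frac_int_inversion s0 sh T0 gam0 mg g2 (@restrict_supp _ T g) mD D2 (@restrict_supp _ T Dg) GE.
have mu_ : measurable_fun [set: R] (fun x => frac_int s h x * tpow 0 (T - x)).
  by apply: measurable_funM; [exact: measurable_frac_int|solve_measurable2].
have S : (gagliardo s (g \_ `[0%R, T]) <= (kap ^+ 2 * energy_cst s)%:E * \int[mu]_x (h x ^+ 2)%:E)%E.
  rewrite (eq_gagliardo_ae _ mg _ vE); last first.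
    by apply: measurable_funM; [exact: measurable_cst|exact: mu_].
  rewrite gagliardoZ// (EFinM (kap ^+ 2)) -muleA lee_wpmul2l ?lee_fin ?sqr_ge0//.
  exact: (gagliardo_frac_int_cut s0 sh mD D2 (@restrict_supp _ T Dg)).
split.
  rewrite /integrand Hh; split; first exact: L2g.
  apply: (le_lt_trans S); rewrite lte_mul_pinfty// lee_fin.
  by apply: mulr_ge0; [exact: sqr_ge0|exact: E0].
by rewrite integrand_prod_lt// (EFinM c) -muleA lee_wpmul2l ?lee_fin.
Qed.

End energy_bounds.

Unset Implicit Arguments.

Theorem lemma4 (R : realType) (d : measure_display) (Omega : measurableType d)
    (P : probability Omega R) (T H : R) (W : R -> {RV P >-> R})
    (I : (R -> R) -> Omega -> R) :
  0 < T -> 0 < H < 1 -> is_fBm P H W -> is_wiener_integral P T H W I ->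
  exists C : R, 0 < C /\
    forall g Dg : R -> R,
      L2_on T g -> is_RL T ((1 - 2 * H) / 2) g Dg -> L2_on T Dg ->
      ('E_P[I g \* I g] <= C%:E * L2_norm_on T Dg ^+ 2)%E /\
      ('E_P[I (fun r => g (T - r)%R) \* I (fun r => g (T - r)%R)]
         <= C%:E * L2_norm_on T Dg ^+ 2)%E.
Proof.
move=> T0 H01 _ WI.
(* The regime is settled before [g] is introduced, so that [C] does not depend on it. *)
have [C C0 CP] : exists2 C : R, 0 <= C & forall g Dg : R -> R,
  L2_on T g -> is_RL T ((1 - 2 * H) / 2) g Dg -> L2_on T Dg ->
  integrand T H g /\
  (integrand_prod T H g g <= C%:E * \int[lebesgue_measure]_x ((Dg \_ `[0, T]) x ^+ 2)%:E)%E.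
  have [Hh|Hh|Hh] := ltgtP H 2^-1.
  - exact: energy_bound_lt.
  - exact: energy_bound_gt.
  - by exists 1 => //; exact: energy_bound_eq.
(* [C] is only nonnegative; adding 1 makes the constant positive. *)
exists (C + 1); split; first exact: ltr_wpDl.
move=> g Dg L2g RL L2D; have [Ig gC] := CP g Dg L2g RL L2D.
have bound : (integrand_prod T H g g <= (C + 1)%:E * L2_norm_on T Dg ^+ 2)%E.
  apply: (le_trans gC); rewrite /L2_norm_on sqr_Lnorm2 lee_wpmul2r ?lee_fin ?lerDl//.
  by apply: integral_ge0 => x _; rewrite lee_fin sqr_ge0.
have Ir := integrand_reflect Ig; split.
  by rewrite (wiener_isometry WI Ig Ig).
by rewrite (wiener_isometry WI Ir Ir) integrand_prod_reflect.
Qed.
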